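(* Let $n\geq 2$ and let $B$ be a ball of $\mathbb{R}^n$ of radius $1$. There exist two constants $\delta>0$ and $C>0$, depending only on $n$, such that for every open, bounded and convex set $\Omega\subset\mathbb{R}^n$ with $|\Omega|=|B|$ and $P(\Omega)-P(B)<\delta$, it holds $$\mathcal{A}_F(\Omega)\geq C\,\bigl(P(\Omega)-P(B)\bigr).$$
   Context: $|\cdot|$ denotes Lebesgue measure in $\mathbb{R}^n$. $P(\Omega)$ denotes the perimeter of $\Omega$ in the De Giorgi sense; for a bounded open convex set, $P(\Omega)=\mathcal{H}^{n-1}(\partial\Omega)$. $\mathcal{A}_F(\Omega)$ is the Fraenkel asymmetry of $\Omega$, $$\mathcal{A}_F(\Omega)=\min_{x\in\mathbb{R}^n}\left\{\frac{|\Omega\,\Delta\, B_R(x)|}{|\Omega|} \;:\; B_R(x)\text{ is the ball centered at }x\text{ with } |B_R(x)|=|\Omega|\right\},$$ where $\Delta$ denotes the symmetric difference of sets. *)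

(* Defs.v *)
From HB Require Import structures.
From mathcomp Require Import all_boot all_order all_algebra.
From mathcomp Require Import all_classical all_reals all_analysis.
From mathcomp Require Import measurable_realfun.

Set Implicit Arguments.
Unset Strict Implicit.
Unset Printing Implicit Defensive.

Import Order.TTheory GRing.Theory Num.Theory.
Import numFieldNormedType.Exports.

Local Open Scope classical_set_scope.
Local Open Scope ring_scope.

(* R^n is 'rV[R]_n, with the sigma-algebra generated by the coordinates (as for
   n.-tuple T in the library), i.e. the Borel one: see open_measurable_rV. *)
Definition measure_rV_display : measure_display. Proof. by []. Qed.

Section measurable_rV.
Context (R : realType) (n : nat).

Let coors : 'I_n -> 'rV[R]_n -> measurableTypeR R := fun i v => v ord0 i.

Let rV_set0 : g_sigma_preimage coors set0.
Proof. exact: sigma_algebra0. Qed.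

Let rV_setC A : g_sigma_preimage coors A -> g_sigma_preimage coors (~` A).
Proof. exact: sigma_algebraC. Qed.

Let rV_bigcup (F : (set 'rV[R]_n)^nat) :
  (forall i, g_sigma_preimage coors (F i)) ->
  g_sigma_preimage coors (\bigcup_i (F i)).
Proof. exact: sigma_algebra_bigcup. Qed.

HB.instance Definition _ := @isMeasurable.Build measure_rV_display
  'rV[R]_n (g_sigma_preimage coors) rV_set0 rV_setC rV_bigcup.

Lemma measurable_coord_rV (i : 'I_n) :
  measurable_fun [set: 'rV[R]_n] (fun v => v ord0 i : measurableTypeR R).
Proof.
move=> _ Y mY; rewrite setTI; apply: sub_sigma_algebra => /=.
rewrite -bigcup_seq/=; exists i => /=; first by rewrite mem_index_enum.
by exists Y => //; rewrite setTI.
Qed.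

Lemma measurable_fun_rV d (T : measurableType d) (f : T -> 'rV[R]_n) :
  (forall i, measurable_fun [set: T] (fun t => f t ord0 i : measurableTypeR R)) ->
  measurable_fun [set: T] f.
Proof.
move=> mf.
have : g_sigma_preimage (fun i => coors i \o f) `<=` measurable.
  apply: smallest_sub; first exact: sigma_algebra_measurable.
  rewrite -bigcup_seq; apply: bigcup_sub => i _ _ [B mB <-].
  exact: mf.
rewrite g_sigma_preimage_comp => h _ A mA; apply: h.
by exists A.
Qed.

End measurable_rV.

Section open_measurable.
Context (R : realType) (n : nat).

Let ratball (q : 'rV[rat]_n * rat) : set 'rV[R]_n :=
  ball (map_mx ratr q.1 : 'rV[R]_n) (ratr q.2 : R).

Let measurable_ratball q : measurable (ratball q).
Proof.
have [q0|q0] := ltP 0 (ratr q.2 : R); last first.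
  rewrite (_ : ratball q = set0)//; apply/seteqP; split => // x [q0'].
  by rewrite ltNge q0 in q0'.
rewrite (_ : ratball q = \big[setI/[set: 'rV[R]_n]]_(i < n)
    [set v : 'rV[R]_n | (ball (ratr (q.1 ord0 i) : R) (ratr q.2)) (v ord0 i)]).
  apply: bigsetI_measurable => i _.
  have := @measurable_coord_rV R n i measurableT
    (ball (ratr (q.1 ord0 i) : R) (ratr q.2)).
  rewrite setTI; apply; apply: open_measurable; exact: ball_open.
apply/seteqP; split => [x [_ xq]|x].
  by rewrite -bigcap_seq => i _ /=; have := xq ord0 i; rewrite mxE.
rewrite -bigcap_seq => xq; split => // i j; rewrite ord1 mxE.
by apply: xq; rewrite /= mem_index_enum.
Qed.

Lemma open_measurable_rV (U : set 'rV[R]_n) : open U -> measurable U.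
Proof.
move=> oU.
rewrite (_ : U = \bigcup_(q in [set q | ratball q `<=` U]) ratball q); last first.
  apply/seteqP; split => [x Ux|x [q /= qU /qU//]].
  have /nbhs_ballP[e /= e0 xeU] : nbhs x U by exact: open_nbhs_nbhs.
  have [r /= /[!in_itv]/= /andP[r0 re]] :
    exists r : rat, ratr r \in `]0, (e / 2)[.
    by apply: rat_in_itvoo; exact: divr_gt0.
  have /choice[f fP] i : exists q : rat, `|x ord0 i - ratr q| < ratr r.
    have /rat_in_itvoo[q] : x ord0 i - ratr r < x ord0 i + ratr r.
      by rewrite ltrBlDr -addrA ltrDl addr_gt0.
    by rewrite in_itv/= => /andP[q1 q2]; exists q; rewrite ltr_distlC q1 q2.
  have xr : ratball (\row_i f i, r) x.
    split => // i j; rewrite ord1 !mxE /ball/= distrC; exact: fP.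
  exists (\row_i f i, r) => //= y yr; apply: xeU.
  rewrite (splitr e); apply: le_ball; last first.
    apply: (@ball_triangle _ _ (map_mx ratr (\row_i f i) : 'rV[R]_n)).
      by apply: ball_sym; exact: xr.
    exact: yr.
  by rewrite lerD// ltW.
rewrite bigcup_mkcond; apply: countable_bigcupT_measurable => // q.
by case: ifP.
Qed.

End open_measurable.

(* Product of n copies of the one-dimensional Lebesgue measure; the row
   (x, v_1, ..., v_n) is row_mx x%:M v : 'rV_(1 + n). *)
Definition consrV (R : realType) (n : nat)
  (p : measurableTypeR R * 'rV[R]_n) : 'rV[R]_n.+1 :=
  row_mx (p.1%:M : 'rV[R]_1) p.2.

Fixpoint lebesgue_rV (R : realType) (n : nat) : set 'rV[R]_n -> \bar R :=
  match n with
  | 0 => dirac (0 : 'rV[R]_0)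
  | m.+1 => pushforward (lebesgue_measure \x @lebesgue_rV R m)%E (@consrV R m)
  end.

Section lebesgue_rV_measure.
Context (R : realType).
Local Open Scope ereal_scope.

Lemma consrV0 n (x : R) (v : 'rV[R]_n) : consrV (x, v) ord0 ord0 = x.
Proof.
transitivity (row_mx (x%:M : 'rV[R]_1) v ord0 (lshift n ord0)).
  by congr (row_mx _ _ _ _); exact/val_inj.
by rewrite row_mxEl mxE eqxx mulr1n.
Qed.

Lemma consrVS n (x : R) (v : 'rV[R]_n) i :
  consrV (x, v) ord0 (lift ord0 i) = v ord0 i.
Proof.
transitivity (row_mx (x%:M : 'rV[R]_1) v ord0 (rshift 1 i)).
  by congr (row_mx _ _ _ _); exact/val_inj.
by rewrite row_mxEr.
Qed.

Lemma measurable_consrV n : measurable_fun setT (@consrV R n).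
Proof.
apply: measurable_fun_rV => i.
have [j ->|->] := unliftP ord0 i.
  rewrite [X in measurable_fun _ X](_ : _ =
      (fun v : 'rV[R]_n => v ord0 j : measurableTypeR R) \o snd); last first.
    by apply/funext => -[x v]; rewrite consrVS.
  apply: (@measurableT_comp _ _ _ _ _ _
    (fun v : 'rV[R]_n => v ord0 j : measurableTypeR R)) => //.
  exact: measurable_coord_rV.
rewrite [X in measurable_fun _ X](_ : _ = fst)//.
by apply/funext => -[x v]; rewrite consrV0.
Qed.

Let unconsrV n (v : 'rV[R]_n.+1) : measurableTypeR R * 'rV[R]_n :=
  (v ord0 ord0, \row_j v ord0 (lift ord0 j)).

Let consrVK n : cancel (@consrV R n) (@unconsrV n).
Proof.
move=> [x v]; rewrite /unconsrV consrV0; congr pair.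
by apply/rowP => j; rewrite mxE consrVS.
Qed.

Let measurable_unconsrV n : measurable_fun setT (@unconsrV n).
Proof.
apply/measurable_fun_pair; first exact: measurable_coord_rV.
apply: measurable_fun_rV => i.
rewrite [X in measurable_fun _ X](_ : _ =
  (fun v : 'rV[R]_n.+1 => v ord0 (lift ord0 i) : measurableTypeR R)).
  exact: measurable_coord_rV.
by apply/funext => v; rewrite mxE.
Qed.

Let lebesgue_rV_sigma_finite n :
  {m : {sigma_finite_measure set 'rV[R]_n -> \bar R} |
     m = @lebesgue_rV R n :> (set 'rV[R]_n -> \bar R)}.
Proof.
elim: n => [|n [m mE]]; first by exists (dirac (0%R : 'rV[R]_0)).
pose p : {measure set (measurableTypeR R * 'rV[R]_n)%type -> \bar R} :=
  lebesgue_integral_fubini_product_measure1__canonical__measure_function_Measure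
    (@lebesgue_measure R) m.
pose q : {measure set 'rV[R]_n.+1 -> \bar R} :=
  measure_function_pushforward__canonical__measure_function_Measure
    p (@measurable_consrV n).
have qsigma : sigma_finite setT q.
  have /sigma_finiteP[F [FT ndF Foo]] := sigma_finiteT (@lebesgue_measure R).
  have /sigma_finiteP[G [GT ndG Goo]] := sigma_finiteT m.
  exists (fun i => @unconsrV n @^-1` (F i `*` G i)).
    rewrite -preimage_bigcup (_ : \bigcup_i _ = setT) ?preimage_setT//.
    apply/seteqP; split => // -[x v] _.
    have [k _ Fkx] : (\bigcup_i F i) x by rewrite -FT.
    have [l _ Glv] : (\bigcup_i G i) v by rewrite -GT.
    exists (maxn k l) => //; split => /=.
      by move: x Fkx; exact/subsetPset/ndF/leq_maxl.
    by move: v Glv; exact/subsetPset/ndG/leq_maxr.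
  move=> i; have [mF pF] := Foo i; have [mG pG] := Goo i; split.
    rewrite -[X in measurable X]setTI.
    by apply: measurable_unconsrV => //; exact: measurableX.
  rewrite /q/= /pushforward -comp_preimage (_ : _ \o _ = id); last first.
    by apply/funext => z /=; rewrite consrVK.
  by rewrite /p/= product_measure1E// lte_mul_pinfty// ge0_fin_numE.
pose Q : {sigma_finite_measure set 'rV[R]_n.+1 -> \bar R} :=
  HB.pack (q : set _ -> \bar R) (Measure.class q)
    (Measure_isSigmaFinite.Build _ _ _ (q : set _ -> \bar R) qsigma).
exists Q.
by rewrite /= -mE.
Qed.

Let lebesgue_rV0 n : @lebesgue_rV R n set0 = 0.
Proof. by have [m <-] := lebesgue_rV_sigma_finite n. Qed.

Let lebesgue_rV_ge0 n A : 0 <= @lebesgue_rV R n A.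
Proof. by have [m <-] := lebesgue_rV_sigma_finite n. Qed.

Let lebesgue_rV_semi_sigma_additive n : semi_sigma_additive (@lebesgue_rV R n).
Proof.
have [m <-] := lebesgue_rV_sigma_finite n.
exact: measure_semi_sigma_additive.
Qed.

HB.instance Definition _ n := isMeasure.Build _ _ _ (@lebesgue_rV R n)
  (@lebesgue_rV0 n) (@lebesgue_rV_ge0 n) (@lebesgue_rV_semi_sigma_additive n).

Let lebesgue_rV_sigma_finiteT n : sigma_finite setT (@lebesgue_rV R n).
Proof.
have [m <-] := lebesgue_rV_sigma_finite n.
exact: sigma_finiteT.
Qed.

HB.instance Definition _ n := Measure_isSigmaFinite.Build _ _ _
  (@lebesgue_rV R n) (@lebesgue_rV_sigma_finiteT n).

Let box n (a b : 'rV[R]_n) : set 'rV[R]_n :=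
  [set v | forall i, (a ord0 i < v ord0 i < b ord0 i)%R].

Let measurable_box n (a b : 'rV[R]_n) : measurable (box a b).
Proof.
rewrite (_ : box a b = \big[setI/[set: 'rV[R]_n]]_(i < n)
    [set v : 'rV[R]_n | `]a ord0 i, b ord0 i[%classic (v ord0 i)]).
  apply: bigsetI_measurable => i _.
  have := @measurable_coord_rV R n i measurableT `]a ord0 i, b ord0 i[%classic.
  by rewrite setTI; apply; exact: measurable_itv.
apply/seteqP; split => x; rewrite -bigcap_seq => xab i.
  by move=> _ /=; rewrite in_itv/=; exact: xab.
by have := xab i; rewrite /= mem_index_enum in_itv/=; apply.
Qed.

Lemma lebesgue_rV_box n (a b : 'rV[R]_n) : (forall i, a ord0 i <= b ord0 i)%R ->
  lebesgue_rV [set v : 'rV[R]_n | forall i, (a ord0 i < v ord0 i < b ord0 i)%R] =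
  (\prod_i (b ord0 i - a ord0 i))%:E.
Proof.
elim: n a b => [|n IH] a b ab.
  by rewrite big_ord0 /lebesgue_rV diracE mem_set//= => -[].
pose a' : 'rV[R]_n := \row_j a ord0 (lift ord0 j).
pose b' : 'rV[R]_n := \row_j b ord0 (lift ord0 j).
rewrite big_ord_recl.
rewrite [LHS](_ : _ = (lebesgue_measure \x @lebesgue_rV R n)
    (`]a ord0 ord0, b ord0 ord0[%classic `*` box a' b')); last first.
  rewrite /= /pushforward; congr product_measure1.
  apply/seteqP; split => [[x v] /= h|[x v] /= [x_ab h] i].
    split; first by have := h ord0; rewrite consrV0 /= in_itv.
    by move=> i; have := h (lift ord0 i); rewrite consrVS !mxE.
  have [j ->|->] := unliftP ord0 i.
    by rewrite consrVS; have := h j; rewrite !mxE.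
  by rewrite consrV0; move: x_ab; rewrite /= in_itv.
rewrite product_measure1E//=; last exact: measurable_box.
rewrite IH => [|i]; last by rewrite !mxE.
rewrite lebesgue_measure_itv/= lte_fin EFinM; congr (_ * _%:E).
  case: ltP => [//|ba].
  by rewrite (@le_anti _ _ (a ord0 ord0) (b ord0 ord0)) ?ab ?ba// subrr.
by apply: eq_bigr => i _; rewrite !mxE.
Qed.

End lebesgue_rV_measure.

Section perimeter.
Context (R : realType) (n : nat).
Implicit Types (E : set 'rV[R]_n) (x : 'rV[R]_n) (phi : 'rV[R]_n -> 'rV[R]_n).

(* The canonical norm `|x| on 'rV[R]_n is the sup norm: it gives the Euclidean
   topology, but not the Euclidean balls. *)
Definition enorm x : R := Num.sqrt (\sum_i x ord0 i ^+ 2).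

Definition eball x (r : R) : set 'rV[R]_n := [set y | enorm (y - x) < r].

Definition C1 phi := forall i : 'I_n,
  (forall x, derivable phi x 'e_i) /\ continuous ('D_('e_i) phi).

Definition divergence phi x : R := \sum_i ('D_('e_i) phi x) ord0 i.

Definition test_field phi :=
  [/\ C1 phi, compact (closure [set x | phi x != 0]) &
      forall x, enorm (phi x) <= 1].

(* Total variation of the indicator of E, in the sense of De Giorgi. *)
Definition perimeter E : \bar R :=
  ereal_sup [set (\int[@lebesgue_rV R n]_(x in E) (divergence phi x)%:E)%E
            | phi in test_field].

(* The minimum over the centers x is written as an infimum; for 0 < |E| < +oo
   the radius r is determined by E. *)
Definition fraenkel_asymmetry E : \bar R :=
  ereal_inf [set t | exists x r,
    [/\ 0 < r, lebesgue_rV (eball x r) = lebesgue_rV E &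
    t = (lebesgue_rV (E `+` eball x r) / lebesgue_rV E)%E]].

End perimeter.

(* Main.v *)
Require Import Defs.
From mathcomp Require Import all_boot all_order all_algebra.
From mathcomp Require Import all_classical all_reals all_analysis.
From mathcomp Require Import measurable_realfun.
From mathcomp Require Import ring lra.
Import Order.TTheory GRing.Theory Num.Theory.
Import numFieldNormedType.Exports.
Local Open Scope classical_set_scope.
Local Open Scope ring_scope.

Set Implicit Arguments.
Unset Strict Implicit.
Unset Printing Implicit Defensive.

(* Let B be the unit ball centred at c, H(x) = |x - c|^2 - 1, D the symmetric
   difference of Omega and B, and K the convex hull of their union.

   Perimeter is monotone on convex sets and P(K) <= n |K| because K contains a
   unit ball, while P(B) >= n |B| by a radial test field; hence
   P(Omega) - P(B) <= n |K \ B|, and it remains to bound |K \ B| by C |D|.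
   A point q of K \ B satisfies |q - p|^2 <= H(p) for some p in Omega \ B. If y
   in B is at depth of order H(p) near p, then either y is not in Omega, or the
   midpoint of p and y is in Omega \ B: so D fills a fixed fraction of the
   neighbourhood of p of height H(p) and width H(p)^(1/2). Since this scale can
   be read off a point y of D as |H(y)|, integrating over q in K \ B and y in D
   the kernel 1_E(q, y) / |E_y|, where E relates q to the y close to it at scale
   |H(y)|, gives the bound. All this requires H to be small on Omega, but
   otherwise |D| is bounded below and there is nothing to prove.

   For the monotonicity, let u1 <= u be cutoffs of Omega and K, and h a convex
   function close to the distance to Omega. Then, for a test field phi,
     int_Omega div phi ~ - int grad u1 . phi <= int |grad u1|
       ~ - int grad u1 . grad h <= - int grad u . grad h <= int |grad u|,
   where the comparison of u1 and u holds because int grad w . grad h <= 0 for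
   w = u - u1 >= 0 and h convex. *)

(** * Euclidean structure and measure of 'rV[R]_n *)

Section dot_product.
Context {R : realType} {n : nat}.
Implicit Types x y z : 'rV[R]_n.

(** The identity [H(l p + (1 - l) y) = l H(p) + (1 - l) H(y) - l (1 - l) |p - y|^2] is behind every
    geometric step. For [y] in [B] the last two terms are nonpositive, so a point of the segment
    with [H > 0] must be close to [p]; and for [y] near [p] at shallow depth they are small, so the
    midpoint stays outside [B]. The bound [P(K) <= n |K|] comes from [K + e B] lying in the dilation
    of [K] by [1 + e]: a shell of width [e] has volume about [n e |K|] at most. The radial field
    yields the same factor [n] for the ball, so the perimeter deficit becomes a difference of
    volumes. In the volume estimate the obstacle is that the scale [H(p)] varies with [p], so that
    the neighbourhoods overlap without control. Dividing by [|E_y|] makes the overlap harmless: the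
    kernel plays the part of a covering lemma. Second derivatives are avoided throughout: gradients
    are limits of difference quotients, and integration by parts is translation invariance followed
    by dominated convergence. *)

Definition dot x y : R := \sum_i x ord0 i * y ord0 i.

Lemma dotC x y : dot x y = dot y x.
Proof. by apply: eq_bigr => i _; rewrite mulrC. Qed.

Lemma dotDl x y z : dot (x + y) z = dot x z + dot y z.
Proof. by rewrite /dot -big_split; apply: eq_bigr => i _; rewrite mxE mulrDl. Qed.

Lemma dotZl a x z : dot (a *: x) z = a * dot x z.
Proof. by rewrite /dot mulr_sumr; apply: eq_bigr => i _; rewrite mxE mulrA. Qed.

Lemma dotNl x z : dot (- x) z = - dot x z.
Proof. by rewrite -scaleN1r dotZl mulN1r. Qed.

Lemma dotDr x y z : dot x (y + z) = dot x y + dot x z.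
Proof. by rewrite dotC dotDl !(dotC x). Qed.

Lemma dotZr a x z : dot x (a *: z) = a * dot x z.
Proof. by rewrite dotC dotZl dotC. Qed.

Lemma dotNr x z : dot x (- z) = - dot x z.
Proof. by rewrite dotC dotNl dotC. Qed.

Lemma dot0l x : dot 0 x = 0.
Proof. by rewrite -(scale0r 0) dotZl mul0r. Qed.

Lemma dot0r x : dot x 0 = 0.
Proof. by rewrite dotC dot0l. Qed.

Definition dotE := (dotDl, dotDr, dotNl, dotNr, dotZl, dotZr).

Lemma dot_ge0 x : 0 <= dot x x.
Proof. by apply: sumr_ge0 => i _; rewrite -expr2 sqr_ge0. Qed.

Lemma dot_eq0 x : (dot x x == 0) = (x == 0).
Proof.
apply/eqP/eqP => [/eqP|->]; last exact: dot0l.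
rewrite psumr_eq0 => [/allP xx0|i _]; last by rewrite -expr2 sqr_ge0.
apply/rowP => i; rewrite mxE; apply/eqP.
by have := xx0 i (mem_index_enum _); rewrite mulf_eq0 orbb.
Qed.

Lemma cauchy_schwarz x y : dot x y ^+ 2 <= dot x x * dot y y.
Proof.
have [->|y0] := eqVneq y 0; first by rewrite !dot0r expr0n mulr0.
have yy : 0 < dot y y by rewrite lt_def dot_eq0 y0 dot_ge0.
have := dot_ge0 (dot y y *: x - dot x y *: y).
rewrite !dotE (dotC y x) => h.
have : 0 <= dot y y * (dot x x * dot y y - dot x y ^+ 2) by nra.
by rewrite pmulr_rge0// subr_ge0.
Qed.

Lemma dot_le x y (a b : R) : 0 <= a -> 0 <= b ->
  dot x x <= a ^+ 2 -> dot y y <= b ^+ 2 -> `|dot x y| <= a * b.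
Proof.
move=> a0 b0 xa yb; rewrite -ler_sqr ?nnegrE ?mulr_ge0// real_normK ?num_real//.
apply: le_trans (cauchy_schwarz x y) _.
by rewrite exprMn ler_pM// dot_ge0.
Qed.

Lemma enormE x : enorm x = Num.sqrt (dot x x).
Proof. by congr Num.sqrt; apply: eq_bigr => i _; rewrite expr2. Qed.

Lemma enorm_ge0 x : 0 <= enorm x. Proof. exact: sqrtr_ge0. Qed.

Lemma enorm_sqr x : enorm x ^+ 2 = dot x x.
Proof. by rewrite enormE sqr_sqrtr// dot_ge0. Qed.

Lemma enorm_lt x r : 0 <= r -> (enorm x < r) = (dot x x < r ^+ 2).
Proof. by move=> r0; rewrite -enorm_sqr ltr_sqr ?nnegrE ?enorm_ge0. Qed.

Lemma enorm_le x r : 0 <= r -> (enorm x <= r) = (dot x x <= r ^+ 2).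
Proof. by move=> r0; rewrite -enorm_sqr ler_sqr ?nnegrE ?enorm_ge0. Qed.

Lemma dot_le_enorm x y : `|dot x y| <= enorm x * enorm y.
Proof. by apply: dot_le; rewrite ?enorm_ge0 ?enorm_sqr. Qed.

Lemma enormD x y : enorm (x + y) <= enorm x + enorm y.
Proof.
rewrite enorm_le ?addr_ge0 ?enorm_ge0// !dotE (dotC y x) -!enorm_sqr.
by have := ler_norm (dot x y); have := dot_le_enorm x y; nra.
Qed.

Lemma enormZ a x : enorm (a *: x) = `|a| * enorm x.
Proof.
by rewrite !enormE !dotE mulrA -expr2 sqrtrM ?sqr_ge0// sqrtr_sqr.
Qed.

Lemma enormN x : enorm (- x) = enorm x.
Proof. by rewrite -scaleN1r enormZ normrN1 mul1r. Qed.

Lemma enorm0 : enorm (0 : 'rV[R]_n) = 0.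
Proof. by rewrite enormE dot0l sqrtr0. Qed.

Lemma coord_le_enorm x i : `|x ord0 i| <= enorm x.
Proof.
rewrite -ler_sqr ?nnegrE ?enorm_ge0// real_normK ?num_real// enorm_sqr /dot.
by rewrite (bigD1 i)//= expr2 lerDl sumr_ge0// => j _; rewrite -expr2 sqr_ge0.
Qed.

End dot_product.

Section continuous_real_functions.
Context {R : realType} {T : topologicalType}.
Implicit Types f g : T -> R.

Lemma continuous_cst (k : R) : continuous (fun _ : T => k).
Proof. exact: cst_continuous. Qed.

Lemma continuous_add f g : continuous f -> continuous g ->
  continuous (fun x => f x + g x).
Proof. by move=> cf cg x; exact: (continuousD (cf x) (cg x)). Qed.

Lemma continuous_sub f g : continuous f -> continuous g ->
  continuous (fun x => f x - g x).
Proof. by move=> cf cg x; exact: (continuousB (cf x) (cg x)). Qed.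

Lemma continuous_mul f g : continuous f -> continuous g ->
  continuous (fun x => f x * g x).
Proof. by move=> cf cg x; exact: (continuousM (cf x) (cg x)). Qed.

End continuous_real_functions.

Section topology_rV.
Context {R : realType} {n : nat}.
Implicit Types x y z : 'rV[R]_n.

Lemma nbhs_enormP x (A : set 'rV[R]_n) :
  nbhs x A <-> exists2 r, 0 < r & forall y, enorm (y - x) < r -> A y.
Proof.
rewrite nbhs_ballP; split=> [[e /= e0 eA]|[r r0 rA]].
  exists e => // y yx; apply: eA; split=> // i j; rewrite ord1 /ball/= distrC.
  by apply: le_lt_trans yx; have := coord_le_enorm (y - x) j; rewrite !mxE.
(* A sup-norm ball of this radius lies in the Euclidean one; [n.+1] instead of the square root of
   [n] keeps the radius meaningful and the inequality strict even for [n = 0]. *)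
exists (r / n.+1%:R) => /=; first by rewrite divr_gt0.
move=> y [_ yx]; apply: rA; rewrite enorm_lt ?ltW//.
apply: (@le_lt_trans _ _ (\sum_(i < n) (r / n.+1%:R) ^+ 2)).
  apply: ler_sum => i _; rewrite -expr2 -ler_sqrt ?sqr_ge0// !sqrtr_sqr.
  have := yx ord0 i; rewrite /ball/= distrC !mxE => /ltW /le_trans; apply.
  by rewrite ler_norm.
rewrite sumr_const card_ord -[X in X < _]mulr_natr expr_div_n -mulrA.
rewrite gtr_pMr ?exprn_gt0// ltr_pdivrMl ?exprn_gt0// mulr1 -natrX ltr_nat.
by rewrite -[X in (X <= _)%N]expn1 leq_pexp2l.
Qed.

Lemma open_enormP (A : set 'rV[R]_n) :
  open A <-> forall x, A x -> exists2 r, 0 < r & forall y, enorm (y - x) < r -> A y.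
Proof.
rewrite openE; split=> [oA x /oA /nbhs_enormP//|oA x /oA ?].
exact/nbhs_enormP.
Qed.

Lemma continuous_enormP (f : 'rV[R]_n -> R) :
  continuous f <-> forall x e, 0 < e ->
    exists2 r, 0 < r & forall y, enorm (y - x) < r -> `|f y - f x| < e.
Proof.
split=> [cf x e e0|cf x].
  have /cvgrPdist_lt/(_ _ e0)/nbhs_enormP[r r0 rP] := cf x.
  by exists r => // y /rP; rewrite distrC.
apply/(@cvgrPdist_lt _ _ _ _ (nbhs_filter x)) => e /(cf x)[r r0 rP]; apply/nbhs_enormP; exists r => // y.
by move=> /rP; rewrite distrC.
Qed.

Lemma lipschitz_continuous (f : 'rV[R]_n -> R) (L : R) :
  (forall x y, `|f y - f x| <= L * enorm (y - x)) -> continuous f.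
Proof.
move=> fL; apply/continuous_enormP => x e e0.
have L0 : 0 < `|L| + 1 by rewrite ltr_wpDl.
exists (e / (`|L| + 1)) => [|y yx]; first by rewrite divr_gt0.
apply: le_lt_trans (fL x y) _.
apply: (@le_lt_trans _ _ ((`|L| + 1) * enorm (y - x))).
  by rewrite ler_wpM2r ?enorm_ge0// (le_trans (ler_norm _))// lerDl.
by rewrite mulrC -ltr_pdivlMr.
Qed.

Lemma continuous_sum (I : Type) (s : seq I) (f : I -> 'rV[R]_n -> R) :
  (forall i, continuous (f i)) -> continuous (fun x => \sum_(i <- s) f i x).
Proof.
move=> cf; elim: s => [|i s IH] x.
  have -> : (fun y => \sum_(j <- [::]) f j y) = cst 0.
    by apply/funext => y; rewrite big_nil.
  exact: cst_continuous.
have -> : (fun y => \sum_(j <- i :: s) f j y) =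
    (f i + (fun y => \sum_(j <- s) f j y)).
  by apply/funext => y; rewrite big_cons.
exact: (continuousD (cf i x) (IH x)).
Qed.

Lemma continuous_dot (f g : 'rV[R]_n -> 'rV[R]_n) :
  continuous f -> continuous g -> continuous (fun x => dot (f x) (g x)).
Proof.
move=> cf cg; apply: continuous_sum => i x.
have cc (h : 'rV[R]_n -> 'rV[R]_n) : continuous h ->
    {for x, continuous (fun x => h x ord0 i)}.
  move=> ch; apply: (@continuous_comp _ _ _ h (fun v : 'rV[R]_n => v ord0 i)).
    exact: ch.
  exact: coord_continuous.
exact: (continuousM (cc _ cf) (cc _ cg)).
Qed.

Lemma continuous_measurable_rV (f : 'rV[R]_n -> R) : continuous f ->
  measurable_fun [set: 'rV[R]_n] (f : 'rV[R]_n -> measurableTypeR R).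
Proof.
move=> /continuousP cf; apply: (measurability _ (RGenOpens.measurableE R)) => //.
move=> _ [_ [a [b ->]] <-]; rewrite setTI; apply: open_measurable_rV; apply: cf.
exact: interval_open.
Qed.

Lemma eball_open x r : open (eball x r).
Proof.
apply/open_enormP => y; rewrite /eball/= => yx.
exists (r - enorm (y - x)); first by rewrite subr_gt0.
move=> z; rewrite ltrBrDr; apply: le_lt_trans.
by have := enormD (z - y) (y - x); rewrite addrA subrK.
Qed.

Lemma measurable_eball x r : measurable (eball x r : set 'rV[R]_n).
Proof. by apply: open_measurable_rV; exact: eball_open. Qed.

End topology_rV.

Section homothety_measure.
Context {R : realType}.
Local Open Scope ereal_scope.

Lemma measurable_affine (a b : R) :
  measurable_fun setT (fun x : measurableTypeR R => (b + a * x)%R : measurableTypeR R).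
Proof. by apply: measurable_funD => //; exact: mulrl_measurable. Qed.

(** Uniqueness of Lebesgue measure: [a] times the push-forward gives half-open intervals their
    length. *)
Lemma lebesgue_measure_homothety (a b : R) (A : set (measurableTypeR R)) :
  (0 < a)%R -> measurable A ->
  lebesgue_measure ((fun x : R => b + a * x)%R @^-1` A) =
  a^-1%:E * lebesgue_measure A.
Proof.
move=> a0 mA.
pose nu : {measure set (measurableTypeR R) -> \bar R} :=
  mscale (NngNum (ltW a0))
    (measure_function_pushforward__canonical__measure_function_Measure
      (@lebesgue_measure R) (measurable_affine a b)).
rewrite (@lebesgue_measure_unique R nu _ A) => [| |//].
  rewrite /nu/= /mscale/= /pushforward muleA -EFinM mulVf ?mul1e//.
  by rewrite gt_eqF.
move=> _ [[u v]] _ <- /=; rewrite /nu/= /mscale/= /pushforward.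
rewrite (_ : _ @^-1` _ = `](u - b) / a, (v - b) / a]%classic)%R; last first.
  apply/seteqP; split=> x /=; rewrite !in_itv/=.
    by rewrite ltr_pdivrMr// ler_pdivlMr// (mulrC x) ltrBlDl lerBrDl.
  by rewrite ltr_pdivrMr// ler_pdivlMr// (mulrC x) ltrBlDl lerBrDl.
rewrite !lebesgue_measure_itv/= !lte_fin ltr_pM2r ?invr_gt0//.
rewrite ltrD2r; case: ifPn => _; last by rewrite mule0.
rewrite -EFinD -EFinM; congr EFin.
by field; rewrite gt_eqF.
Qed.

Lemma integral_homothety (a b : R) (f : measurableTypeR R -> \bar R) :
  (0 < a)%R -> measurable_fun setT f -> (forall x, 0 <= f x) ->
  \int[lebesgue_measure]_x f (b + a * x)%R =
  a^-1%:E * \int[lebesgue_measure]_x f x.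
Proof.
move=> a0 mf f0; have ia0 : (0 < a^-1)%R by rewrite invr_gt0.
have := @ge0_integral_pushforward _ _ _ _ R _ (measurable_affine a b)
  lebesgue_measure setT f measurableT mf (fun x _ => f0 x).
rewrite preimage_setT => <-.
rewrite -(@ge0_integral_mscale _ _ _ _ setT measurableT (NngNum (ltW ia0)))//.
apply: eq_measure_integral => [|maff A mA _]; first exact: measurable_affine.
rewrite /= /mscale/=. exact: lebesgue_measure_homothety.
Qed.

Lemma measurable_homothety_rV n (a : R) (v : 'rV[R]_n) :
  measurable_fun setT (fun x : 'rV[R]_n => v + a *: x)%R.
Proof.
apply: measurable_fun_rV => i.
rewrite (_ : (fun _ => _) = fun x : 'rV[R]_n => v ord0 i + a * x ord0 i)%R.
  apply: measurable_funD => //; apply: measurable_funM => //.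
  exact: measurable_coord_rV.
by apply/funext => x; rewrite !mxE.
Qed.

(** Induction on the dimension by slicing: the slice of the preimage at [x] is the preimage, under
    the homothety in the remaining coordinates, of the slice of [A] at [v ord0 ord0 + a * x]. *)
Lemma lebesgue_rV_homothety n (a : R) (v : 'rV[R]_n) (A : set 'rV[R]_n) :
  (0 < a)%R -> measurable A ->
  lebesgue_rV ((fun x => v + a *: x)%R @^-1` A) =
  (a^-1 ^+ n)%:E * lebesgue_rV A.
Proof.
move=> a0; elim: n v A => [|n IH] v A mA.
  rewrite expr0 mul1e; congr lebesgue_rV; apply/seteqP; split => x /=;
    by rewrite [(v + _)%R](_ : _ = x)//; apply/rowP => -[].
pose v' : 'rV[R]_n := \row_i v ord0 (lift ord0 i).
have mcA : measurable (@consrV R n @^-1` A).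
  by rewrite -[X in measurable X]setTI; exact: measurable_consrV.
have -> : lebesgue_rV ((fun x => v + a *: x)%R @^-1` A) =
    \int[lebesgue_measure]_x
      ((a^-1 ^+ n)%:E * (@lebesgue_rV R n \o xsection (@consrV R n @^-1` A)) (v ord0 ord0 + a * x)%R).
  rewrite [LHS]/= /pushforward /product_measure1; apply: eq_integral => x _.
  rewrite /= -(IH v'); last exact: measurable_xsection.
  have mxDZ k (u w : 'rV[R]_k) i : ((u + a *: w) ord0 i = u ord0 i + a * w ord0 i)%R.
    by rewrite !mxE.
  have E y : (v + a *: consrV (x, y) = consrV (v ord0 ord0 + a * x, v' + a *: y))%R.
    apply/matrixP => k i; have -> : k = ord0 by rewrite ord1; exact: val_inj.
    have [j ->|->] := unliftP ord0 i.
      apply/esym; etransitivity; first exact: consrVS.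
      rewrite !mxDZ mxE; congr (_ + _ * _)%R; apply/esym; exact: consrVS.
    apply/esym; etransitivity; first exact: consrV0.
    rewrite mxDZ; congr (_ + _ * _)%R; apply/esym; exact: consrV0.
  congr lebesgue_rV; apply/seteqP; split=> y; rewrite /xsection/= !inE/= E//.
have mF : measurable_fun setT (@lebesgue_rV R n \o xsection (@consrV R n @^-1` A)).
  exact: measurable_fun_xsection.
rewrite ge0_integralZl//.
- rewrite (@integral_homothety a (v ord0 ord0))// exprS muleA -EFinM mulrC.
  by [].
- by apply: (measurableT_comp mF); exact: measurable_affine.
- by rewrite lee_fin exprn_ge0// invr_ge0 ltW.
Qed.

End homothety_measure.

Section volume.
Context {R : realType} {n : nat}.
Implicit Types (x y c v : 'rV[R]_n) (A B : set 'rV[R]_n).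

(** Sup-norm balls are boxes of known measure. They contain the Euclidean balls, which are thus of
    finite measure, and fit inside nonempty open sets, which are thus of positive measure. *)
Let cube x (e : R) : set 'rV[R]_n :=
  [set v | forall i, (\row_j (x ord0 j - e)) ord0 i < v ord0 i
                       < (\row_j (x ord0 j + e)) ord0 i].

Let cubeE x (e : R) : 0 < e -> cube x e = ball x e.
Proof.
move=> e0; apply/seteqP; split=> [v /= h|v [_ h] i]; last first.
  by rewrite !mxE -ltr_distlC; have := h ord0 i.
by split=> // k i; rewrite ord1 /ball/= ltr_distlC; have := h i; rewrite !mxE.
Qed.

Let lebesgue_rV_ball x (e : R) : 0 < e ->
  lebesgue_rV (ball x e) = ((e *+ 2) ^+ n)%:E.
Proof.
move=> e0; rewrite -cubeE// lebesgue_rV_box => [|i]; last first.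
  by rewrite !mxE lerBlDr -addrA lerDl addr_ge0 ?ltW.
congr EFin; rewrite -[in RHS](card_ord n) -prodr_const; apply: eq_bigr => i _.
by rewrite !mxE; ring.
Qed.

Lemma lebesgue_rV_eball_lty c (r : R) : (lebesgue_rV (eball c r) < +oo)%E.
Proof.
have [r0|r0] := leP r 0.
  rewrite (_ : eball c r = set0) ?measure0 ?ltry// -subset0 => x /=.
  by rewrite /eball/= ltNge (le_trans r0) ?enorm_ge0.
apply: (@le_lt_trans _ _ (lebesgue_rV (ball c r))).
  apply: le_measure; rewrite ?inE.
  - exact: measurable_eball.
  - by apply: open_measurable_rV; exact: ball_open.
  - move=> x xc; split=> // k i; rewrite ord1.
    by apply: le_lt_trans xc; have := coord_le_enorm (x - c) i; rewrite !mxE distrC.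
by rewrite lebesgue_rV_ball ?ltry.
Qed.

Lemma lebesgue_rV_open_gt0 A : open A -> A !=set0 -> (0 < lebesgue_rV A)%E.
Proof.
move=> oA [x Ax].
have /nbhs_ballP[e /= e0 eA] : nbhs x A by exact: open_nbhs_nbhs.
apply: (@lt_le_trans _ _ (lebesgue_rV (ball x e))).
  by rewrite lebesgue_rV_ball// lte_fin exprn_gt0// mulrn_wgt0.
apply: le_measure; rewrite ?inE//.
- by apply: open_measurable_rV; exact: ball_open.
- exact: open_measurable_rV.
Qed.

Lemma convex_setP A : @convex_set R 'rV[R]_n A ->
  forall x y (t : R), 0 <= t -> t <= 1 -> A x -> A y -> A (t *: x + (1 - t) *: y).
Proof.
move=> cA x y t t0 t1 Ax Ay.
pose l : {i01 R} := Itv01 t0 t1.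
by have := cA x y l (mem_set Ax) (mem_set Ay); rewrite inE.
Qed.

Lemma bounded_set_eball A : bounded_set A -> exists2 r : R, 0 < r & A `<=` eball 0 r.
Proof.
move=> /ex_strict_bound_gt0 [M M0 AM].
exists (n.+1%:R * M) => [|x Ax]; first by rewrite mulr_gt0.
rewrite /eball/= subr0 enorm_lt ?mulr_ge0// ?ltW//.
apply: (@le_lt_trans _ _ (\sum_(i < n) M ^+ 2)).
  apply: ler_sum => i _; rewrite -expr2 -ler_sqrt ?sqr_ge0// !sqrtr_sqr.
  rewrite (gtr0_norm M0) (le_trans _ (ltW (AM _ Ax)))//.
  by rewrite [leRHS]/Num.norm/= mx_normrE (le_trans _ (le_bigmax _ _ (ord0, i))).
rewrite sumr_const card_ord -[X in X < _]mulr_natl exprMn ltr_pM2r ?exprn_gt0//.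
by rewrite -natrX ltr_nat -[X in (X <= _)%N]expn1 leq_pexp2l.
Qed.

(** The contracted point is the barycentre, with weights [1] and [e], of [v] and a point of the
    ball. So neighbourhoods of a convex set lie in its dilations, whose volumes are explicit. *)
Lemma convex_dilation A c (r e : R) v : @convex_set R 'rV[R]_n A ->
  eball c r `<=` A -> 0 < e -> A v -> forall x, enorm (x - v) < r * e ->
  A (c + (1 + e)^-1 *: (x - c)).
Proof.
move=> cA cr e0 Av x xv.
have e1 : 0 < 1 + e by rewrite addr_gt0.
have := convex_setP cA (t := (1 + e)^-1) (x := v) (y := c + e^-1 *: (x - v)).
rewrite invr_ge0 (ltW e1) invf_le1// lerDl (ltW e0) => /(_ isT isT Av) H.
rewrite (_ : c + _ = (1 + e)^-1 *: v +
         (1 - (1 + e)^-1) *: (c + e^-1 *: (x - v))); first last.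
  apply/rowP => i; rewrite !mxE; field.
  by rewrite !gt_eqF.
apply: H; apply: cr; rewrite /eball/= addrAC subrr add0r enormZ gtr0_norm ?invr_gt0//.
by rewrite ltr_pdivrMl// mulrC.
Qed.

Lemma lebesgue_rV_dilation c (a : R) A : 0 < a -> measurable A ->
  lebesgue_rV [set x | A (c + a^-1 *: (x - c))] = ((a ^+ n)%:E * lebesgue_rV A)%E.
Proof.
move=> a0 mA; rewrite -{2}(invrK a) -(lebesgue_rV_homothety (c - a^-1 *: c))//.
  by congr lebesgue_rV; apply/funext => x /=; rewrite scalerBr addrAC -addrA.
by rewrite invr_gt0.
Qed.

End volume.

(** * Tonelli estimate *)

Section kernel_bound.
Context d (T : measurableType d) (R : realType).
Variable mu : {sigma_finite_measure set T -> \bar R}.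
Local Open Scope ereal_scope.

Let le_inv_mule (k m : R) (M : \bar R) :
  (0 < m)%R -> (k * m)%:E <= M -> k%:E <= (m^-1)%:E * M.
Proof.
move=> m0 kM; apply: (@le_trans _ _ ((m^-1)%:E * (k * m)%:E)); last first.
  by apply: lee_wpmul2l => //; rewrite lee_fin invr_ge0 ltW.
by rewrite -EFinM lee_fin mulrCA mulVf ?mulr1// gt_eqF.
Qed.

(* The kernel 1_E(x, y) / mu(E_y) has mass at most 1 in x and, by assumption,
   mass at least k in y over D: exchange the integrals. *)
Lemma kernel_bound (X D : set T) (E : set (T * T)) (k : R) :
  measurable X -> measurable D -> measurable E -> (0 <= k)%R ->
  (forall y, mu (ysection E y) < +oo) ->
  (forall x, X x -> exists W (m : R), [/\ measurable W, W `<=` D `&` xsection E x,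
     (0 < m)%R, (forall y, W y -> 0 < mu (ysection E y) <= m%:E) &
     (k * m)%:E <= mu W]) ->
  k%:E * mu X <= mu D.
Proof.
move=> mX mD mE k0 Efin XW.
pose e y := fine (mu (ysection E y)).
have eE y : mu (ysection E y) = (e y)%:E.
  by rewrite fineK// ge0_fin_numE// Efin.
have e0 y : (0 <= e y)%R by exact: fine_ge0.
have me : measurable_fun setT e.
  by apply: measurableT_comp => //; exact: measurable_fun_ysection.
(* The inverse of [e y], written as a power for its measurability; it is 0 where [e y = 0]. *)
pose w y : R := (e y `^ (-1))%R.
have w0 y : (0 <= w y)%R by exact: powR_ge0.
have mw : measurable_fun setT w.
  by apply: (measurableT_comp (@measurable_powR R (-1)%R)).
pose F := E `&` (X `*` D).
have mF : measurable F by apply: measurableI => //; exact: measurableX.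
pose f (z : T * T) : \bar R := (\1_F z * w z.2)%R%:E.
have mf : measurable_fun setT f.
  apply/measurable_EFinP; apply: measurable_funM; first exact/measurable_indicP.
  exact: measurableT_comp mw _.
have f0 z : 0 <= f z by rewrite lee_fin mulr_ge0.
have fub := fubini_tonelli (m1 := mu) (m2 := mu) f mf f0.
have mF1 : measurable_fun setT (fun x => \int[mu]_y f (x, y)) := measurable_fun_fubini_tonelli_F (m2 := mu) f mf f0.
have mF2 : measurable_fun setT (fun y => \int[mu]_x f (x, y)) := measurable_fun_fubini_tonelli_G (m1 := mu) f mf f0.
have mf1 x : measurable_fun setT (fun y => f (x, y)).
  exact: measurableT_comp mf (pair1_measurable x).
have mf2 y : measurable_fun setT (fun x => f (x, y)).
  exact: measurableT_comp mf (pair2_measurable y).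
(* On the set [W] attached to [x] the weight is at least [1 / m], and [W] has measure at least
   [k m]: the integral in [y] is at least [k]. *)
have L : k%:E * mu X <= \int[mu]_x \int[mu]_y f (x, y).
  have <- : \int[mu]_(x in X) (cst k%:E x) = k%:E * mu X by exact: integral_cst.
  apply: (@le_trans _ _ (\int[mu]_(x in X) \int[mu]_y f (x, y))); last first.
    apply: (ge0_subset_integral mu mX measurableT mF1) => [x _|]; last exact: subsetT.
    by apply: integral_ge0.
  apply: (ge0_le_integral mu mX) => [x _|||x Xx].
  - by rewrite lee_fin.
  - exact: measurable_cst.
  - exact: (measurable_funTS mF1).
  have [W [m [mW WD m0 Wm kW]]] := XW x Xx.
  apply: (@le_trans _ _ (\int[mu]_(y in W) (cst (m^-1)%:E y))).
    have -> : \int[mu]_(y in W) (cst (m^-1)%:E y) = (m^-1)%:E * mu W.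
      exact: integral_cst.
    exact: le_inv_mule.
  apply: (@le_trans _ _ (\int[mu]_(y in W) f (x, y))); last first.
    apply: (ge0_subset_integral mu mW measurableT (mf1 x)) => [y _|]; last exact: subsetT.
    exact: f0.
  apply: (ge0_le_integral mu mW) => [y _|||y Wy].
  - by rewrite lee_fin invr_ge0 ltW.
  - exact: measurable_cst.
  - exact: (measurable_funTS (mf1 x)).
  have [Dy Exy] := WD _ Wy; clear fub mF1 mF2 mf1 mf2 mf mw me.
  have /andP[ey0 eym] := Wm _ Wy.
  rewrite lee_fin indicE mem_set ?mul1r.
    rewrite /w powR_inv1// lef_pV2//; first by rewrite -lee_fin -eE.
    by rewrite posrE -lte_fin -eE.
  by split=> //; move: Exy; rewrite /xsection/= inE.
apply: le_trans L _; rewrite {}fub.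
have <- : \int[mu]_y (\1_D y)%:E = mu D by rewrite integral_indic// setIT.
apply: (ge0_le_integral mu measurableT _ mF2) => [y _||y _].
- by apply: integral_ge0 => x _; exact: f0.
- exact/measurable_EFinP/measurable_indicP.
have mEy : measurable (ysection E y) by exact: measurable_ysection.
have mI : measurable_fun setT (fun x => (\1_(ysection E y) x)%:E : \bar R).
  exact/measurable_EFinP/measurable_indicP.
apply: (@le_trans _ _ (\int[mu]_x ((w y * \1_D y)%:E * (\1_(ysection E y) x)%:E))).
  apply: (ge0_le_integral mu measurableT _ (mf2 y)) => [x _||x _].
  - exact: f0.
  - exact: measurable_funeM.
  clear mF1 mF2 mf1 mf2 mf mw me mI.
  rewrite -!EFinM lee_fin mulrC -mulrA ler_wpM2l// !indicE.
  have [/[!inE] -[Exy [_ Dy]]|] := boolP ((x, y) \in F); last by rewrite mulr_ge0.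
  by rewrite !mem_set ?mulr1//= /ysection/= inE.
rewrite (ge0_integralZl _ measurableT mI); last 2 first.
- by move=> x _; rewrite lee_fin.
- by rewrite lee_fin mulr_ge0.
clear mF1 mF2 mf1 mf2 mf mw me mI.
have -> : \int[mu]_x (\1_(ysection E y) x)%:E = (e y)%:E.
  by rewrite integral_indic// setIT; exact: eE.
rewrite -EFinM lee_fin mulrAC ler_piMl//.
rewrite /w powR_inv1//; have [->|ey0] := eqVneq (e y) 0%R; first by rewrite mulr0.
by rewrite mulVf.
Qed.

End kernel_bound.

(** * Volume of the convex hull of a convex set and a ball *)

Section contraction_arithmetic.
Context {R : realType}.
Implicit Types h s d q : R.

(** If [|p - c|^2 = 1 + h], scaling [p - c] by [s] brings [p] to excess [- 3/32 h]. The constant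
    [35/32] is [1 + 3/32], from [1 - s <= 1 - s^2]. *)
Lemma contraction_factor h : 0 < h -> h <= 1 / 16 -> exists s,
  [/\ 0 <= s, s <= 1, 1 - s <= 35 / 32 * h & s ^+ 2 * (1 + h) = 1 - 3 / 32 * h].
Proof.
move=> h0 h1; have h2 : 0 < 1 + h by rewrite addr_gt0.
pose t := (1 - 3 / 32 * h) / (1 + h).
have th : t * (1 + h) = 1 - 3 / 32 * h by rewrite /t divfK// gt_eqF.
have t0 : 0 <= t by rewrite divr_ge0 ?ltW//; lra.
have t1 : t <= 1 by rewrite ler_pdivrMr//; lra.
exists (Num.sqrt t); rewrite sqr_sqrtr//.
have s0 := sqrtr_ge0 t; have ss := sqr_sqrtr t0.
move: (Num.sqrt t) s0 ss => s s0 ss; move: t {t0} t1 th ss => t t1 th ss.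
have s1 : s <= 1 by rewrite -ler_sqr ?nnegrE// ss expr1n.
have t2 : 1 - t <= 35 / 32 * h by nra.
by split=> //; nra.
Qed.

(** The conditions of [Z p] imply those of [Y p] for the image, with [e = p - c], [w = z - p],
    [d = dot e w] and [q = dot w w]. The third conclusion is the binding one: [2 d] may be as low as
    [- (16 + 1 + 130) h = - 147 h], and [147 / ratio < 1 / 32] asks for a ratio above 4704; 8192 is
    the next power of two. *)
Lemma contraction_bounds h s d q : 0 < h -> h <= 1 / 16 -> 0 <= s -> s <= 1 ->
  1 - s <= 35 / 32 * h -> 0 <= q -> 0 < 130 * h - q ->
  0 < 16 * h - (h + 2 * d + q) -> 0 < 16 * h + (h + 2 * d + q) ->
  [/\ 2 * (8192^-1 * (8192^-1 * q)) + 2 * ((1 - s) * ((1 - s) * (1 + h))) < h,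
   0 < - (h / 16) - (- (3 / 32) * h + 2 * s * (8192^-1 * d) + 8192^-1 ^+ 2 * q) &
   0 < h / 8 + (- (3 / 32) * h + 2 * s * (8192^-1 * d) + 8192^-1 ^+ 2 * q)].
Proof.
move=> h0 h1 s0 s1 gs q0 q1 d1 d2.
have d3 : 2 * d <= 15 * h by lra.
have d4 : - (147 * h) <= 2 * d by lra.
have d5 : s * (2 * d) <= 15 * h by nra.
have d6 : - (147 * h) <= s * (2 * d) by nra.
have s2 : (1 - s) * (1 - s) <= 35 / 32 * h * (35 / 32 * h).
  by apply: ler_pM => //; rewrite subr_ge0.
have s3 : (1 - s) * ((1 - s) * (1 + h)) <= h / 10.
  rewrite mulrA; apply: (@le_trans _ _ (35 / 32 * h * (35 / 32 * h) * (17 / 16))).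
    by apply: ler_pM => //; nra.
  nra.
by split; lra.
Qed.

End contraction_arithmetic.

Section hull_excess.
Context {R : realType} {n : nat}.
Variable c : 'rV[R]_n.
Implicit Types (p q x y z : 'rV[R]_n) (Omega : set 'rV[R]_n).

Local Notation sq x := (dot x x).

Definition excess x : R := sq (x - c) - 1.

Let sqD_le x y : sq (x + y) <= 2 * sq x + 2 * sq y.
Proof.
have := dot_ge0 (x - y); rewrite !dotE (dotC y x); lra.
Qed.

Let sqC x y : sq (x - y) = sq (y - x).
Proof. by rewrite -opprB !dotE; ring. Qed.

Lemma continuous_sqB p : continuous (fun x => sq (x - p)).
Proof.
have cB : continuous (fun x : 'rV[R]_n => x - p).
  move=> x; apply: (@continuousB R 'rV[R]_n 'rV[R]_n id (cst p)).
    exact: cvg_id.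
  exact: cst_continuous.
exact: continuous_dot.
Qed.

Lemma continuous_excess : continuous excess.
Proof.
apply: continuous_sub; [exact: continuous_sqB|exact: continuous_cst].
Qed.

Lemma open_ltr (f : 'rV[R]_n -> R) : continuous f -> open [set x | 0 < f x].
Proof.
move=> cf; rewrite (_ : mkset _ = f @^-1` `]0, +oo[%classic).
  by apply: open_comp => // x _; exact: cf.
by apply/seteqP; split=> x /=; rewrite in_itv/= andbT.
Qed.

Lemma eballE x : eball c 1 x = (excess x < 0).
Proof. by rewrite /eball/= enorm_lt// expr1n /excess subr_lt0. Qed.

(** A neighbourhood of [p] at its own scale [h = excess p], large enough to contain [ysection E y]
    for each [y] with [|y - p|^2 < h] and [|excess y| <= h / 2]: then
    [|z - p|^2 < 2 * 64 h + 2 h = 130 h] and [|excess z| < 32 * h / 2 = 16 h]. *)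
Let Z p := [set z | 0 < 130 * excess p - sq (z - p)] `&`
  [set z | 0 < 16 * excess p - excess z] `&` [set z | 0 < 16 * excess p + excess z].

(** Depth at most [h / 8] and squared distance at most [h] keep the midpoint of [p] and [y] outside
    the ball, since [1/2 - 1/16 - 1/4 > 0]. Depth at least [h / 16] lets [|excess y|] reveal the
    scale [h = excess p]. *)
Let Y p := [set y | 0 < excess p - sq (y - p)] `&`
  [set y | 0 < - (excess p / 16) - excess y] `&` [set y | 0 < excess p / 8 + excess y].

Let open_Z p : open (Z p).
Proof.
by apply: openI; [apply: openI|]; apply: open_ltr;
  [apply: continuous_sub|apply: continuous_sub|apply: continuous_add];
  (exact: continuous_cst || exact: continuous_sqB || exact: continuous_excess).
Qed.

Let open_Y p : open (Y p).
Proof.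
by apply: openI; [apply: openI|]; apply: open_ltr;
  [apply: continuous_sub|apply: continuous_sub|apply: continuous_add];
  (exact: continuous_cst || exact: continuous_sqB || exact: continuous_excess).
Qed.

(* The map is z |-> p + (z - p) / 8192 - (1 - s) (p - c), with s chosen so that p
   itself goes to a point of excess - 3/32 * excess p, the middle of the range
   prescribed by Y p. *)
Let ZY p : 0 < excess p -> excess p <= 1 / 16 ->
  exists v, forall z, Z p z -> Y p (v + 8192^-1 *: z).
Proof.
move=> H0 H1.
have [h hE] : exists h, h = excess p by exists (excess p).
rewrite /Z /Y -hE in H0 H1 *.
have [e eE] : exists e, e = p - c by exists (p - c).
have ee : sq e = 1 + h by rewrite hE /excess -eE addrC subrK.
have [s [s0 s1 gs ss]] := contraction_factor H0 H1.
exists (p - 8192^-1 *: p - (1 - s) *: e) => z [[/= z1 z2] z3].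
have [w wE] : exists w, w = z - p by exists (z - p).
rewrite -wE in z1.
have Hz : excess z = h + 2 * dot e w + sq w.
  rewrite hE /excess (_ : z - c = e + w); last first.
    by apply/rowP => i; rewrite eE wE !mxE; ring.
  by rewrite -eE !dotE (dotC w e); ring.
have Ew : p - 8192^-1 *: p - (1 - s) *: e + 8192^-1 *: z - p =
    8192^-1 *: w - (1 - s) *: e.
  by rewrite wE scalerBr; apply/rowP => i; rewrite !mxE; ring.
have Ec : p - 8192^-1 *: p - (1 - s) *: e + 8192^-1 *: z - c =
    8192^-1 *: w + s *: e.
  by rewrite wE eE; apply/rowP => i; rewrite !mxE; ring.
have HS : excess (p - 8192^-1 *: p - (1 - s) *: e + 8192^-1 *: z) =
    - (3 / 32) * h + 2 * s * (8192^-1 * dot e w) + 8192^-1 ^+ 2 * sq w.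
  rewrite /excess Ec !dotE (dotC w e) ee.
  rewrite -(addrK (s ^+ 2 * (1 + h)) (- (3 / 32) * h)) {2}ss.
  by ring.
have [] := contraction_bounds H0 H1 s0 s1 gs (dot_ge0 w) z1
  (d := dot e w); rewrite -?Hz //.
move=> b1 b2 b3; split; [split|]; rewrite /mkset ?HS ?Ew//.
rewrite subr_gt0; apply: le_lt_trans b1.
have := sqD_le (8192^-1 *: w) (- ((1 - s) *: e)).
by rewrite !(dotZl, dotZr, dotNl, dotNr) !mulrN opprK ee.
Qed.

(** The constants must relate [q] to each [y] found near [p], where [h = excess p] and
    [|excess y| > h / 16]. They allow [|q - y|^2] up to [128 h / 16 = 8 h], while
    [2 * 2 h + 2 h = 6 h] is needed, and [excess q] up to [32 h / 16 = 2 h]. *)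
Let E : set ('rV[R]_n * 'rV[R]_n) :=
  [set z | 0 < 128 * `|excess z.2| - sq (z.1 - z.2)] `&`
  [set z | 0 < 32 * `|excess z.2| - `|excess z.1| ].

Let ysectionE y : ysection E y = [set z | 0 < 128 * `|excess y| - sq (z - y)] `&`
  [set z | 0 < 32 * `|excess y| - `|excess z| ].
Proof.
by apply/seteqP; split=> z; rewrite /ysection/= ?inE//=; rewrite inE.
Qed.

Let continuous_norm_excess : continuous (fun z => `|excess z|).
Proof.
move=> z; apply: (@continuous_comp _ _ _ excess (fun r : R => `|r|)).
  exact: continuous_excess.
exact: norm_continuous.
Qed.

Let open_ysectionE y : open (ysection E y).
Proof.
rewrite ysectionE; apply: openI; apply: open_ltr; apply: continuous_sub.
- exact: continuous_cst.
- exact: continuous_sqB.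
- exact: continuous_cst.
- exact: continuous_norm_excess.
Qed.

Let measurable_gt0 d (T : measurableType d) (f : T -> measurableTypeR R) :
  measurable_fun setT f -> measurable [set z | 0 < (f z : R)].
Proof.
move=> mf; rewrite (_ : mkset _ = setT `&` f @^-1` `]0, +oo[%classic).
  by apply: mf.
by rewrite setTI; apply/seteqP; split=> x /=; rewrite in_itv/= andbT.
Qed.

Let measurable_E : measurable E.
Proof.
have mex : measurable_fun setT (fun z : 'rV[R]_n => `|excess z| : measurableTypeR R).
  exact: continuous_measurable_rV.
have mex1 : measurable_fun setT
    (fun z : 'rV[R]_n * 'rV[R]_n => `|excess z.1| : measurableTypeR R).
  exact: (measurableT_comp mex measurable_fst).
have mex2 : measurable_fun setT
    (fun z : 'rV[R]_n * 'rV[R]_n => `|excess z.2| : measurableTypeR R).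
  exact: (measurableT_comp mex measurable_snd).
have mc i : measurable_fun setT
    (fun z : 'rV[R]_n * 'rV[R]_n => (z.1 - z.2) ord0 i : measurableTypeR R).
  rewrite (_ : (fun _ => _) = fun z : 'rV[R]_n * 'rV[R]_n => z.1 ord0 i - z.2 ord0 i).
    apply: measurable_funB.
      exact: (measurableT_comp (measurable_coord_rV i) measurable_fst).
    exact: (measurableT_comp (measurable_coord_rV i) measurable_snd).
  by apply/funext => z; rewrite !mxE.
apply: measurableI; apply: measurable_gt0; apply: measurable_funB.
- by apply: measurable_funM => //; exact: mex2.
- by apply: measurable_sum => i; apply: measurable_funM; exact: mc.
- by apply: measurable_funM => //; exact: mex2.
- exact: mex1.
Qed.

Let ysectionE_lty y : (lebesgue_rV (ysection E y) < +oo)%E.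
Proof.
apply: (le_lt_trans _ (lebesgue_rV_eball_lty y (128 * `|excess y| + 1))).
apply: le_measure; rewrite ?inE.
- exact: open_measurable_rV.
- exact: measurable_eball.
- rewrite ysectionE => z [/= z1 _]; rewrite /eball/= enorm_lt; last first.
    by rewrite addr_ge0 ?mulr_ge0.
  have := normr_ge0 (excess y); move: z1; set r := `|_|; nra.
Qed.

Let ysection_sub_Z p y : sq (y - p) < excess p -> excess p / 16 < `|excess y| ->
  `|excess y| <= excess p / 2 -> ysection E y `<=` Z p.
Proof.
move=> y1 y2 y3 z; rewrite ysectionE => -[/= z1 z2].
have := sqD_le (z - y) (y - p); rewrite addrA subrK => z3.
have z4 := ler_norm (excess z); have z5 := ler_norm (- excess z).
rewrite normrN in z5.
by split; [split|]; rewrite /mkset; lra.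
Qed.

Let sq_mid p y : sq (2^-1 *: (p + y) - p) = sq (y - p) / 4.
Proof.
rewrite (_ : _ - p = 2^-1 *: (y - p)); last by apply/rowP => i; rewrite !mxE; field.
by rewrite dotZl dotZr; field.
Qed.

Let excess_mid p y :
  excess (2^-1 *: (p + y)) = excess p / 2 + excess y / 2 - sq (y - p) / 4.
Proof.
rewrite /excess (_ : _ - c = 2^-1 *: ((p - c) + (y - c))); last first.
  by apply/rowP => i; rewrite !mxE; field.
rewrite (_ : y - p = (y - c) - (p - c)); last first.
  by apply/rowP => i; rewrite !mxE; ring.
by move: (y - c) (p - c) => v w; rewrite !dotE (dotC v w); field.
Qed.

(* For y in Y p, either y itself is in the ball but not in Omega, or the midpoint
   of p and y is in Omega but not in the ball. *)
Lemma hull_excess_bound Omega (M : R) (X := [set q | 0 < excess q /\ exists p,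
    [/\ Omega p, sq (q - p) < 2 * excess p & excess q < 2 * excess p]]) :
  M = 8192 -> open Omega -> @convex_set R 'rV[R]_n Omega ->
  (forall p, Omega p -> excess p <= 1 / 16) ->
  open X /\ (((1 + 2 ^+ n)^-1 * M ^- n)%:E * lebesgue_rV X <=
            lebesgue_rV (Omega `+` eball c 1))%E.
Proof.
move=> M8192 oO cO Obd.
have M0 : 0 < M by rewrite M8192 ltr0n.
have k0 : 0 <= (1 + 2 ^+ n)^-1 * M ^- n :> R.
  by rewrite mulr_ge0// invr_ge0 ?addr_ge0 ?exprn_ge0 ?(ltW M0).
have oX : open X.
  rewrite (_ : X = \bigcup_(p in Omega) ([set q | 0 < excess q] `&`
      [set q | 0 < 2 * excess p - sq (q - p)] `&`
      [set q | 0 < 2 * excess p - excess q])); last first.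
    apply/seteqP; split=> q /=.
      by move=> [q0 [p [Op q1 q2]]]; exists p => //=; split; [split|] => //; rewrite subr_gt0.
    move=> [p Op [[/= q0]]]; rewrite !subr_gt0 => q1 q2; split=> //.
    by exists p.
  apply: bigcup_open => p Op; apply: openI; [apply: openI|]; apply: open_ltr.
  - exact: continuous_excess.
  - by apply: continuous_sub; [exact: continuous_cst|exact: continuous_sqB].
  - by apply: continuous_sub; [exact: continuous_cst|exact: continuous_excess].
have mD : measurable (Omega `+` eball c 1).
  by apply: measurableU; apply: measurableD; apply: open_measurable_rV => //; exact: eball_open.
split; first exact: oX.
have mX : measurable X by exact: open_measurable_rV.
apply: (@kernel_bound _ _ _ (@lebesgue_rV R n) X _ E _ mX mD measurable_E k0 ysectionE_lty).
move=> q [q0 [p [Op q1 q2]]].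
have H0 : 0 < excess p by lra.
have H1 := Obd _ Op.
set D := Omega `+` eball c 1 in mD *.
pose T y : 'rV[R]_n := 2^-1 *: p + 2^-1 *: y.
have TE y : T y = 2^-1 *: (p + y) by rewrite /T scalerDr.
pose T' y : 'rV[R]_n := - p + 2 *: y.
have TK y : T' (T y) = y by apply/rowP => i; rewrite !mxE; field.
(* The points of [D] that are midpoints of [p] and a point of [Y p]; [T'] is the inverse of the
   midpoint map [T]. *)
pose W2 := D `&` T' @^-1` (Y p).
have mY : measurable (Y p) by exact: open_measurable_rV.
have mW2 : measurable W2.
  by apply: measurableI => //; rewrite -[X in measurable X]setTI; exact: measurable_homothety_rV.
pose W := (Y p `&` D) `|` W2.
have mW : measurable W by apply: measurableU => //; exact: measurableI.
have YW : Y p `<=` W `|` (T @^-1` W).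
  move=> y Yy; have [[/= y1 y2] y3] := Yy.
  have [Oy|Oy] := pselect (Omega y); last first.
    left; left; split=> //; right; split=> //.
    by rewrite eballE; lra.
  right; right; split; last by rewrite /= TK.
  left; split.
    have := convex_setP cO (t := 2^-1) _ _ Op Oy; rewrite /T.
    have -> : 1 - 2^-1 = 2^-1 :> R by field.
    by apply; rewrite ?invr_ge0 ?invf_le1 ?ler1n.
  by rewrite eballE TE excess_mid; lra.
have mZ : measurable (Z p) by exact: open_measurable_rV.
have Zfin : (lebesgue_rV (Z p) < +oo)%E.
  apply: (le_lt_trans _ (lebesgue_rV_eball_lty p (130 * excess p + 1))).
  apply: le_measure; rewrite ?inE//; first exact: measurable_eball.
  by move=> z [[/= z1 _] _]; rewrite /eball/=; rewrite enorm_lt; nra.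
have Z0 : (0 < lebesgue_rV (Z p))%E.
  apply: lebesgue_rV_open_gt0 => //; exists p.
  by split; [split|]; rewrite /mkset ?subrr ?dot0l; lra.
have ZE : lebesgue_rV (Z p) = (fine (lebesgue_rV (Z p)))%:E.
  by rewrite fineK// ge0_fin_numE// ltW.
(* Points of [Y p] have depth between [h / 16] and [h / 8]; the midpoints have height between
   [3 h / 16] and [h / 2], where [h = excess p]. *)
have WE y : W y -> [/\ D y, sq (y - p) < excess p, excess p / 16 < `|excess y| &
    `|excess y| <= excess p / 2].
  case=> [[[[/= y1 y2] y3] Dy]|[Dy [[/= y1 y2] y3]]].
    by split=> //; rewrite ?ltr0_norm; lra.
  move: y1 y2 y3 Dy.
  have -> : y = T (T' y) by apply/rowP => i; rewrite !mxE; field.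
  rewrite TK; move: (T' y) => x y1 y2 y3 Dx.
  have := excess_mid p x; have := sq_mid p x; rewrite -TE => -> ->.
  rewrite gtr0_norm; last by lra.
  by have := dot_ge0 (x - p); split => //; lra.
exists W, (fine (lebesgue_rV (Z p))); split=> //.
- move=> y /WE[Dy y1 y2 y3]; split=> //; rewrite /xsection/= inE /E/=.
  have := sqD_le (q - p) (p - y); rewrite addrA subrK (sqC p) => z3.
  by split; rewrite ?(gtr0_norm q0); lra.
- by rewrite fine_gt0// Z0.
- move=> y /WE[Dy y1 y2 y3]; apply/andP; split.
    apply: lebesgue_rV_open_gt0 => //; exists y; rewrite ysectionE/= subrr dot0l.
    by split; lra.
  rewrite -ZE; apply: le_measure; rewrite ?inE//; first exact: open_measurable_rV.
  exact: ysection_sub_Z.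
(* Origin of the fraction: contracting [Z p] into [Y p] costs [M ^ n], and charging each [y] of
   [Y p] either to itself or to its midpoint [T y] costs [1 + 2 ^ n], because [T] halves lengths. *)
have [v vZ] := ZY H0 H1; rewrite -M8192 in vZ.
have ZY' : (lebesgue_rV (Z p) <= (M ^+ n)%:E * lebesgue_rV (Y p))%E.
  rewrite -[X in (X ^+ n)%:E](invrK M) -(lebesgue_rV_homothety v)// ?invr_gt0//.
  apply: le_measure; rewrite ?inE//.
  by rewrite -[X in measurable X]setTI; exact: measurable_homothety_rV.
have mT : measurable (T @^-1` W).
  by rewrite -[X in measurable X]setTI; exact: measurable_homothety_rV.
have YW' : (lebesgue_rV (Y p) <= (1 + 2 ^+ n)%:E * lebesgue_rV W)%E.
  have /le_trans : (lebesgue_rV (Y p) <= lebesgue_rV (W `|` T @^-1` W))%E.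
    by apply: le_measure; rewrite ?inE//; exact: measurableU.
  apply; apply: (@le_trans _ _ (lebesgue_rV W + lebesgue_rV (T @^-1` W))%E).
    exact: measureU2.
  have -> : lebesgue_rV (T @^-1` W) = (((2^-1)^-1 ^+ n)%:E * lebesgue_rV W)%E.
    by apply: lebesgue_rV_homothety; rewrite ?invr_gt0.
  rewrite invrK EFinD ge0_muleDl ?mul1e//.
rewrite -mulrA EFinM lee_pdivrMl//.
  rewrite EFinM -ZE lee_pdivrMl ?exprn_gt0//; apply: le_trans ZY' _.
  by apply: lee_wpmul2l; rewrite ?lee_fin ?exprn_ge0 ?(ltW M0).
Qed.

End hull_excess.

(** * Integration by parts with difference quotients *)

Section bounded_support.
Context {R : realType} {n : nat}.
Implicit Types (f g : 'rV[R]_n -> R) (v x : 'rV[R]_n).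

Local Notation mu := (@lebesgue_rV R n).
Local Notation mfun f := (measurable_fun [set: 'rV[R]_n] (f : 'rV[R]_n -> measurableTypeR R)).

(** One inequality controls both size and support, and its right-hand side is directly the
    integrable function needed for dominated convergence. *)
Definition supp_bound (M r : R) f := forall x, `|f x| <= M * \1_(eball 0 r) x.

Definition bounded_supp f := mfun f /\ exists M r, supp_bound M r f.

Definition intR f : R := \int[mu]_x f x.

Let integrable_indic r : mu.-integrable setT (EFin \o (\1_(eball 0 r) : 'rV[R]_n -> R)).
Proof.
have me : measurable (eball 0 r : set 'rV[R]_n) by exact: measurable_eball.
apply/integrableP; split; first exact/measurable_EFinP/measurable_indicP.
rewrite (eq_integral (fun x => (\1_(eball 0 r : set 'rV[R]_n) x)%:E)).
  by rewrite integral_indic// setIT; exact: lebesgue_rV_eball_lty.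
by move=> x _; rewrite /= ger0_norm.
Qed.

Lemma bounded_supp_integrable f : bounded_supp f -> mu.-integrable setT (EFin \o f).
Proof.
move=> [mf [M [r fM]]].
apply: (@le_integrable _ _ _ mu setT measurableT _ (fun x => M%:E * (EFin \o \1_(eball 0 r)) x)%E).
- exact/measurable_EFinP.
- move=> x _; rewrite /= lee_fin (le_trans (fM x))// ler_norm.
  done.
- exact: integrableZl.
Qed.

Lemma bounded_suppD f g : bounded_supp f -> bounded_supp g ->
  bounded_supp (fun x => f x + g x).
Proof.
move=> [mf [M [r fM]]] [mg [N [s gN]]]; split; first exact: measurable_funD.
exists (`|M| + `|N|), (Num.max r s) => x.
apply: le_trans (ler_normD _ _) _; rewrite mulrDl.
have h t (K : R) : t <= Num.max r s -> K * \1_(eball 0 t) x <= `|K| * \1_(eball 0 (Num.max r s)) x.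
  move=> tm; apply: (@le_trans _ _ (`|K| * \1_(eball 0 t) x)).
    by rewrite ler_wpM2r// ler_norm.
  rewrite ler_wpM2l// !indicE ler_nat.
  have [|//] := boolP (x \in eball 0 t); rewrite inE /eball/= => xt.
  by rewrite mem_set// /eball/= (lt_le_trans xt).
by apply: lerD; [apply: le_trans (fM x) _|apply: le_trans (gN x) _]; apply: h;
  rewrite le_max lexx ?orbT.
Qed.

Lemma bounded_suppM f g B : bounded_supp f -> mfun g -> (forall x, `|g x| <= B) ->
  bounded_supp (fun x => f x * g x).
Proof.
move=> [mf [M [r fM]]] mg gB; split; first exact: measurable_funM.
exists (M * B), r => x; rewrite normrM mulrAC ler_pM//.
Qed.

Lemma bounded_suppZ (k : R) f : bounded_supp f -> bounded_supp (fun x => k * f x).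
Proof.
move=> bf; rewrite (_ : (fun _ => _) = fun x => f x * k).
  exact: (@bounded_suppM f (cst k) `|k|).
by apply/funext => x; rewrite mulrC.
Qed.

Lemma bounded_suppB f g : bounded_supp f -> bounded_supp g ->
  bounded_supp (fun x => f x - g x).
Proof.
move=> bf /(bounded_suppZ (-1)) bg.
rewrite (_ : (fun _ => _) = fun x => f x + -1 * g x); first exact: bounded_suppD.
by apply/funext => x; rewrite mulN1r.
Qed.

Lemma bounded_supp_sum (I : Type) (s : seq I) (F : I -> 'rV[R]_n -> R) :
  (forall i, bounded_supp (F i)) -> bounded_supp (fun x => \sum_(i <- s) F i x).
Proof.
move=> bF; elim: s => [|i s IH].
  rewrite (_ : (fun _ => _) = cst 0); last by apply/funext => x; rewrite big_nil.
  by split; [exact: measurable_cst|exists 0, 0 => x; rewrite normr0 mul0r].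
rewrite (_ : (fun _ => _) = fun x => F i x + \sum_(j <- s) F j x).
  exact: bounded_suppD.
by apply/funext => x; rewrite big_cons.
Qed.

Lemma measurable_shift f v : mfun f -> mfun (fun x => f (x + v)).
Proof.
move=> mf; apply: (measurableT_comp mf).
have := @measurable_homothety_rV R n 1 v.
by rewrite (_ : (fun _ => _) = fun x => x + v)//; apply/funext => x; rewrite scale1r addrC.
Qed.

Lemma bounded_supp_shift f v : bounded_supp f -> bounded_supp (fun x => f (x + v)).
Proof.
move=> [mf [M [r fM]]]; split; first exact: measurable_shift.
exists `|M|, (r + enorm v) => x; apply: le_trans (fM _) _.
apply: (@le_trans _ _ (`|M| * \1_(eball 0 r) (x + v))).
  by rewrite ler_wpM2r// ler_norm.
rewrite ler_wpM2l// !indicE ler_nat.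
have [|//] := boolP (_ \in eball 0 r); rewrite inE /eball/= subr0 => xr.
rewrite mem_set// /eball/= subr0.
have := enormD (x + v) (- v); rewrite addrK enormN => /le_lt_trans; apply.
by rewrite ltrD2r.
Qed.

Lemma intRD f g : bounded_supp f -> bounded_supp g ->
  intR (fun x => f x + g x) = intR f + intR g.
Proof. by move=> bf bg; apply: RintegralD => //; exact: bounded_supp_integrable. Qed.

Lemma intRB f g : bounded_supp f -> bounded_supp g ->
  intR (fun x => f x - g x) = intR f - intR g.
Proof. by move=> bf bg; apply: RintegralB => //; exact: bounded_supp_integrable. Qed.

Lemma intRZ k f : bounded_supp f -> intR (fun x => k * f x) = k * intR f.
Proof. by move=> bf; apply: RintegralZl => //; exact: bounded_supp_integrable. Qed.

Lemma intR_sum (I : Type) (s : seq I) (F : I -> 'rV[R]_n -> R) :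
  (forall i, bounded_supp (F i)) ->
  intR (fun x => \sum_(i <- s) F i x) = \sum_(i <- s) intR (F i).
Proof.
move=> bF; elim: s => [|i s IH].
  rewrite big_nil /intR /Rintegral integral0_eq// => x _.
  by rewrite big_nil.
rewrite big_cons -IH -intRD//; last exact: bounded_supp_sum.
by apply: eq_Rintegral => x _; rewrite big_cons.
Qed.

Lemma le_intR f g : bounded_supp f -> bounded_supp g -> (forall x, f x <= g x) ->
  intR f <= intR g.
Proof.
by move=> bf bg fg; apply: le_Rintegral => //; exact: bounded_supp_integrable.
Qed.

Lemma intR_ge0 f : (forall x, 0 <= f x) -> 0 <= intR f.
Proof. by move=> f0; apply: Rintegral_ge0 => x _; exact: f0. Qed.

Lemma eq_intR f g : f =1 g -> intR f = intR g.
Proof. by move=> fg; congr intR; exact/funext. Qed.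

Lemma bounded_supp_indic (A : set 'rV[R]_n) r :
  measurable A -> A `<=` eball 0 r -> bounded_supp (\1_A : 'rV[R]_n -> R).
Proof.
move=> mA Ar; split; first exact/measurable_indicP.
exists 1, r => x; rewrite mul1r ger0_norm// !indicE ler_nat.
have [|//] := boolP (x \in A); rewrite inE => /Ar Ax.
by rewrite mem_set.
Qed.

Lemma intR_indic (A : set 'rV[R]_n) : measurable A ->
  intR (\1_A : 'rV[R]_n -> R) = fine (mu A).
Proof. by move=> mA; rewrite /intR /Rintegral integral_indic// setIT. Qed.

Lemma intR_shift f v : bounded_supp f -> intR (fun x => f (x + v)) = intR f.
Proof.
move=> bf; rewrite /intR /Rintegral.
have mv : measurable_fun setT (fun x : 'rV[R]_n => x + v).
  have := @measurable_homothety_rV R n 1 v.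
  by rewrite (_ : (fun _ => _) = fun x => x + v)//; apply/funext => x; rewrite scale1r addrC.
have mf : measurable_fun setT (EFin \o f) by apply/measurable_EFinP; exact: bf.1.
have := @integral_pushforward _ _ _ _ R _ mv mu setT (EFin \o f) mf.
rewrite preimage_setT => /(_ _ measurableT) <-; last first.
  exact: bounded_supp_integrable (bounded_supp_shift v bf).
congr fine; apply: eq_measure_integral => A mA _.
have := @lebesgue_rV_homothety R n 1 v A ltr01 mA; rewrite invr1 expr1n mul1e => hA.
transitivity (lebesgue_rV ((fun x => v + 1 *: x) @^-1` A)); last exact: hA.
rewrite /pushforward; congr lebesgue_rV; by apply/seteqP; split=> x /=; rewrite scale1r addrC.
Qed.

Lemma measurable_lim (F : nat -> 'rV[R]_n -> R) f :
  (forall k, mfun (F k)) -> (forall x, F k x @[k --> \oo] --> f x) -> mfun f.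
Proof. by move=> mF Ff; apply: (measurable_fun_cvg mF) => x _; exact: Ff. Qed.

Lemma supp_bound_lim (F : nat -> 'rV[R]_n -> R) f M r :
  (forall k, supp_bound M r (F k)) -> (forall x, F k x @[k --> \oo] --> f x) ->
  supp_bound M r f.
Proof.
move=> Fb Ff x.
have Fx : `|F k x| @[k --> \oo] --> `|f x| by apply: cvg_norm; exact: Ff.
rewrite -(cvg_lim _ Fx)//; apply: limr_le; first by apply/cvg_ex; exists `|f x|.
by apply: nearW => k; exact: Fb.
Qed.

Lemma intR_cvg (F : nat -> 'rV[R]_n -> R) f M r :
  (forall k, mfun (F k)) -> (forall k, supp_bound M r (F k)) ->
  (forall x, F k x @[k --> \oo] --> f x) -> intR (F k) @[k --> \oo] --> intR f.
Proof.
move=> mF Fb Ff.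
have bf : bounded_supp f.
  by split; [exact: measurable_lim mF Ff|exists M, r; exact: supp_bound_lim Fb Ff].
have ig : mu.-integrable setT
    (fun x => M%:E * (EFin \o (\1_(eball 0 r) : 'rV[R]_n -> R)) x)%E.
  by apply: integrableZl => //; exact: integrable_indic.
have [] := @dominated_convergence _ _ _ mu setT measurableT
  (fun k => EFin \o F k) (EFin \o f)
  (fun x => M%:E * (EFin \o (\1_(eball 0 r) : 'rV[R]_n -> R)) x)%E.
- by move=> k; apply/measurable_EFinP; exact: mF.
- by apply/measurable_EFinP; exact: bf.1.
- by apply: aeW => x _; apply: cvg_EFin; [near=> k|exact: Ff].
- exact: ig.
- by apply: aeW => x k _; rewrite /= lee_fin; exact: Fb.
move=> intf _ Icvg.
have If : (\int[mu]_x (f x)%:E)%E \is a fin_num.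
  by apply: integrable_fin_num.
by move: Icvg; rewrite -(fineK If) => /fine_cvgP[_].
Unshelve. all: by end_near. Qed.

End bounded_support.

Section difference_quotients.
Context {R : realType} {n : nat}.
Implicit Types (u w h f : 'rV[R]_n -> R) (g : 'rV[R]_n -> 'rV[R]_n) (x v : 'rV[R]_n).

Local Notation mfun f := (measurable_fun [set: 'rV[R]_n] (f : 'rV[R]_n -> measurableTypeR R)).

(** A quantitative form of differentiability: [L] dominates the difference quotients and the
    quadratic remainder makes them converge pointwise to [g], which is what dominated convergence
    asks for. *)
Definition C11 u g (L C : R) :=
  (forall x v, `|u (x + v) - u x| <= L * enorm v) /\
  (forall x v, `|u (x + v) - u x - dot (g x) v| <= C * dot v v).

Definition step k : R := k.+1%:R^-1.

Lemma step_gt0 k : 0 < step k. Proof. by rewrite invr_gt0. Qed.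

Lemma step_le1 k : step k <= 1. Proof. by rewrite invf_le1// ler1n. Qed.

Lemma cvg_step : step k @[k --> \oo] --> (0 : R).
Proof. exact: cvg_harmonic. Qed.

Definition dq u v k x := (u (x + step k *: v) - u x) / step k.

Lemma dot_delta x i : dot x 'e_i = x ord0 i.
Proof.
rewrite /dot (bigD1 i)//= big1 => [|j ji]; rewrite mxE eqxx/=.
  by rewrite mulr1 addr0.
by rewrite (negbTE ji) mulr0.
Qed.

Lemma dot_delta_delta (i : 'I_n) : dot ('e_i : 'rV[R]_n) 'e_i = 1.
Proof. by rewrite dot_delta mxE !eqxx. Qed.

Lemma enorm_delta (i : 'I_n) : enorm ('e_i : 'rV[R]_n) = 1.
Proof. by rewrite enormE dot_delta_delta sqrtr1. Qed.

Section C11_theory.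
Variables (u : 'rV[R]_n -> R) (g : 'rV[R]_n -> 'rV[R]_n) (L C : R).
Hypothesis ugC : C11 u g L C.

Lemma C11_continuous : continuous u.
Proof.
apply: (@lipschitz_continuous _ _ _ L) => x y.
by have := ugC.1 x (y - x); rewrite [x + _]addrC subrK.
Qed.

Lemma C11_measurable : mfun u.
Proof. exact: continuous_measurable_rV C11_continuous. Qed.

Lemma C11_dq_le v k x : enorm v = 1 -> `|dq u v k x| <= L.
Proof.
move=> v1; rewrite /dq normrM normfV (gtr0_norm (step_gt0 k)).
rewrite ler_pdivrMr ?step_gt0//; have := ugC.1 x (step k *: v).
by rewrite enormZ v1 mulr1 (gtr0_norm (step_gt0 k)).
Qed.

Lemma C11_dq_cvg v x : dq u v k x @[k --> \oo] --> dot (g x) v.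
Proof.
have dqB k : `|dot (g x) v - dq u v k x| <= C * dot v v * step k.
  rewrite distrC; have := ugC.2 x (step k *: v); rewrite !dotZr !dotZl => H.
  rewrite -(ler_pM2l (step_gt0 k)) -{1}(gtr0_norm (step_gt0 k)) -normrM.
  rewrite mulrBr /dq mulrCA mulfV ?gt_eqF ?step_gt0// mulr1.
  by apply: le_trans H _; rewrite le_eqVlt; apply/orP; left; apply/eqP; ring.
have s0 : C * dot v v * step k @[k --> \oo] --> (0 : R).
  by rewrite -(mulr0 (C * dot v v)); apply: cvgMr; exact: cvg_step.
apply/cvgrPdist_le => e e0.
have /cvgrPdist_le/(_ e e0) := s0; apply: filterS => k.
rewrite sub0r normrN; apply: le_trans; apply: le_trans (dqB k) _.
exact: ler_norm.
Qed.

Lemma dq_measurable f v k : mfun f -> mfun (dq f v k).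
Proof.
move=> mf; apply: measurable_funM => //; apply: measurable_funB => //.
exact: measurable_shift.
Qed.

Lemma C11_grad_measurable i : mfun (fun x => g x ord0 i).
Proof.
apply: (@measurable_lim _ _ (dq u 'e_i)) => [k|x].
  exact: dq_measurable C11_measurable.
by rewrite -dot_delta; exact: C11_dq_cvg.
Qed.

End C11_theory.

Lemma C11B u g L C u' g' L' C' : C11 u g L C -> C11 u' g' L' C' ->
  C11 (fun x => u x - u' x) (fun x => g x - g' x) (L + L') (C + C').
Proof.
move=> [u1 u2] [u1' u2']; split=> x v.
  rewrite mulrDl; apply: le_trans (lerD (u1 x v) (u1' x v)).
  rewrite (_ : _ - _ = (u (x + v) - u x) - (u' (x + v) - u' x)); last by ring.
  exact: ler_normB.
rewrite mulrDl; apply: le_trans (lerD (u2 x v) (u2' x v)).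
rewrite dotDl dotNl (_ : _ - _ = (u (x + v) - u x - dot (g x) v) -
  (u' (x + v) - u' x - dot (g' x) v)); last by ring.
exact: ler_normB.
Qed.

Definition vanish_out (r : R) u := forall x, r <= enorm x -> u x = 0.

Lemma bounded_supp_vanish u M r : mfun u -> (forall x, `|u x| <= M) ->
  vanish_out r u -> bounded_supp u.
Proof.
move=> mu uM ur; split => //; exists M, r => x; rewrite indicE.
have [_|] := boolP (x \in eball 0 r); first by rewrite mulr1.
rewrite notin_setE /eball/= subr0 => /negP; rewrite -leNgt => /ur ->.
by rewrite normr0 mulr0.
Qed.

Lemma vanish_dq_supp u r v k L : enorm v = 1 -> vanish_out r u ->
  (forall x, `|dq u v k x| <= L) -> supp_bound L (r + 1) (dq u v k).
Proof.
move=> v1 ur uL x; rewrite indicE.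
have [_|] := boolP (x \in eball 0 (r + 1)); first by rewrite mulr1.
rewrite notin_setE /eball/= subr0 => /negP; rewrite -leNgt => xr.
rewrite /dq !ur ?subr0 ?mul0r ?normr0 ?mulr0//.
  by apply: le_trans xr; rewrite lerDl.
have := enormD (x + step k *: v) (- (step k *: v)).
rewrite addrK enormN enormZ v1 mulr1 gtr0_norm ?step_gt0//.
have := step_le1 k; lra.
Qed.

Lemma supp_boundM f f' M B r : supp_bound M r f -> (forall x, `|f' x| <= B) ->
  supp_bound (M * B) r (fun x => f x * f' x).
Proof. by move=> fM fB x; rewrite normrM mulrAC ler_pM. Qed.

(** Translation invariance moves the shift by [step k *: v] from [f] to [u], where it becomes a
    difference quotient along [- v]. *)
Lemma discrete_by_parts u f B v k : bounded_supp u -> mfun f ->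
  (forall x, `|f x| <= B) ->
  intR (fun x => u x * dq f v k x) = - intR (fun x => dq u (- v) k x * - f x).
Proof.
move=> bu mf fB; set z := step k *: v.
have bu1 : bounded_supp (fun x => u x * f (x + z)).
  apply: (@bounded_suppM _ _ u (fun x => f (x + z)) B) => //.
  exact: measurable_shift.
have bu2 : bounded_supp (fun x => u x * f x) by exact: bounded_suppM fB.
have bu3 : bounded_supp (fun x => u (x - z) * f x).
  by apply: (bounded_suppM _ mf fB); exact: bounded_supp_shift.
have E1 : intR (fun x => u x * f (x + z)) = intR (fun x => u (x - z) * f x).
  rewrite -(intR_shift z bu3); apply: eq_intR => x.
  by rewrite addrK.
transitivity ((step k)^-1 * (intR (fun x => u x * f (x + z)) - intR (fun x => u x * f x))).
  rewrite -intRB// -intRZ; last exact: bounded_suppB.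
  by apply: eq_intR => x; rewrite /dq -/z; ring.
rewrite E1 -intRB// -intRZ; last exact: bounded_suppB.
rewrite -mulN1r -intRZ.
  by apply: eq_intR => x; rewrite /dq scalerN -/z; ring.
rewrite (_ : (fun _ => _) = fun x => - (step k)^-1 * (u (x - z) * f x - u x * f x)).
  by apply: bounded_suppZ; exact: bounded_suppB.
by apply/funext => x; rewrite /dq scalerN -/z; ring.
Qed.

(** The limit of [discrete_by_parts]: [u] supplies the bounded support on both sides, [M] and
    [L * B] the domination. *)
Lemma by_parts u g L C r f f' B M i : C11 u g L C -> (forall x, `|u x| <= 1) ->
  vanish_out r u -> mfun f -> (forall x, `|f x| <= B) ->
  (forall k x, `|dq f 'e_i k x| <= M) ->
  (forall x, dq f 'e_i k x @[k --> \oo] --> f' x) ->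
  intR (fun x => u x * f' x) = - intR (fun x => g x ord0 i * f x).
Proof.
move=> ugC u1 ur mf fB fM ff'.
have mu := C11_measurable ugC.
have bu := bounded_supp_vanish mu u1 ur.
have ub : supp_bound 1 r u.
  move=> x; rewrite indicE; have [_|] := boolP (x \in eball 0 r); first by rewrite mulr1.
  rewrite notin_setE /eball/= subr0 => /negP; rewrite -leNgt => /ur ->.
  by rewrite normr0 mulr0.
have eN1 : enorm (- 'e_i : 'rV[R]_n) = 1 by rewrite enormN enorm_delta.
have l1 : intR (fun x => u x * dq f 'e_i k x) @[k --> \oo] --> intR (fun x => u x * f' x).
  apply: (@intR_cvg _ _ (fun k x => u x * dq f 'e_i k x) _ (1 * M) r) => [k|k|x].
  - by apply: measurable_funM => //; exact: dq_measurable.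
  - exact: supp_boundM.
  - by apply: cvgMr; exact: ff'.
have l2 : - intR (fun x => dq u (- 'e_i) k x * - f x) @[k --> \oo] -->
    - intR (fun x => dot (g x) (- 'e_i) * - f x).
  apply: cvgN.
  apply: (@intR_cvg _ _ (fun k x => dq u (- 'e_i) k x * - f x) _ (L * B) (r + 1)) => [k|k|x].
  - apply: measurable_funM; first exact: dq_measurable.
    exact: measurable_funN.
  - apply: supp_boundM => [|x]; last by rewrite normrN.
    by apply: vanish_dq_supp => // x; exact: (C11_dq_le ugC).
  - by apply: cvgMl; exact: (C11_dq_cvg ugC).
have -> : intR (fun x => g x ord0 i * f x) = intR (fun x => dot (g x) (- 'e_i) * - f x).
  by apply: eq_intR => x; rewrite dotNr dot_delta mulrNN.
have El : (fun k => intR (fun x => u x * dq f 'e_i k x)) =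
    (fun k => - intR (fun x => dq u (- 'e_i) k x * - f x)).
  by apply/funext => k; exact: discrete_by_parts fB.
by apply: (cvg_unique _ l1) => //; rewrite El; exact: l2.
Qed.

(* By translation invariance the discrete version of this integral is minus the
   integral of w times a second difference of h. *)
Lemma grad_convex_le0 w g L C r B h gh Lh Ch i : C11 w g L C ->
  (forall x, 0 <= w x <= B) -> vanish_out r w ->
  C11 h gh Lh Ch -> (forall x v, 0 <= h (x + v) + h (x - v) - 2 * h x) ->
  intR (fun x => g x ord0 i * gh x ord0 i) <= 0.
Proof.
move=> wgC wB wr hC hc.
have mw := C11_measurable wgC; have mh := C11_measurable hC.
have bw : bounded_supp w.
  by apply: (bounded_supp_vanish (M := B) mw _ wr) => x; have /andP[? ?] := wB x; rewrite ger0_norm.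
have e1 := enorm_delta i.
have l : intR (fun x => dq w 'e_i k x * dq h 'e_i k x) @[k --> \oo] -->
    intR (fun x => g x ord0 i * gh x ord0 i).
  apply: (@intR_cvg _ _ (fun k x => dq w 'e_i k x * dq h 'e_i k x) _ (L * Lh) (r + 1)) => [k|k|x].
  - by apply: measurable_funM; exact: dq_measurable.
  - apply: supp_boundM => [|x]; last exact: (C11_dq_le hC).
    by apply: vanish_dq_supp => // x; exact: (C11_dq_le wgC).
  - rewrite -!dot_delta; apply: cvgM; first exact: (C11_dq_cvg wgC).
    exact: (C11_dq_cvg hC).
rewrite -(cvg_lim _ l)//; apply: limr_le.
  by apply/cvg_ex; eexists; exact: l.
apply: nearW => k; set z := step k *: ('e_i : 'rV[R]_n).
pose a x := dq h 'e_i k x.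
have aB x : `|a x| <= Lh by exact: (C11_dq_le hC).
have ma : mfun a by exact: dq_measurable.
have b1 : bounded_supp (fun x => w (x + z) * a x).
  by apply: (bounded_suppM _ ma aB); exact: bounded_supp_shift.
have b2 : bounded_supp (fun x => w x * a x) by exact: bounded_suppM aB.
have b3 : bounded_supp (fun x => w x * a (x - z)).
  by apply: (@bounded_suppM _ _ w (fun x => a (x - z)) Lh) => //; exact: measurable_shift.
have E1 : intR (fun x => w (x + z) * a x) = intR (fun x => w x * a (x - z)).
  rewrite -(intR_shift z b3); apply: eq_intR => x.
  by rewrite addrK.
have -> : intR (fun x => dq w 'e_i k x * dq h 'e_i k x) =
    - ((step k)^-1 * intR (fun x => w x * a x - w x * a (x - z))).
  transitivity ((step k)^-1 * (intR (fun x => w (x + z) * a x) - intR (fun x => w x * a x))).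
    rewrite -intRB// -intRZ; last exact: bounded_suppB.
    by apply: eq_intR => x; rewrite {1}/dq -/z /a; ring.
  by rewrite E1 intRB//; ring.
rewrite oppr_le0 mulr_ge0 ?invr_ge0 ?(ltW (step_gt0 k))//.
apply: intR_ge0 => x; rewrite -mulrBr mulr_ge0//; first by have /andP[] := wB x.
have := hc x z; rewrite /a /dq -/z subrK -mulrBl => H.
rewrite mulr_ge0 ?invr_ge0 ?(ltW (step_gt0 k))//; lra.
Qed.

End difference_quotients.

(** * Cutoff functions of convex sets *)

Section smooth_positive_part.
Context {R : realType}.
Variable t : R.
Hypothesis t0 : 0 < t.
Implicit Types x y : R.

(* A C^1 substitute for the positive part with slope at most 1; being close to
   linear, it makes the cutoffs below almost optimal: the slope of a ramp of
   height 1 and width e is at most (1 + t) / e. *)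
Definition psi x : R := if x <= 0 then 0 else x ^+ 2 / (x + t).
Definition dpsi x : R := if x <= 0 then 0 else 1 - (t / (x + t)) ^+ 2.

Lemma dpsi_itv x : 0 <= dpsi x <= 1.
Proof.
rewrite /dpsi; case: ifPn => [_|]; first by rewrite lexx ler01.
rewrite -ltNge => x0; have xt : 0 < x + t by rewrite addr_gt0.
have a0 : 0 <= t / (x + t) by rewrite divr_ge0 ?ltW.
have a1 : t / (x + t) <= 1 by rewrite ler_pdivrMr// mul1r lerDr ltW.
by apply/andP; split; nra.
Qed.

(** On the left, convexity; on the right, the curvature bound [psi'' = 2 t^2 / (x + t)^3 <= 2 / t]
    for [x > 0]. As [psi''] jumps at 0, the four sign cases are computed by hand. *)
Lemma psi_taylor x y :
  0 <= psi y - psi x - dpsi x * (y - x) <= 2 / t * (y - x) ^+ 2.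
Proof.
have xt z : 0 < z -> 0 < z + t by move=> z0; rewrite addr_gt0.
have c0 : 0 < 2 / t by rewrite divr_gt0.
rewrite /psi /dpsi; have [y0|y0] := leP y 0; have [x0|x0] := leP x 0.
- by rewrite mul0r !subr0 lexx mulr_ge0 ?sqr_ge0 ?ltW.
- have x1 := xt _ x0.
  have d0 : 1 - (t / (x + t)) ^+ 2 = x * (x + 2 * t) / (x + t) ^+ 2.
    by field; rewrite gt_eqF.
  rewrite d0 sub0r.
  have -> : - (x ^+ 2 / (x + t)) - x * (x + 2 * t) / (x + t) ^+ 2 * (y - x) =
     x / (x + t) ^+ 2 * (x * t - y * (x + 2 * t)).
    by field; rewrite gt_eqF.
  apply/andP; split.
    apply: mulr_ge0; first by rewrite divr_ge0 ?sqr_ge0 ?(ltW x0).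
    have y1 : 0 <= - y * (x + 2 * t).
      apply: mulr_ge0; first by rewrite oppr_ge0.
      by rewrite addr_ge0 ?mulr_ge0 ?(ltW x0) ?(ltW t0).
    by have := mulr_gt0 x0 t0; lra.
  have D : 0 < t * (x + t) ^+ 2 by rewrite mulr_gt0 ?exprn_gt0.
  have -> : x / (x + t) ^+ 2 * (x * t - y * (x + 2 * t)) =
      x * (x * t - y * (x + 2 * t)) * t / (t * (x + t) ^+ 2).
    by field; rewrite !gt_eqF.
  have -> : 2 / t * (y - x) ^+ 2 = 2 * (y - x) ^+ 2 * (x + t) ^+ 2 / (t * (x + t) ^+ 2).
    by field; rewrite !gt_eqF.
  rewrite ler_pM2r ?invr_gt0//.
  have b0 : 0 <= - y by rewrite oppr_ge0.
  move: (- y) (opprK y) b0 => b <- b0 {d0 D y0 xt c0}.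
  have [x0' t0'] := (ltW x0, ltW t0).
  (* With [b = - y], this is exactly the difference of the two sides, and every coefficient is
     nonnegative. *)
  have : 0 <= 2 * x ^+ 4 + 4 * x ^+ 3 * t + x ^+ 2 * t ^+ 2 + 4 * x ^+ 3 * b +
      7 * x ^+ 2 * b * t + 2 * x * b * t ^+ 2 + 2 * b ^+ 2 * (x + t) ^+ 2.
    by rewrite !addr_ge0 ?mulr_ge0 ?exprn_ge0// addr_ge0.
  rewrite -subr_ge0 => /le_trans; apply; rewrite le_eqVlt; apply/orP; left.
  by apply/eqP; ring.
- rewrite mul0r !subr0; apply/andP; split.
    by apply: divr_ge0; [exact: sqr_ge0|exact: ltW (xt _ y0)].
  apply: (@le_trans _ _ (y ^+ 2 / t)).
    by rewrite ler_wpM2l ?sqr_ge0// lef_pV2 ?posrE ?xt// lerDr ltW.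
  rewrite mulrC (mulrC 2) -mulrA ler_wpM2l ?invr_ge0 ?ltW//.
  by nra.
- have x1 := xt _ x0; have y1 := xt _ y0.
  have -> : y ^+ 2 / (y + t) - x ^+ 2 / (x + t) - (1 - (t / (x + t)) ^+ 2) * (y - x) =
      t ^+ 2 * (y - x) ^+ 2 / ((x + t) ^+ 2 * (y + t)).
    by field; rewrite !gt_eqF.
  have d0 : 0 < (x + t) ^+ 2 * (y + t) by rewrite mulr_gt0 ?exprn_gt0.
  apply/andP; split.
    by apply: divr_ge0; [rewrite mulr_ge0 ?sqr_ge0|exact: ltW d0].
  rewrite ler_pdivrMr// (_ : 2 / t * _ * _ =
    2 * ((x + t) ^+ 2 * (y + t)) / t * (y - x) ^+ 2); last by ring.
  rewrite ler_wpM2r ?sqr_ge0// ler_pdivlMr//.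
  have h1 : t ^+ 2 <= (x + t) ^+ 2.
    by rewrite ler_sqr ?nnegrE ?(ltW t0) ?(ltW x1)// lerDr ltW.
  have h2 : t ^+ 2 * t <= (x + t) ^+ 2 * (y + t).
    by rewrite ler_pM ?sqr_ge0 ?(ltW t0)// lerDr ltW.
  have h3 : 0 <= t ^+ 2 * t by rewrite mulr_ge0 ?sqr_ge0 ?(ltW t0).
  by move: h2 h3; move: (t ^+ 2 * t) (_ * (y + t)) => a b; lra.
Qed.

Lemma psi_ge0 x : 0 <= psi x.
Proof.
rewrite /psi; case: ifPn => //; rewrite -ltNge => x0.
by rewrite divr_ge0 ?sqr_ge0// addr_ge0 ?ltW.
Qed.

Lemma psi_le x y : x <= y -> psi x <= psi y.
Proof.
move=> xy; have /andP[H _] := psi_taylor x y; have /andP[d0 _] := dpsi_itv x.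
have : 0 <= dpsi x * (y - x) by rewrite mulr_ge0// subr_ge0.
by lra.
Qed.

Lemma psi_lipschitz x y : `|psi y - psi x| <= `|y - x|.
Proof.
wlog xy : x y / x <= y => [H|].
  by have [/H//|/ltW/H] := leP x y; rewrite distrC (distrC y).
have psi0 := psi_le xy.
rewrite !ger0_norm ?subr_ge0//.
have /andP[H _] := psi_taylor y x; have /andP[d0 d1] := dpsi_itv y.
have : dpsi y * (y - x) <= y - x by rewrite ler_piMl// subr_ge0.
lra.
Qed.

End smooth_positive_part.

(** * Projection on a compact convex set and smoothed distance *)

Section projection.
Context {R : realType} {n : nat}.
Implicit Types (A : set 'rV[R]_n) (x y v : 'rV[R]_n).

Definition is_projection A (proj : 'rV[R]_n -> 'rV[R]_n) :=
  forall x, A (proj x) /\ forall y, A y -> dot (x - proj x) (y - proj x) <= 0.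

(** A nearest point [p] has the obtuse-angle property: if the angle at [p] towards some [y] of [A]
    were acute, a short move from [p] towards [y] would decrease the distance. *)
Lemma projection_exists A : compact A -> A !=set0 -> @convex_set R 'rV[R]_n A ->
  exists proj, is_projection A proj.
Proof.
move=> cA A0 convA.
suff /choice[proj projP] : forall x, exists p,
    A p /\ forall y, A y -> dot (x - p) (y - p) <= 0 by exists proj.
move=> x.
have cf := @continuous_sqB R n x.
have [p Ap pmin] := compact_EVT_min A0 cA (continuous_subspaceT cf).
exists p; split; first by rewrite inE in Ap.
move=> y Ay; rewrite leNgt; apply/negP => d0.
have H (s : R) : 0 < s -> s <= 1 -> 2 * dot (x - p) (y - p) <= s * dot (y - p) (y - p).
  move=> s0 s1; rewrite inE in Ap.
  have := convex_setP convA (ltW s0) s1 Ay Ap.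
  rewrite -(@in_setE _ A) => /pmin.
  rewrite (_ : s *: y + (1 - s) *: p - x = s *: (y - p) - (x - p)); last first.
    by apply/rowP => i; rewrite !mxE; ring.
  rewrite -(opprB x p); move: (y - p) (x - p) => a b.
  rewrite !dotE (dotC a b) => H.
  by rewrite -(ler_pM2l s0); nra.
have := dot_ge0 (y - p); rewrite le_eqVlt => /predU1P[yy|yy].
  by have := H 1 ltr01 (lexx _); rewrite -yy mulr0; lra.
set d := dot (x - p) (y - p) in d0 H; set q := dot (y - p) (y - p) in yy H.
(* The step [s = d / (d + q)] is at most 1 and satisfies [s q < d], against [2 d <= s q]. *)
have dq0 : 0 < d / (d + q) by rewrite divr_gt0 ?addr_gt0.
have /H : d / (d + q) <= 1 by rewrite ler_pdivrMr ?addr_gt0// mul1r lerDl ltW.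
move=> /(_ dq0); rewrite mulrAC ler_pdivlMr ?addr_gt0//; nra.
Qed.

Section smoothed_distance.
Variables (A : set 'rV[R]_n) (proj : 'rV[R]_n -> 'rV[R]_n).
Hypothesis projP : is_projection A proj.

Lemma projection_id x : A x -> x - proj x = 0.
Proof.
move=> /(projP x).2 H; apply/eqP; rewrite -dot_eq0.
by rewrite eq_le dot_ge0 andbT.
Qed.

(* The distance to A * {0} in R^(n+1) of the point (x, s): convex and, unlike the
   distance to A itself, smooth across the boundary of A. *)
Definition sdist (s : R) x := Num.sqrt (dot (x - proj x) (x - proj x) + s ^+ 2).

Section sdist_theory.
Variable s : R.
Hypothesis s0 : 0 < s.

Let arg_ge0 x : 0 <= dot (x - proj x) (x - proj x) + s ^+ 2.
Proof. by rewrite addr_ge0 ?dot_ge0 ?sqr_ge0. Qed.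

Lemma sdist_sqr x : sdist s x ^+ 2 = dot (x - proj x) (x - proj x) + s ^+ 2.
Proof. by rewrite sqr_sqrtr. Qed.

Lemma sdist_ge x : s <= sdist s x.
Proof.
by rewrite -ler_sqr ?nnegrE ?sqrtr_ge0 ?(ltW s0)// sdist_sqr lerDr dot_ge0.
Qed.

Lemma sdist_gt0 x : 0 < sdist s x. Proof. exact: lt_le_trans (sdist_ge x). Qed.

Lemma enorm_le_sdist x : enorm (x - proj x) <= sdist s x.
Proof.
by rewrite enorm_le ?sqrtr_ge0// sdist_sqr lerDl sqr_ge0.
Qed.

Lemma sdist_le x : sdist s x <= enorm (x - proj x) + s.
Proof.
rewrite -ler_sqr ?nnegrE ?sqrtr_ge0 ?addr_ge0 ?enorm_ge0 ?(ltW s0)// sdist_sqr -enorm_sqr.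
by have := mulr_ge0 (enorm_ge0 (x - proj x)) (ltW s0); lra.
Qed.

(** Convexity, as a subgradient inequality: Cauchy-Schwarz in [R^(n+1)] for [(x + v - y, s)] and
    [(x - proj x, s)], where [y = proj (x + v)], combined with the obtuse angle at [proj x]. *)
Lemma sdist_lower x v :
  0 <= sdist s (x + v) - sdist s x - dot ((sdist s x)^-1 *: (x - proj x)) v.
Proof.
have h0 := sdist_gt0 x; have h1 := sdist_gt0 (x + v).
set y := proj (x + v).
have := (projP x).2 _ (projP (x + v)).1; rewrite -/y => H.
have : dot (x - proj x) v + sdist s x ^+ 2 <= sdist s (x + v) * sdist s x.
  apply: (@le_trans _ _ (dot (x + v - y) (x - proj x) + s ^+ 2)).
    rewrite sdist_sqr addrA lerD2r (_ : x + v - y =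
      (x - proj x) + v - (y - proj x)); last by apply/rowP => i; rewrite !mxE; ring.
    move: (x - proj x) (y - proj x) H => g w H.
    by rewrite !dotE (dotC v g) (dotC w g); lra.
  apply: le_trans (ler_norm _) _.
  rewrite -ler_sqr ?nnegrE ?mulr_ge0 ?(ltW h0) ?(ltW h1)// real_normK ?num_real//.
  rewrite exprMn !sdist_sqr -/y.
  have := cauchy_schwarz (x + v - y) (x - proj x).
  have := dot_ge0 (x - proj x); have := dot_ge0 (x + v - y).
  have : 2 * dot (x + v - y) (x - proj x) <=
      dot (x + v - y) (x + v - y) + dot (x - proj x) (x - proj x).
    have := dot_ge0 (x + v - y - (x - proj x)).
    by move: (x + v - y) (x - proj x) => a b; rewrite !dotE (dotC b a); lra.
  move: (dot (x + v - y) _) (dot (x + v - y) _) (dot (x - proj x) _) => a b c' *.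
  have : 0 <= s ^+ 2 by exact: sqr_ge0.
  by nra.
move=> H2; rewrite dotZl -(pmulr_rge0 _ h0) !mulrBr mulrA mulfV ?gt_eqF// mul1r.
by rewrite -expr2; lra.
Qed.

(** [proj x] is no nearer to [x + v] than [proj (x + v)] is, which bounds the square of [sdist] by
    its quadratic expansion at [x]; taking the root divides the remainder by
    [2 * sdist s x >= 2 * s]. *)
Lemma sdist_upper x v :
  sdist s (x + v) - sdist s x - dot ((sdist s x)^-1 *: (x - proj x)) v <=
  (2 * s)^-1 * dot v v.
Proof.
have h0 := sdist_gt0 x.
have h2 : sdist s (x + v) ^+ 2 <= sdist s x ^+ 2 + 2 * dot (x - proj x) v + dot v v.
  rewrite !sdist_sqr; set y := proj (x + v).
  have := (projP (x + v)).2 _ (projP x).1; rewrite -/y => H.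
  have -> : x - proj x = (x + v - y) - (proj x - y) - v.
    by apply/rowP => i; rewrite !mxE; ring.
  have := dot_ge0 (proj x - y).
  move: (x + v - y) (proj x - y) H => a b H.
  by rewrite !dotE (dotC b a) (dotC v a) (dotC v b); lra.
rewrite dotZl; set d := dot (x - proj x) v in h2 *.
apply: (@le_trans _ _ ((2 * sdist s x)^-1 * dot v v)); last first.
  rewrite ler_wpM2r ?dot_ge0// lef_pV2 ?posrE ?mulr_gt0//.
  by rewrite ler_pM2l// sdist_ge.
have -> : (2 * sdist s x)^-1 * dot v v = dot v v / (2 * sdist s x) by rewrite mulrC.
rewrite ler_pdivlMr ?mulr_gt0//.
have -> : (sdist s (x + v) - sdist s x - (sdist s x)^-1 * d) * (2 * sdist s x) =
    2 * sdist s (x + v) * sdist s x - 2 * sdist s x ^+ 2 - 2 * d.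
  by field; rewrite gt_eqF.
have := sqr_ge0 (sdist s (x + v) - sdist s x); nra.
Qed.

Lemma sdist_C11 :
  C11 (sdist s) (fun x => (sdist s x)^-1 *: (x - proj x)) 1 (2 * s)^-1.
Proof.
split=> x v; last first.
  by rewrite ger0_norm ?sdist_lower// sdist_upper.
rewrite mul1r.
have gle y w : `|dot ((sdist s y)^-1 *: (y - proj y)) w| <= enorm w.
  rewrite dotZl normrM gtr0_norm ?invr_gt0 ?sdist_gt0// mulrC ler_pdivrMr ?sdist_gt0//.
  apply: le_trans (dot_le_enorm _ _) _; rewrite mulrC ler_wpM2l ?enorm_ge0//.
  exact: enorm_le_sdist.
(* The Lipschitz bound follows from the subgradient inequalities at both ends, the gradients having
   norm at most 1. *)
have := sdist_lower x v; have := sdist_lower (x + v) (- v); rewrite addrK.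
have := gle x v; have := gle (x + v) (- v); rewrite enormN !ler_norml.
by move=> /andP[a1 a2] /andP[b1 b2] c1 c2; apply/andP; split; lra.
Qed.

Lemma sdist_convex x v : 0 <= sdist s (x + v) + sdist s (x - v) - 2 * sdist s x.
Proof.
by have := sdist_lower x v; have := sdist_lower x (- v); rewrite dotNr; lra.
Qed.

End sdist_theory.
End smoothed_distance.
End projection.

Section cutoff.
Context {R : realType} {n : nat}.
Variables (A : set 'rV[R]_n) (proj : 'rV[R]_n -> 'rV[R]_n).
Hypothesis projP : is_projection A proj.
Variables (e t : R).
Hypotheses (e0 : 0 < e) (t0 : 0 < t).
Implicit Types x v : 'rV[R]_n.

Let te0 : 0 < t * e. Proof. exact: mulr_gt0. Qed.
Let t1 : 0 < 1 + t. Proof. by rewrite addr_gt0. Qed.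

(** On [A] the smoothed distance takes its minimum [t * e], so [arg] is 1 there; [arg] is
    nonpositive once it reaches [(1 + t) * e]. The factor [1 + t] of [cutoff] normalises
    [psi t 1 = 1 / (1 + t)]. *)
Let arg x := 1 - (sdist proj (t * e) x - t * e) / e.

Definition cutoff x := (1 + t) * psi t (arg x).
Definition cutoff_slope x := (1 + t) / e * dpsi t (arg x) / sdist proj (t * e) x.
Definition cutoff_grad x := - cutoff_slope x *: (x - proj x).
Definition cutoff_nbhd := [set x | sdist proj (t * e) x < (1 + t) * e].

Let sdist0 x : 0 < sdist proj (t * e) x. Proof. exact: sdist_gt0. Qed.

Let dpsi0 x : 0 <= dpsi t (arg x). Proof. by have /andP[] := dpsi_itv t0 (arg x). Qed.
Let dpsi1 x : dpsi t (arg x) <= 1. Proof. by have /andP[] := dpsi_itv t0 (arg x). Qed.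

Lemma cutoff_ge0 x : 0 <= cutoff x.
Proof. by rewrite mulr_ge0 ?psi_ge0// ltW. Qed.

Let psi1 : (1 + t) * psi t 1 = 1.
Proof. by rewrite /psi lt_geF// expr1n mul1r mulfV// gt_eqF. Qed.

Lemma cutoff_le1 x : cutoff x <= 1.
Proof.
rewrite -psi1 /cutoff ler_pM2l// psi_le// /arg gerBl divr_ge0 ?(ltW e0)//.
by rewrite subr_ge0 sdist_ge.
Qed.

Lemma cutoff_slope_ge0 x : 0 <= cutoff_slope x.
Proof. by rewrite !mulr_ge0 ?invr_ge0 ?(ltW t1) ?(ltW e0)// ltW. Qed.

Lemma cutoff_slope_le x : cutoff_slope x <= (1 + t) / e / (t * e).
Proof.
have h := sdist_ge proj te0 x; have h0 := sdist0 x.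
rewrite /cutoff_slope ler_pM ?mulr_ge0 ?invr_ge0 ?(ltW t1) ?(ltW e0) ?(ltW h0)//.
  by rewrite ler_piMr// mulr_ge0 ?invr_ge0 ?(ltW t1) ?(ltW e0).
by rewrite lef_pV2.
Qed.

Lemma cutoff_grad_le x : enorm (cutoff_grad x) <= (1 + t) / e.
Proof.
have h0 := sdist0 x.
rewrite enormZ normrN ger0_norm ?cutoff_slope_ge0// /cutoff_slope mulrAC ler_pdivrMr//.
rewrite -[leLHS]mulrA ler_pM2l ?divr_gt0// (le_trans _ (enorm_le_sdist proj (t * e) x))//.
by rewrite ler_piMl ?enorm_ge0.
Qed.

Lemma cutoff_eq1 x : A x -> cutoff x = 1.
Proof.
move=> Ax; rewrite -psi1 /cutoff /arg /sdist (projection_id projP Ax) dot0l add0r.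
by rewrite sqrtr_sqr gtr0_norm// subrr mul0r subr0.
Qed.

Lemma cutoff_grad_eq0 x : A x -> cutoff_grad x = 0.
Proof. by move=> Ax; rewrite /cutoff_grad (projection_id projP Ax) scaler0. Qed.

Let arg_le0 x : ~ cutoff_nbhd x -> arg x <= 0.
Proof.
move=> /negP; rewrite -leNgt => H; rewrite /arg subr_le0 ler_pdivlMr// mul1r.
lra.
Qed.

Lemma cutoff_out x : ~ cutoff_nbhd x -> cutoff x = 0.
Proof. by move=> /arg_le0 a0; rewrite /cutoff /psi a0 mulr0. Qed.

Lemma cutoff_slope_out x : ~ cutoff_nbhd x -> cutoff_slope x = 0.
Proof. by move=> /arg_le0 a0; rewrite /cutoff_slope /dpsi a0 mulr0 mul0r. Qed.

Lemma cutoff_nbhd_proj x : cutoff_nbhd x -> enorm (x - proj x) < (1 + t) * e.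
Proof. by apply: le_lt_trans; exact: enorm_le_sdist. Qed.

Lemma cutoff_nbhd_open : open cutoff_nbhd.
Proof.
rewrite (_ : cutoff_nbhd = [set x | 0 < (1 + t) * e - sdist proj (t * e) x]).
  rewrite (_ : mkset _ = (fun x => (1 + t) * e - sdist proj (t * e) x) @^-1` `]0, +oo[%classic).
    apply: open_comp => // x _; apply: continuous_sub; first exact: continuous_cst.
    exact: C11_continuous (sdist_C11 projP te0).
  by apply/seteqP; split=> x /=; rewrite in_itv/= andbT.
by apply/seteqP; split=> x; rewrite /cutoff_nbhd/= subr_gt0.
Qed.

(** Chain rule for Taylor remainders: the first part of the constant is the remainder of [sdist],
    weighted by [dpsi <= 1]; the second is that of [psi] for an increment of size at most
    [|v| / e]. *)
Lemma cutoff_C11 : C11 cutoff cutoff_grad ((1 + t) / e)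
  ((1 + t) / e * (2 * (t * e))^-1 + (1 + t) * (2 / t) / e ^+ 2).
Proof.
have [L T] := sdist_C11 projP te0; split=> x v.
  rewrite /cutoff -mulrBr normrM gtr0_norm// -mulrA ler_pM2l//.
  apply: le_trans (psi_lipschitz t0 _ _) _.
  rewrite (_ : _ - _ = - ((sdist proj (t * e) (x + v) - sdist proj (t * e) x) / e)); last first.
    by rewrite /arg; ring.
  rewrite normrN normrM normfV (gtr0_norm e0) mulrC ler_pM2l ?invr_gt0//.
  by have := L x v; rewrite mul1r.
have := L x v; have := T x v; rewrite mul1r.
rewrite /cutoff_grad /cutoff /cutoff_slope !dotZl.
set h := sdist proj (t * e) x; set h' := sdist proj (t * e) (x + v).
set d := dot (x - proj x) v => H1 H2.
have h0 : 0 < h by exact: sdist0.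
have H3 : (h' - h) ^+ 2 <= dot v v.
  by rewrite -enorm_sqr -(real_normK (num_real (h' - h))) ler_sqr ?nnegrE ?enorm_ge0.
have /andP[P1 P2] := psi_taylor t0 (arg x) (arg (x + v)).
have aE : arg (x + v) - arg x = - ((h' - h) / e) by rewrite /arg -/h -/h'; ring.
rewrite aE in P1 P2.
rewrite (_ : _ - _ - _ = (1 + t) * (psi t (arg (x + v)) - psi t (arg x) -
    dpsi t (arg x) * - ((h' - h) / e)) - (1 + t) / e * (dpsi t (arg x) * (h' - h - h^-1 * d))).
  rewrite [leRHS]mulrDl; apply: le_trans (ler_normB _ _) _; rewrite addrC lerD//.
    rewrite normrM gtr0_norm ?divr_gt0// -mulrA ler_pM2l ?divr_gt0//.
    rewrite normrM ger0_norm// (le_trans _ H1)// ler_piMl//.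
  rewrite normrM (gtr0_norm t1) (ger0_norm P1) -!mulrA ler_pM2l//.
  apply: le_trans P2 _; rewrite sqrrN -mulrA ler_pM2l// ler_pM2l ?invr_gt0//.
  by rewrite expr_div_n mulrC ler_pM2l ?invr_gt0 ?exprn_gt0.
by field; rewrite !gt_eqF.
Qed.

Section bounded.
Variables (r : R).
Hypothesis Ar : forall x, A x -> enorm x < r.

Lemma cutoff_nbhd_sub : cutoff_nbhd `<=` eball 0 (r + (1 + t) * e).
Proof.
move=> x /cutoff_nbhd_proj xA; rewrite /eball/= subr0.
have := enormD (proj x) (x - proj x); rewrite addrC subrK => /le_lt_trans; apply.
by rewrite ltrD// Ar//; exact: (projP x).1.
Qed.

Lemma cutoff_vanish x : r + (1 + t) * e <= enorm x -> ~ cutoff_nbhd x.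
Proof.
by move=> rx /cutoff_nbhd_sub; rewrite /eball/= subr0 ltNge rx.
Qed.

Lemma bounded_supp_cutoff : bounded_supp cutoff.
Proof.
apply: (@bounded_supp_vanish _ _ _ 1 (r + (1 + t) * e)).
- exact: C11_measurable cutoff_C11.
- by move=> x; rewrite ger0_norm ?cutoff_ge0 ?cutoff_le1.
- by move=> x /cutoff_vanish; exact: cutoff_out.
Qed.

Lemma bounded_supp_cutoff_grad i : bounded_supp (fun x => cutoff_grad x ord0 i).
Proof.
apply: (@bounded_supp_vanish _ _ _ ((1 + t) / e) (r + (1 + t) * e)).
- exact: C11_grad_measurable cutoff_C11 _.
- by move=> x; apply: le_trans (coord_le_enorm _ _) (cutoff_grad_le _).
- move=> x /cutoff_vanish/cutoff_slope_out xs.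
  by rewrite /cutoff_grad xs oppr0 scale0r mxE.
Qed.

End bounded.
End cutoff.

(** * Perimeter of convex sets *)

Section variation_bound.
Context {R : realType} {n : nat}.
Variables (A K E : set 'rV[R]_n) (pA pK : 'rV[R]_n -> 'rV[R]_n).
Hypotheses (pAP : is_projection A pA) (pKP : is_projection K pK).
Variables (r e1 e t B : R).
Hypotheses (e1_gt0 : 0 < e1) (e0 : 0 < e) (t0 : 0 < t).
Hypotheses (Ar : forall x, A x -> enorm x < r) (Kr : forall x, K x -> enorm x < r).
Hypotheses (mE : measurable E) (EA : E `<=` A) (mK : measurable K).
Variables (phi : 'rV[R]_n -> 'rV[R]_n) (dphi : 'I_n -> 'rV[R]_n -> R).
Hypotheses (phi1 : forall x, enorm (phi x) <= 1)
  (mphi : forall i, measurable_fun [set: 'rV[R]_n] (fun x => phi x ord0 i : measurableTypeR R))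
  (dphiB : forall i k x, `|dq (fun x => phi x ord0 i) 'e_i k x| <= B)
  (dphiP : forall i x, dq (fun x => phi x ord0 i) 'e_i k x @[k --> \oo] --> dphi i x).

Local Notation mu := (@lebesgue_rV R n).
Local Notation N := (cutoff_nbhd pA e1 1).
Local Notation S := (cutoff_nbhd pK e t `\` K).
(** Since [u] is 1 on [K] and [u1] vanishes outside [N], this inclusion yields [u1 <= u]. *)
Hypothesis NK : N `<=` K.

Let u1 := cutoff pA e1 1.
Let g1 := cutoff_grad pA e1 1.
Let u := cutoff pK e t.
Let g := cutoff_grad pK e t.
Let div x := \sum_i dphi i x.

Let mdphi i : measurable_fun [set: 'rV[R]_n] (dphi i : 'rV[R]_n -> measurableTypeR R).
Proof.
apply: (@measurable_lim _ _ (dq (fun x => phi x ord0 i) 'e_i)) => // k.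
exact: dq_measurable.
Qed.

Let mdiv : measurable_fun [set: 'rV[R]_n] (div : 'rV[R]_n -> measurableTypeR R).
Proof. exact: measurable_sum. Qed.

Let dphi_le i x : `|dphi i x| <= B.
Proof.
have Fx : `|dq (fun x => phi x ord0 i) 'e_i k x| @[k --> \oo] --> `|dphi i x|.
  by apply: cvg_norm; exact: dphiP.
rewrite -(cvg_lim _ Fx)//; apply: limr_le; first by apply/cvg_ex; exists `|dphi i x|.
exact: nearW.
Qed.

Let div_le x : `|div x| <= n%:R * B.
Proof.
apply: le_trans (ler_norm_sum _ _ _) _.
apply: (@le_trans _ _ (\sum_(i < n) B)); first exact: ler_sum.
by rewrite sumr_const card_ord mulr_natl.
Qed.

Let bu1 : bounded_supp u1. Proof. exact: bounded_supp_cutoff Ar. Qed.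
Let bg1 i : bounded_supp (fun x => g1 x ord0 i).
Proof. exact: bounded_supp_cutoff_grad Ar _. Qed.
Let bg i : bounded_supp (fun x => g x ord0 i).
Proof. exact: bounded_supp_cutoff_grad Kr _. Qed.

Let u1_out x : r + (1 + 1) * e1 <= enorm x -> u1 x = 0.
Proof. by move=> /(cutoff_vanish pAP Ar)/cutoff_out; apply. Qed.

Let u_out x : r + (1 + t) * e <= enorm x -> u x = 0.
Proof. by move=> /(cutoff_vanish pKP Kr)/cutoff_out; apply. Qed.

Let bounded_supp_dot (f h : 'rV[R]_n -> 'rV[R]_n) (C : R) :
  (forall i, bounded_supp (fun x => f x ord0 i)) ->
  (forall i, measurable_fun [set: 'rV[R]_n] (fun x => h x ord0 i : measurableTypeR R)) ->
  (forall i x, `|h x ord0 i| <= C) -> bounded_supp (fun x => - dot (f x) (h x)).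
Proof.
move=> bf mh hC; rewrite (_ : (fun _ => _) = fun x => -1 * dot (f x) (h x)).
  by apply: bounded_suppZ; apply: bounded_supp_sum => i; exact: bounded_suppM (hC i).
by apply/funext => x; rewrite mulN1r.
Qed.

Let parts : intR (fun x => u1 x * div x) = intR (fun x => - dot (g1 x) (phi x)).
Proof.
have u1C := cutoff_C11 pAP e1_gt0 ltr01.
have phi_le i x : `|phi x ord0 i| <= 1 by apply: le_trans (phi1 x); exact: coord_le_enorm.
have b1 i : bounded_supp (fun x => u1 x * dphi i x) by exact: bounded_suppM (dphi_le i).
have b2 i : bounded_supp (fun x => g1 x ord0 i * phi x ord0 i).
  exact: bounded_suppM (phi_le i).
transitivity (\sum_i intR (fun x => u1 x * dphi i x)).
  by rewrite -intR_sum//; apply: eq_intR => x; rewrite mulr_sumr.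
transitivity (-1 * \sum_i intR (fun x => g1 x ord0 i * phi x ord0 i)).
  rewrite mulN1r -sumrN; apply: eq_bigr => i _.
  have u1_le x : `|u1 x| <= 1 by rewrite ger0_norm ?cutoff_ge0 ?cutoff_le1.
  exact: (by_parts u1C u1_le u1_out (mphi i) (phi_le i) (dphiB i) (@dphiP i)).
rewrite -intR_sum// -intRZ; last exact: bounded_supp_sum.
by apply: eq_intR => x; rewrite mulN1r.
Qed.

Let mN : measurable N.
Proof. by apply: open_measurable_rV; exact: cutoff_nbhd_open. Qed.

Let mS : measurable S.
Proof.
apply: measurableD => //; apply: open_measurable_rV.
exact: (cutoff_nbhd_open pKP e0 t0).
Qed.

Let bN : bounded_supp (\1_N : 'rV[R]_n -> R).
Proof. exact: bounded_supp_indic (@cutoff_nbhd_sub _ _ _ _ pAP e1 1 _ Ar). Qed.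

Let bS : bounded_supp (\1_S : 'rV[R]_n -> R).
Proof.
by apply: (bounded_supp_indic mS) => x -[xS _]; exact: (@cutoff_nbhd_sub _ _ _ _ pKP e t _ Kr _ xS).
Qed.

Section comparison.
Variable s : R.
Hypothesis s0 : 0 < s.

Let h := sdist pA s.
Let gh x := (sdist pA s x)^-1 *: (x - pA x).

Let hC : C11 h gh 1 (2 * s)^-1. Proof. exact: sdist_C11. Qed.

Let gh_le x : enorm (gh x) <= 1.
Proof.
have h0 := sdist_gt0 pA s0 x.
by rewrite enormZ gtr0_norm ?invr_gt0// ler_pdivrMl// mulr1 enorm_le_sdist.
Qed.

Let mgh i : measurable_fun [set: 'rV[R]_n] (fun x => gh x ord0 i : measurableTypeR R).
Proof. exact: C11_grad_measurable hC _. Qed.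

Let gh_coord i x : `|gh x ord0 i| <= 1.
Proof. exact: le_trans (coord_le_enorm _ _) (gh_le x). Qed.

(* g1 x and gh x are opposite in direction, and gh x is almost of norm 1. *)
Let step1 x : - dot (g1 x) (phi x) <=
  - dot (g1 x) (gh x) + s * ((1 + 1) / e1 / (1 * e1)) * \1_N x.
Proof.
have h0 := sdist_gt0 pA s0 x.
rewrite /g1 /cutoff_grad /gh !dotZl dotZr !mulNr !opprK indicE.
have m0 := cutoff_slope_ge0 pA e1_gt0 ltr01 x.
have mle := cutoff_slope_le pA e1_gt0 ltr01 x.
have [|/negP xN] := boolP (x \in N); last first.
  by rewrite cutoff_slope_out ?mul0r ?mulr0 ?addr0// => /mem_set.
move=> _; rewrite mulr1.
set m := cutoff_slope _ _ _ _ in m0 mle *; set G := x - pA x.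
apply: (@le_trans _ _ (m * enorm G)).
  rewrite ler_wpM2l// (le_trans (ler_norm _))// (le_trans (dot_le_enorm _ _))//.
  by rewrite ler_piMr ?enorm_ge0.
apply: (@le_trans _ _ (m * ((sdist pA s x)^-1 * dot G G) + m * s)); last first.
  by rewrite lerD2l mulrC ler_wpM2l// ltW.
rewrite -mulrDr ler_wpM2l// -enorm_sqr -(ler_pM2l h0) mulrDr mulrA mulfV ?gt_eqF// mul1r.
have l1 := enorm_le_sdist pA s x; have l2 := sdist_le pA s0 x.
rewrite -/G in l1 l2; have l3 := enorm_ge0 G.
move: (sdist pA s x) (enorm G) h0 l1 l2 l3 => a b *; nra.
Qed.

Let step2 : intR (fun x => - dot (g1 x) (gh x)) <= intR (fun x => - dot (g x) (gh x)).
Proof.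
have wC := C11B (cutoff_C11 pKP e0 t0) (cutoff_C11 pAP e1_gt0 ltr01).
pose r' := Num.max (r + (1 + t) * e) (r + (1 + 1) * e1).
have wr : vanish_out r' (fun x => u x - u1 x).
  by move=> x; rewrite ge_max => /andP[/u_out -> /u1_out ->]; rewrite subr0.
have w01 x : 0 <= u x - u1 x <= 1.
  have [xN|xN] := pselect (N x).
    rewrite /u (cutoff_eq1 pKP e0 t0 (NK xN)) subr_ge0 cutoff_le1//=.
    by rewrite gerBl cutoff_ge0.
  by rewrite /u1 cutoff_out// subr0 cutoff_ge0//= cutoff_le1.
have b1 i : bounded_supp (fun x => (g x - g1 x) ord0 i * gh x ord0 i).
  apply: (bounded_suppM _ (mgh i) (gh_coord i)).
  rewrite (_ : (fun _ => _) = fun x => g x ord0 i - g1 x ord0 i).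
    exact: bounded_suppB.
  by apply/funext => x; rewrite !mxE.
have b2 := bounded_supp_dot bg1 mgh gh_coord.
have b3 := bounded_supp_dot bg mgh gh_coord.
rewrite -subr_le0 -intRB//.
apply: (@le_trans _ _ (\sum_i intR (fun x => (g x - g1 x) ord0 i * gh x ord0 i))).
  rewrite -intR_sum// le_eqVlt; apply/orP; left; apply/eqP; apply: eq_intR => x.
  by rewrite -/(dot (g x - g1 x) (gh x)) dotDl dotNl; ring.
apply: sumr_le0 => i _.
exact: (grad_convex_le0 i wC w01 wr hC (sdist_convex pAP s0)).
Qed.

(** [g] vanishes on [K] and beyond the ramp, so only the shell [S] counts; there the slope of the
    ramp bounds it, [gh] having norm at most 1. *)
Let step3 x : - dot (g x) (gh x) <= (1 + t) / e * \1_S x.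
Proof.
have te0 : 0 <= (1 + t) / e by rewrite divr_ge0 ?(ltW e0)// addr_ge0 ?(ltW t0).
rewrite indicE; have [xS|/negP xS] := boolP (x \in S).
  rewrite mulr1 (le_trans (ler_norm _))// normrN (le_trans (dot_le_enorm _ _))//.
  rewrite -[leRHS]mulr1 ler_pM ?enorm_ge0//; exact: cutoff_grad_le.
rewrite mulr0.
have -> : g x = 0.
  have [Kx|Kx] := pselect (K x); first exact: (@cutoff_grad_eq0 _ _ _ _ pKP).
  rewrite /g /cutoff_grad cutoff_slope_out ?oppr0 ?scale0r// => xN.
  by apply: xS; rewrite inE.
by rewrite dot0l oppr0.
Qed.

Lemma comparison_step : intR (fun x => u1 x * div x) <=
  (1 + t) / e * fine (mu S) + s * ((1 + 1) / e1 / (1 * e1) * fine (mu N)).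
Proof.
have b2 := bounded_supp_dot bg1 mgh gh_coord.
have b3 := bounded_supp_dot bg mgh gh_coord.
have phi_le i x : `|phi x ord0 i| <= 1 by apply: le_trans (phi1 x); exact: coord_le_enorm.
have b4 := bounded_supp_dot bg1 mphi phi_le.
rewrite parts; apply: (@le_trans _ _ (intR (fun x => - dot (g1 x) (gh x) +
  s * ((1 + 1) / e1 / (1 * e1)) * \1_N x))).
  apply: le_intR => //; first by apply: bounded_suppD => //; exact: bounded_suppZ.
rewrite intRD//; last exact: bounded_suppZ.
rewrite intRZ// intR_indic// [s * (_ * fine _)]mulrA lerD2r; apply: le_trans step2 _.
rewrite -intR_indic// -intRZ//; apply: le_intR => //; first exact: bounded_suppZ.
Qed.

End comparison.

Lemma variation_bound : intR (fun x => \1_E x * div x) <=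
  n%:R * B * fine (mu (N `\` E)) + (1 + t) / e * fine (mu S).
Proof.
have mNE : measurable (N `\` E) by exact: measurableD.
have bE : bounded_supp (\1_E : 'rV[R]_n -> R).
  by apply: (bounded_supp_indic (r := r) mE) => x /EA/Ar; rewrite /eball/= subr0.
have bNE : bounded_supp (\1_(N `\` E) : 'rV[R]_n -> R).
  by apply: (bounded_supp_indic mNE) => x [xN _]; exact: (@cutoff_nbhd_sub _ _ _ _ pAP e1 1 _ Ar _ xN).
have h1 : intR (fun x => u1 x * div x) <= (1 + t) / e * fine (mu S).
  (* [comparison_step] holds for every [s > 0]: a small enough [s] makes its error term at most half
     of the supposed excess [a - b]. *)
  rewrite leNgt; apply/negP => H.
  set a := intR _ in H; set b := _ * fine (mu S) in H.
  set c := (1 + 1) / e1 / (1 * e1) * fine (mu N).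
  have c0 : 0 <= c.
    rewrite mulr_ge0 ?fine_ge0// !mulr_ge0 ?invr_ge0 ?mulr_ge0 ?(ltW e1_gt0)//.
  have s0 : 0 < (a - b) / (c + 1) / 2.
    by rewrite !divr_gt0 ?subr_gt0// ltr_wpDl.
  have := comparison_step s0; rewrite -/a -/b -/c.
  have c1 : 0 < c + 1 by rewrite ltr_wpDl.
  have : (a - b) / (c + 1) / 2 * c <= (a - b) / 2.
    rewrite mulrAC ler_pM2r ?invr_gt0// mulrAC ler_pdivrMr// ler_pM2l ?subr_gt0//.
    by rewrite lerDl.
  by move: H; lra.
have b1 : bounded_supp (fun x => u1 x * div x) by exact: bounded_suppM div_le.
have b2 : bounded_supp (fun x => \1_E x * div x) by exact: bounded_suppM div_le.
(* [u1] and the indicator of [E] are both 1 on [E] and both 0 outside [N], so replacing one by the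
   other costs at most the divergence bound times the volume of [N] minus [E]. *)
rewrite addrC -lerBlDr; apply: le_trans h1.
rewrite lerBlDr addrC -lerBlDr -intRB// -intR_indic// -intRZ//.
apply: le_intR; [exact: bounded_suppB|exact: bounded_suppZ|move=> x].
have nB : 0 <= n%:R * B := le_trans (normr_ge0 _) (div_le x).
rewrite !indicE; have [xE|xE] := boolP (x \in E).
  rewrite /u1 (cutoff_eq1 pAP e1_gt0 ltr01); last by apply: EA; rewrite inE in xE.
  by rewrite subrr mulr_ge0.
rewrite mul0r sub0r; have [xN|xN] := pselect (N x).
  rewrite mem_set; last by split=> //; rewrite notin_setE in xE.
  rewrite mulr1 -mulrN (le_trans (ler_norm _))// normrM normrN.
  rewrite -[leRHS]mul1r ler_pM// ger0_norm ?cutoff_ge0 ?cutoff_le1//.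
by rewrite /u1 cutoff_out// mul0r oppr0 mulr_ge0.
Qed.

End variation_bound.

(** * Bounds and difference quotients of test fields *)

Section test_field_theory.
Context {R : realType} {n : nat}.
Implicit Types (phi : 'rV[R]_n -> 'rV[R]_n) (x v : 'rV[R]_n).

Lemma coord_diff_quotient_cvg phi x v j : derivable phi x v ->
  h^-1 * (phi (h *: v + x) ord0 j - phi x ord0 j) @[h --> (0 : R)^'] -->
  'D_v phi x ord0 j.
Proof.
move=> dphi.
have c : {for 'D_v phi x, continuous (fun w : 'rV[R]_n => w ord0 j)}.
  exact: coord_continuous.
have C := continuous_cvg _ c dphi.
rewrite (_ : (fun h => _) = (fun w : 'rV[R]_n => w ord0 j) \o
  (fun h => h^-1 *: ((phi \o shift x) (h *: v) - phi x))); first exact: C.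
by apply/funext => h; rewrite /= !mxE.
Qed.

Lemma derivable_dq_cvg phi x v j : derivable phi x v ->
  dq (fun y => phi y ord0 j) v k x @[k --> \oo] --> 'D_v phi x ord0 j.
Proof.
move=> dphi; have H := coord_diff_quotient_cvg (j := j) dphi.
have s0 : step k @[k --> \oo] --> (0 : R)^'.
  move=> U HU.
  have : \forall k \near \oo, (step k != 0 :> R -> U (step k)) := cvg_step HU.
  by apply: filterS => k; apply; rewrite gt_eqF ?step_gt0.
have := cvg_comp _ _ s0 H.
rewrite (_ : _ \o _ = fun k => dq (fun y => phi y ord0 j) v k x)//.
by apply/funext => k; rewrite /dq /= mulrC (addrC x).
Qed.

Lemma is_derive_line phi x v j (s : R) : derivable phi (x + s *: v) v ->
  is_derive s 1 (fun s => phi (x + s *: v) ord0 j) ('D_v phi (x + s *: v) ord0 j).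
Proof.
move=> dphi; have H := coord_diff_quotient_cvg (j := j) dphi.
have E : (fun h : R => h^-1 *: (((fun s => phi (x + s *: v) ord0 j) \o shift s) (h *: 1) -
    phi (x + s *: v) ord0 j)) =
  (fun h => h^-1 * (phi (h *: v + (x + s *: v)) ord0 j - phi (x + s *: v) ord0 j)).
  apply/funext => h; rewrite /= [h *: 1]mulr1; congr (_ * (phi _ ord0 j - _)).
  by rewrite scalerDl addrCA addrA.
apply: DeriveDef; last first.
  by rewrite /derive E; apply: cvg_lim.
by rewrite /derivable E; apply/cvg_ex; eexists; exact: H.
Qed.

Lemma derivable_line_lipschitz phi v j (M : R) :
  (forall x, derivable phi x v) -> (forall x, `|'D_v phi x ord0 j| <= M) ->
  forall x (s : R), `|phi (x + s *: v) ord0 j - phi x ord0 j| <= M * `|s|.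
Proof.
move=> dphi DM.
have pos x (s : R) : 0 < s -> `|phi (x + s *: v) ord0 j - phi x ord0 j| <= M * `|s|.
  move=> s0.
  have H z : is_derive z (1 : R) (fun s => phi (x + s *: v) ord0 j)
    ('D_v phi (x + z *: v) ord0 j) by exact: is_derive_line.
  have cz : {within `[0, s], continuous (fun s => phi (x + s *: v) ord0 j)}.
    by apply: derivable_within_continuous => z _; have [] := H z.
  have [c _] := MVT s0 (fun z _ => H z) cz.
  rewrite scale0r addr0 subr0 => ->.
  by rewrite normrM ler_wpM2r.
move=> x s; have [s0|s0|<-] := ltgtP 0 s; first exact: pos.
- have := pos (x + s *: v) (- s); rewrite oppr_gt0 => /(_ s0).
  by rewrite scaleNr addrK distrC normrN.
- by rewrite scale0r addr0 subrr !normr0 mulr0.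
Qed.

(** Partial derivatives control [f] along the axes only, so the coordinates of [x] are replaced by
    those of [y] one at a time. *)
Lemma lipschitz_of_lines (f : 'rV[R]_n -> R) (M : R) : 0 <= M ->
  (forall i x (s : R), `|f (x + s *: 'e_i) - f x| <= M * `|s|) ->
  forall x y, `|f y - f x| <= n%:R * M * enorm (y - x).
Proof.
move=> M0 fM x y.
pose z k : 'rV[R]_n := \row_i (if (i < k)%N then y ord0 i else x ord0 i).
have zn : z n = y by apply/rowP => i; rewrite mxE ltn_ord.
have z0 : z 0%N = x by apply/rowP => i; rewrite mxE.
rewrite -{1}zn -{1}z0 -(telescope_sumr (f \o z) (leq0n n)) big_mkord.
apply: le_trans (ler_norm_sum _ _ _) _.
apply: (@le_trans _ _ (\sum_(i < n) M * enorm (y - x))); last first.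
  by rewrite sumr_const card_ord -mulrA mulr_natl.
apply: ler_sum => i _ /=.
rewrite (_ : z i.+1 = z i + (y - x) ord0 i *: 'e_i); last first.
  apply/rowP => k; rewrite !mxE eqxx/=.
  have [->|ki] := eqVneq k i; first by rewrite ltnSn ltnn mulr1 addrC subrK.
  rewrite mulr0 addr0 ltnS leq_eqVlt (_ : (k == i :> nat) = false)//.
  exact/negbTE.
apply: le_trans (fM _ _ _) _; rewrite ler_wpM2l//.
exact: coord_le_enorm.
Qed.

(** The partial derivatives are continuous on the compact support, and off it [phi] vanishes in a
    neighbourhood of each point. *)
Lemma test_field_derive_bounded phi : test_field phi ->
  exists2 M : R, 0 <= M & forall i x j, `|'D_('e_i) phi x ord0 j| <= M.
Proof.
move=> [C1phi cS _]; set S := closure _ in cS.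
suff /choice[M MP] : forall i : 'I_n, exists M : R, 0 <= M /\
    forall x j, `|'D_('e_i) phi x ord0 j| <= M.
  exists (\sum_i M i); first by apply: sumr_ge0 => i _; have [] := MP i.
  move=> i x j; apply: le_trans ((MP i).2 x j) _.
  by rewrite (bigD1 i)//= lerDl sumr_ge0// => k _; have [] := MP k.
move=> i; have [dphi cD] := C1phi i.
pose f x := dot ('D_('e_i) phi x) ('D_('e_i) phi x).
have cf : continuous f by exact: continuous_dot.
have [L L0 fL] : exists2 L, 0 <= L & forall x, S x -> f x <= L.
  have [->|S0] := eqVneq S set0; first by exists 0.
  have [|c _ cmax] := compact_EVT_max _ cS (continuous_subspaceT cf); first exact/set0P.
  by exists (f c) => [|x Sx]; [exact: dot_ge0|apply: cmax; rewrite inE].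
exists (Num.sqrt L); split=> [|x j]; first exact: sqrtr_ge0.
apply: le_trans (coord_le_enorm _ _) _; rewrite enormE ler_sqrt//.
have [/fL//|xS] := pselect (S x).
suff -> : 'D_('e_i) phi x = 0 by rewrite dot0l.
have : \forall y \near x, phi y = 0.
  have : nbhs x (~` S).
    by apply: open_nbhs_nbhs; split=> //; apply: closed_openC; exact: closed_closure.
  apply: filterS => y yS; apply: contrapT => y0; apply: yS.
  by apply: subset_closure => /=; apply/eqP.
by move=> /(near_eq_derive (g := cst 0)) ->; rewrite derive_cst.
Qed.

End test_field_theory.

(** * Real-valued volume, dilations and closures *)

Section volume_real.
Context {R : realType} {n : nat}.
Implicit Types (A B : set 'rV[R]_n) (c : 'rV[R]_n).

Lemma convex_setI A :
  (forall x y (t : R), 0 <= t -> t <= 1 -> A x -> A y -> A (t *: x + (1 - t) *: y)) ->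
  @convex_set R 'rV[R]_n A.
Proof.
move=> cA x y l; rewrite !inE => Ax Ay.
exact: (cA x y l%:num (ge0 l) (le1 l) Ax Ay).
Qed.

(** [fine] sends an infinite measure to 0, hence the bounding balls in the lemmas on [vol]. *)
Definition vol A : R := fine (lebesgue_rV A).

Lemma volE A r : measurable A -> A `<=` eball 0 r -> lebesgue_rV A = (vol A)%:E.
Proof.
move=> mA Ar; rewrite fineK// ge0_fin_numE//.
apply: (le_lt_trans _ (lebesgue_rV_eball_lty 0 r)).
by apply: le_measure; rewrite ?inE//; exact: measurable_eball.
Qed.

Lemma vol_ge0 A : 0 <= vol A. Proof. exact: fine_ge0. Qed.

Lemma vol_le A B r : measurable A -> measurable B -> A `<=` B -> B `<=` eball 0 r ->
  vol A <= vol B.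
Proof.
move=> mA mB AB Br; rewrite -lee_fin -(volE mB Br) -(volE mA (subset_trans AB Br)).
by apply: le_measure; rewrite ?inE.
Qed.

Lemma vol_setD A B r : measurable A -> measurable B -> A `<=` B -> B `<=` eball 0 r ->
  vol (B `\` A) = vol B - vol A.
Proof.
move=> mA mB AB Br; have Ar := subset_trans AB Br.
have mD : measurable (B `\` A) by exact: measurableD.
have Dr : B `\` A `<=` eball 0 r by move=> x [/Br].
apply: (addIr (vol A)); rewrite subrK; apply: EFin_inj.
rewrite EFinD -(volE mA Ar) -(volE mB Br) -(volE mD Dr) -measureU//.
  by rewrite setUC setDUK.
by rewrite setDKI.
Qed.

(** For [a > 0], the homothetic image [c + a (A - c)], written as a preimage, which suits membership
    and measurability. *)
Definition dilate c (a : R) A := [set x | A (c + a^-1 *: (x - c))].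

Lemma vol_dilate c a A : 0 < a -> measurable A -> vol (dilate c a A) = a ^+ n * vol A.
Proof.
move=> a0 mA; rewrite /vol /dilate lebesgue_rV_dilation//.
have [Afin|] := boolP (lebesgue_rV A \is a fin_num); first by rewrite fineM.
rewrite ge0_fin_numE// -leNgt leye_eq => /eqP ->.
by rewrite gt0_muley ?lte_fin ?exprn_gt0//= mulr0.
Qed.

Lemma measurable_dilate c a A : measurable A -> measurable (dilate c a A).
Proof.
move=> mA; rewrite -[X in measurable X]setTI.
have := measurable_homothety_rV a^-1 (c - a^-1 *: c) measurableT mA.
rewrite [X in measurable (_ `&` X)](_ : _ = dilate c a A)//.
by apply/seteqP; split=> x; rewrite /dilate/= scalerBr addrAC addrA.
Qed.

Lemma dilate_le c (a : R) A B : A `<=` B -> dilate c a A `<=` dilate c a B.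
Proof. by move=> AB x /AB. Qed.

Lemma dilate_dilate c (a b : R) A : dilate c a (dilate c b A) = dilate c (a * b) A.
Proof.
apply/funext => x; rewrite /dilate/= [c + _ *: _ - c]addrAC subrr add0r scalerA.
by rewrite invfM mulrC.
Qed.

Lemma subset_dilate A c (a : R) : @convex_set R 'rV[R]_n A -> A c -> 1 <= a ->
  A `<=` dilate c a A.
Proof.
move=> cA Ac a1 x Ax; rewrite /dilate/=.
have a0 : 0 < a by rewrite (lt_le_trans _ a1).
have := convex_setP cA (t := a^-1) _ _ Ax Ac; rewrite invr_ge0 (ltW a0) invf_le1//.
by rewrite a1 => /(_ isT isT); congr A; apply/rowP => i; rewrite !mxE; ring.
Qed.

Lemma convex_dilate A c (a : R) : @convex_set R 'rV[R]_n A ->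
  @convex_set R 'rV[R]_n (dilate c a A).
Proof.
move=> cA; apply: convex_setI => x y t t0 t1 Ax Ay.
have := convex_setP cA t0 t1 Ax Ay; rewrite /dilate/=; congr A.
by apply/rowP => i; rewrite !mxE; ring.
Qed.

Lemma closure_enormP A x : closure A x <->
  forall e : R, 0 < e -> exists2 y, A y & enorm (x - y) < e.
Proof.
split=> [Ax e e0|H B /nbhs_enormP[r r0 rB]].
  have /Ax[y [Ay ye]] : nbhs x [set y | enorm (y - x) < e].
    by apply/nbhs_enormP; exists e.
  by exists y => //; rewrite -enormN opprB.
have [y Ay xy] := H _ r0; exists y; split=> //; apply: rB.
by rewrite -enormN opprB.
Qed.

Lemma convex_closure A : @convex_set R 'rV[R]_n A -> @convex_set R 'rV[R]_n (closure A).
Proof.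
move=> cA; apply: convex_setI => x y t t0 t1 /closure_enormP Ax /closure_enormP Ay.
apply/closure_enormP => e e0.
have [x' Ax' xx'] := Ax _ e0; have [y' Ay' yy'] := Ay _ e0.
exists (t *: x' + (1 - t) *: y'); first exact: convex_setP.
have -> : t *: x + (1 - t) *: y - (t *: x' + (1 - t) *: y') =
    t *: (x - x') + (1 - t) *: (y - y').
  by apply/rowP => i; rewrite !mxE; ring.
apply: le_lt_trans (enormD _ _) _; rewrite !enormZ !ger0_norm ?subr_ge0//.
have [->|/negP tn] := eqVneq t 0; first by rewrite mul0r add0r subr0 mul1r.
have tp : 0 < t by rewrite lt_def t0 andbT; apply/negP.
have : t * enorm (x - x') < t * e by rewrite ltr_pM2l.
have : (1 - t) * enorm (y - y') <= (1 - t) * e by rewrite ler_wpM2l ?subr_ge0// ltW.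
lra.
Qed.

Lemma closure_ball_sub A r : A `<=` eball 0 r -> closure A `<=` eball 0 (r + 1).
Proof.
move=> Ar x /closure_enormP/(_ _ ltr01)[y /Ar]; rewrite /eball/= !subr0 => yr xy.
by have := enormD (x - y) y; rewrite subrK => /le_lt_trans; apply; rewrite addrC ltrD.
Qed.

Lemma compact_closure_rV A r : A `<=` eball 0 r -> compact (closure A).
Proof.
move=> Ar; apply: bounded_closed_compact; last exact: closed_closure.
exists (r + 1); split; first exact: num_real.
move=> M rM x /(closure_ball_sub Ar); rewrite /eball/= subr0 => xr.
apply: ltW; apply: le_lt_trans (lt_trans xr rM).
rewrite [`|x|]mx_normrE bigmax_le ?enorm_ge0// => -[i j] _ /=.
by rewrite ord1 coord_le_enorm.
Qed.

End volume_real.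

(** * Upper bound for the perimeter of a convex set inside a convex set containing a unit ball *)

Section perimeter_upper_bound.
Context {R : realType} {n : nat}.
Implicit Types (A K : set 'rV[R]_n) (phi : 'rV[R]_n -> 'rV[R]_n).

(** To first order in [x] the right-hand side is [k x]: this is where the factor [n] in
    [P(K) <= n |K|] comes from. *)
Lemma exp1DB_le (x : R) k : 0 <= x -> (1 + x) ^+ k - 1 <= k%:R * x * (1 + x) ^+ k.
Proof.
move=> x0; elim: k => [|k IH]; first by rewrite !expr0 subrr mul0r mul0r.
have x1 : 1 <= 1 + x by rewrite lerDl.
have a1 : 1 <= (1 + x) ^+ k by rewrite exprn_ege1.
rewrite exprS -natr1; move: ((1 + x) ^+ k) IH a1 => a IH a1.
have kx : 0 <= k%:R * x by rewrite mulr_ge0.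
by nra.
Qed.

Lemma le_at_0_of_continuous (a : R) (f : R -> R) : continuous f ->
  (forall t, 0 < t -> t <= 1 -> a <= f t) -> a <= f 0.
Proof.
move=> cf af; rewrite leNgt; apply/negP => fa.
have /cvgrPdist_lt/(_ (a - f 0)) := cf 0; rewrite subr_gt0 => /(_ fa).
move=> /nbhs_ballP[e /= e0 eP].
pose t := Num.min (e / 2) 1.
have t0 : 0 < t by rewrite lt_min divr_gt0//= ltr01.
have te : t < e by rewrite gt_min ltr_pdivrMr// ltr_pMr// ltr1n.
have := eP t; rewrite /ball/= sub0r normrN gtr0_norm// => /(_ te).
have := af t t0; rewrite ge_min lexx orbT => /(_ isT) H.
by have := ler_norm (f t - f 0); rewrite distrC; lra.
Qed.

Lemma continuous_exp (f : R -> R) k : continuous f -> continuous (fun x => f x ^+ k).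
Proof.
move=> cf; elim: k => [|k IH].
  by under eq_fun do rewrite expr0; exact: continuous_cst.
by under eq_fun do rewrite exprS; exact: continuous_mul.
Qed.

Lemma cutoff_nbhd_near A proj (e t : R) x : is_projection (closure A) proj ->
  cutoff_nbhd proj e t x -> exists2 a, A a & enorm (x - a) < (1 + t) * e.
Proof.
move=> pP /cutoff_nbhd_proj xp.
have [] := (closure_enormP A (proj x)).1 (pP x).1 ((1 + t) * e - enorm (x - proj x)).
  by rewrite subr_gt0.
move=> a Aa pa; exists a => //.
have := enormD (x - proj x) (proj x - a); rewrite addrA subrK; lra.
Qed.

Lemma test_field_integral phi (Omega : set 'rV[R]_n) r : test_field phi ->
  measurable Omega -> Omega `<=` eball 0 r ->
  (\int[@lebesgue_rV R n]_(x in Omega) (divergence phi x)%:E)%E =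
  (intR (fun x => \1_Omega x * \sum_i 'D_('e_i) phi x ord0 i))%:E.
Proof.
move=> tphi mO Or.
have [M M0 DM] := test_field_derive_bounded tphi.
have [C1phi _ _] := tphi.
have bO : bounded_supp (\1_Omega : 'rV[R]_n -> R) by exact: bounded_supp_indic Or.
have mD i : measurable_fun [set: 'rV[R]_n]
    (fun x => 'D_('e_i) phi x ord0 i : measurableTypeR R).
  apply: continuous_measurable_rV => x.
  apply: (@continuous_comp _ _ _ ('D_('e_i) phi) (fun v : 'rV[R]_n => v ord0 i)).
    exact: (C1phi i).2.
  exact: coord_continuous.
have bi : bounded_supp (fun x => \1_Omega x * \sum_i 'D_('e_i) phi x ord0 i).
  apply: (bounded_suppM (B := n%:R * M) bO).
    exact: measurable_sum.
  move=> x; apply: le_trans (ler_norm_sum _ _ _) _.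
  apply: (@le_trans _ _ (\sum_(i < n) M)); first by apply: ler_sum => i _; exact: DM.
  by rewrite sumr_const card_ord mulr_natl.
have int := bounded_supp_integrable bi.
rewrite /intR /Rintegral fineK; last exact: integrable_fin_num.
rewrite [LHS]integral_mkcond; apply: eq_integral => x _.
rewrite patchE /divergence indicE; case: ifP => _; first by rewrite mul1r.
by rewrite mul0r.
Qed.

Lemma test_field_variation phi (Omega : set 'rV[R]_n) (A K : set 'rV[R]_n) r e1 e t :
  test_field phi -> forall B : R, 0 <= B ->
  (forall i x j, `|'D_('e_i) phi x ord0 j| <= B) ->
  forall pA pK, is_projection A pA -> is_projection K pK ->
  0 < e1 -> 0 < e -> 0 < t -> A `<=` eball 0 r -> K `<=` eball 0 r ->
  measurable Omega -> Omega `<=` A -> measurable K ->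
  cutoff_nbhd pA e1 1 `<=` K ->
  intR (fun x => \1_Omega x * \sum_i 'D_('e_i) phi x ord0 i) <=
  n%:R * B * vol (cutoff_nbhd pA e1 1 `\` Omega) +
    (1 + t) / e * vol (cutoff_nbhd pK e t `\` K).
Proof.
move=> tphi B B0 DB pA pK pAP pKP e1_0 e0 t0 Ar Kr mO OA mK NK.
have [C1phi _ phi1] := tphi.
have dphi i x : derivable phi x 'e_i by exact: (C1phi i).1.
have line i j x (s : R) : `|phi (x + s *: 'e_i) ord0 j - phi x ord0 j| <= B * `|s|.
  by apply: derivable_line_lipschitz => // y; exact: DB.
have mphi j : measurable_fun [set: 'rV[R]_n] (fun x => phi x ord0 j : measurableTypeR R).
  apply: continuous_measurable_rV; apply: (@lipschitz_continuous _ _ _ (n%:R * B)).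
  exact: (lipschitz_of_lines (f := fun x => phi x ord0 j)).
apply: (variation_bound (r := r) pAP pKP e1_0 e0 t0 _ _ mO OA mK phi1 mphi) => //.
- by move=> x /Ar; rewrite /eball/= subr0.
- by move=> x /Kr; rewrite /eball/= subr0.
- move=> i k x; rewrite /dq normrM normfV (gtr0_norm (step_gt0 k)).
  rewrite ler_pdivrMr ?step_gt0//; have := line i i x (step k).
  by rewrite (gtr0_norm (step_gt0 k)).
- by move=> i x; exact: derivable_dq_cvg.
Qed.

Lemma dilate_bounded c (a r : R) A : 0 < a -> A `<=` eball 0 r ->
  dilate c a A `<=` eball 0 (enorm c + a * (r + enorm c)).
Proof.
move=> a0 Ar x /Ar; rewrite /eball/= !subr0; set y := c + _ => yr.
have -> : x = c + a *: (y - c).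
  by rewrite /y [c + _ - c]addrAC subrr add0r scalerA mulfV ?gt_eqF// scale1r addrC subrK.
apply: le_lt_trans (enormD _ _) _; rewrite ltrD2l enormZ gtr0_norm// ltr_pM2l//.
by apply: le_lt_trans (enormD _ _) _; rewrite enormN ltrD2r.
Qed.

Lemma closed_measurable_rV A : closed A -> measurable A.
Proof.
move=> cA; rewrite -(setCK A); apply: measurableC; apply: open_measurable_rV.
exact: closed_openC.
Qed.

(** [K0] is first dilated by [1 + t], which makes room for the ramp of the cutoff of [Omega]. Then
    [t] tends to 0: the ramp region outside [Omega] loses its volume, and the shell around the
    dilated set, divided by its width, tends to at most [n |U|]. The set [U] stands for [K0], whose
    measurability is not assumed. *)
Lemma perimeter_le (Omega K0 U : set 'rV[R]_n) (c : 'rV[R]_n) (r : R) :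
  open Omega -> Omega !=set0 -> @convex_set R 'rV[R]_n Omega ->
  @convex_set R 'rV[R]_n K0 -> Omega `<=` K0 -> eball c 1 `<=` K0 ->
  measurable U -> K0 `<=` U -> U `<=` eball 0 r ->
  (perimeter Omega <= (n%:R * vol U)%:E)%E.
Proof.
move=> oO [c' Oc'] cO cK0 OK0 BK0 mU K0U Ur.
have [r0 r0_gt0 Or0] := (open_enormP Omega).1 oO _ Oc'.
have {}Or0 : eball c' r0 `<=` Omega by [].
have mO : measurable Omega by exact: open_measurable_rV.
have Or : Omega `<=` eball 0 r by move=> x /OK0/K0U/Ur.
apply: ge_ereal_sup => _ [phi tphi <-].
rewrite (test_field_integral tphi mO Or) lee_fin.
have [M M0 DM] := test_field_derive_bounded tphi.
(* The first term bounds the loss on the ramp of [Omega], by dilation about an interior point [c'];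
   the second bounds the shell of [K] times the slope [(1 + t) / t]. *)
pose F (t : R) := n%:R * M * (((1 + t / r0) ^+ n - 1) * vol Omega) +
  n%:R * ((1 + t) ^+ 2 * (1 + (1 + t) * t) ^+ n) * (((1 + t) ^+ 2) ^+ n * vol U).
have cid : continuous (fun x : R => x) by move=> x; exact: cvg_id.
have F0 : F 0 = n%:R * vol U.
  by rewrite /F mul0r mulr0 addr0 !expr1n subrr mul0r mulr0 add0r !mulr1 mul1r.
rewrite -F0; apply: le_at_0_of_continuous.
  have cc := @continuous_cst R R; have c1t : continuous (fun t : R => 1 + t).
    by apply: continuous_add => //; exact: cc.
  apply: continuous_add; apply: continuous_mul; try exact: cc.
  - apply: continuous_mul; last exact: cc.
    apply: continuous_sub; last exact: cc.
    apply: continuous_exp; apply: continuous_add; first exact: cc.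
    by apply: continuous_mul => //; exact: cc.
  - apply: continuous_mul; first exact: cc.
    apply: continuous_mul; first exact: continuous_exp.
    apply: continuous_exp; apply: continuous_add; first exact: cc.
    exact: continuous_mul.
  - apply: continuous_mul; last exact: cc.
    by do 2 apply: continuous_exp.
move=> t t0 t1.
have t1_gt0 : 0 < 1 + t by rewrite addr_gt0.
have t1_ge1 : 1 <= 1 + t by rewrite lerDl ltW.
pose A := closure Omega.
pose K1 := dilate c (1 + t) K0.
pose K := closure K1.
have c0 : K0 c by apply: BK0; rewrite /eball/= subrr enorm0.
have cK1 : @convex_set R 'rV[R]_n K1 by exact: convex_dilate.
have K01 : K0 `<=` K1 by exact: subset_dilate.
have BK1 : eball c 1 `<=` K1 by exact: subset_trans BK0 K01.
(* The inner cutoff has smoothing parameter 1, so the width [t / 2] gives it reach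
   [(1 + 1) * (t / 2) = t]. *)
have e1_0 : 0 < t / 2 by rewrite divr_gt0.
(* One factor [1 + t] is for [K1], the other absorbs its closure. *)
pose U2 := dilate c ((1 + t) * (1 + t)) U.
have mU2 : measurable U2 by exact: measurable_dilate.
have KU2 : K `<=` U2.
  move=> x /closure_enormP/(_ _ t0)[y K1y xy].
  have : dilate c (1 + t) (dilate c (1 + t) K0) x.
    by apply: (convex_dilation cK1 BK1 t0 K1y); rewrite mul1r.
  by rewrite dilate_dilate; exact: dilate_le.
have U2r := dilate_bounded (c := c) (mulr_gt0 t1_gt0 t1_gt0) Ur.
have Kr := subset_trans KU2 U2r; rewrite -/U2 in U2r Kr.
set r2 := enorm c + _ in U2r Kr.
have OK1 : Omega `<=` K1 by exact: subset_trans OK0 K01.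
have AK : A `<=` K by exact: closure_subset.
have mK : measurable K by apply: closed_measurable_rV; exact: closed_closure.
have cK : @convex_set R 'rV[R]_n K by exact: convex_closure.
have OA : Omega `<=` A by exact: subset_closure.
have K1r : K1 `<=` eball 0 r2 by apply: subset_trans Kr; exact: subset_closure.
have [pA pAP] := projection_exists (compact_closure_rV Or) (ex_intro _ c' (OA _ Oc'))
  (convex_closure cO).
have [pK pKP] := projection_exists (compact_closure_rV K1r)
  (ex_intro _ c' (AK _ (OA _ Oc'))) cK.
have N_near x : cutoff_nbhd pA (t / 2) 1 x -> exists2 a, Omega a & enorm (x - a) < t.
  move=> /(cutoff_nbhd_near pAP)[a Oa xa]; exists a => //.
  by rewrite (_ : t = (1 + 1) * (t / 2)) //; field.
have NK : cutoff_nbhd pA (t / 2) 1 `<=` K.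
  move=> x /N_near[a Oa xa]; apply: subset_closure.
  by apply: (convex_dilation cK0 BK0 t0 (OK0 _ Oa)); rewrite mul1r.
have := test_field_variation tphi M0 DM pAP pKP e1_0 t0 t0
  (subset_trans AK Kr) Kr mO OA mK NK.
move=> /le_trans; apply.
have mN : measurable (cutoff_nbhd pA (t / 2) 1).
  by apply: open_measurable_rV; exact: (cutoff_nbhd_open pAP e1_0 ltr01).
have mN' : measurable (cutoff_nbhd pK t t).
  by apply: open_measurable_rV; exact: (cutoff_nbhd_open pKP t0 t0).
have tr0 : 0 < t / r0 by rewrite divr_gt0.
have a0 : 0 < 1 + t / r0 by rewrite addr_gt0.
have tt0 : 0 < (1 + t) * t by rewrite mulr_gt0.
have b0 : 0 < 1 + (1 + t) * t by rewrite addr_gt0.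
apply: lerD.
  rewrite ler_wpM2l ?mulr_ge0// mulrBl mul1r -(vol_dilate c')//.
  have O2r := dilate_bounded (c := c') a0 Or.
  have OO2 : Omega `<=` dilate c' (1 + t / r0) Omega.
    by apply: subset_dilate => //; rewrite lerDl ltW.
  have mO2 : measurable (dilate c' (1 + t / r0) Omega) by exact: measurable_dilate.
  rewrite -(vol_setD mO mO2 OO2 O2r); apply: vol_le.
  - exact: measurableD.
  - exact: measurableD.
  - apply: setSD => x /N_near[a Oa xa].
    by apply: (convex_dilation cO Or0 tr0 Oa); rewrite mulrCA mulfV ?mulr1 ?gt_eqF.
  - by move=> x [xO _]; exact: (O2r x xO).
have volS : vol (cutoff_nbhd pK t t `\` K) <=
    n%:R * ((1 + t) * t) * (1 + (1 + t) * t) ^+ n * vol K.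
  apply: (@le_trans _ _ (((1 + (1 + t) * t) ^+ n - 1) * vol K)); last first.
    by rewrite ler_wpM2r ?vol_ge0// exp1DB_le// ltW.
  rewrite mulrBl mul1r -(vol_dilate c)//.
  have K2r := dilate_bounded (c := c) b0 Kr.
  have KK2 : K `<=` dilate c (1 + (1 + t) * t) K.
    apply: subset_dilate => //; last by rewrite lerDl ltW.
    by apply: subset_closure; exact: K01.
  have mK2 : measurable (dilate c (1 + (1 + t) * t) K) by exact: measurable_dilate.
  rewrite -(vol_setD mK mK2 KK2 K2r); apply: vol_le.
  - exact: measurableD.
  - exact: measurableD.
  - apply: setSD => x /(cutoff_nbhd_near pKP)[a K1a xa].
    apply: subset_closure.
    by apply: (convex_dilation cK1 BK1 tt0 K1a); rewrite mul1r.
  - by move=> x [xO _]; exact: (K2r x xO).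
have volK : vol K <= ((1 + t) ^+ 2) ^+ n * vol U.
  rewrite [(1 + t) ^+ 2]expr2 -(vol_dilate c)// ?mulr_gt0//.
  exact: (vol_le mK mU2 KU2 U2r).
apply: (@le_trans _ _ ((1 + t) / t * (n%:R * ((1 + t) * t) * (1 + (1 + t) * t) ^+ n * vol K))).
  by rewrite ler_wpM2l// divr_ge0 ?ltW.
rewrite (_ : _ / t * _ = n%:R * ((1 + t) ^+ 2 * (1 + (1 + t) * t) ^+ n) * vol K); last first.
  by field; rewrite gt_eqF.
rewrite ler_wpM2l//; apply: mulr_ge0 => //; apply: mulr_ge0.
  exact: sqr_ge0.
by rewrite exprn_ge0// ltW.
Qed.

End perimeter_upper_bound.

(** * Lower bound for the perimeter of the unit ball *)

Section perimeter_lower_bound.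
Context {R : realType} {n : nat}.

Lemma cvg_row (T : Type) (F : set_system T) (FF : Filter F) (f : T -> 'rV[R]_n) (l : 'rV[R]_n) :
  (forall j, f x ord0 j @[x --> F] --> l ord0 j) -> f @ F --> l.
Proof.
move=> fl; apply/cvg_ballP => e e0.
have : \forall x \near F, forall j, ball (l ord0 j) e (f x ord0 j).
  by apply: filter_forall => j; have /cvg_ballP/(_ e e0) := fl j.
by apply: filterS => x xe; split=> // i j; rewrite ord1; exact: xe.
Qed.

Lemma is_derive_taylor (f : R -> R) (y d C : R) :
  (forall h, `|f (y + h) - f y - d * h| <= C * h ^+ 2) -> is_derive y 1 f d.
Proof.
move=> fT.
have H : (fun h : R => h^-1 *: ((f \o shift y) (h *: 1) - f y)) @ 0^' --> d.
  apply/cvgrPdist_le => e e0.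
  have C0 : 0 < `|C| + 1 by rewrite ltr_wpDl.
  near=> h.
  have h0 : h != 0 by near: h; exact: nbhs_dnbhs_neq.
  have he : `|h| <= e / (`|C| + 1).
    near: h; apply: dnbhs0_le; exact: divr_gt0.
  rewrite /= [h *: 1]mulr1 (addrC h) /GRing.scale/=.
  have -> : d - h^-1 * (f (y + h) - f y) = - (h^-1 * (f (y + h) - f y - d * h)).
    by field.
  rewrite normrN normrM normfV ler_pdivrMl ?normr_gt0//.
  apply: le_trans (fT h) _; rewrite -(real_normK (num_real h)) expr2 mulrCA.
  rewrite ler_wpM2l//; apply: (@le_trans _ _ ((`|C| + 1) * `|h|)).
    by rewrite ler_wpM2r// (le_trans (ler_norm _))// lerDl.
  by rewrite mulrC -ler_pdivlMr.
apply: DeriveDef; last by rewrite /derive; apply: cvg_lim.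
by rewrite /derivable; apply/cvg_ex; eexists; exact: H.
Unshelve. all: by end_near. Qed.

(** The positive part; its square is of class C^1 and serves to build the radial cutoff. *)
Definition pos (y : R) : R := (y + `|y|) / 2.

Lemma pos_id y : 0 <= y -> pos y = y.
Proof. by move=> y0; rewrite /pos ger0_norm//; field. Qed.

Lemma pos_eq0 y : y <= 0 -> pos y = 0.
Proof. by move=> y0; rewrite /pos ler0_norm// subrr mul0r. Qed.

Lemma pos_ge0 y : 0 <= pos y.
Proof. by have [/ltW y0|y0] := ltP 0 y; [rewrite pos_id|rewrite pos_eq0]. Qed.

Lemma continuous_pos : continuous pos.
Proof.
apply: continuous_mul; last exact: continuous_cst.
by apply: continuous_add => x; [exact: cvg_id|exact: norm_continuous].
Qed.

Lemma is_derive_pos2 (y : R) : is_derive y 1 (fun y => pos y ^+ 2) (2 * pos y).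
Proof.
apply: (@is_derive_taylor _ _ _ 1) => h; rewrite mul1r.
have [y0|y0] := leP y 0; have [h0|h0] := leP (y + h) 0.
- rewrite !pos_eq0//; have := sqr_ge0 h; rewrite expr0n mulr0 mul0r !subr0 normr0.
  done.
- rewrite (pos_eq0 y0) (pos_id (ltW h0)) expr0n/= mulr0 mul0r !subr0.
  by rewrite ger0_norm ?sqr_ge0//; nra.
- rewrite (pos_eq0 h0) (pos_id (ltW y0)) expr0n/= ler_norml; apply/andP; split; nra.
- rewrite (pos_id (ltW h0)) (pos_id (ltW y0)) (_ : _ - _ - _ = h ^+ 2); last by ring.
  by rewrite ger0_norm ?sqr_ge0.
Qed.

Section radial_field.
Variables (c : 'rV[R]_n) (t : R).
Hypothesis t0 : 0 < t.

Local Notation p y := (pos y ^+ 2).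

Let sq x := dot (x - c) (x - c).
(** A C^1 function equal to 1 for [s <= 1] and to 0 for [s >= 1 + t]. Hence [chi (sq x)] vanishes
    when [|x - c| >= 1 + t], and the factor [(1 + t)^-1] of [radial_field] brings the norm below
    1. *)
Let chi (s : R) := p (1 - p (s - 1) / t ^+ 2).
Let dchi (s : R) := 2 * pos (1 - p (s - 1) / t ^+ 2) * - (2 * pos (s - 1) / t ^+ 2).

Definition radial_field (x : 'rV[R]_n) : 'rV[R]_n := ((1 + t)^-1 * chi (sq x)) *: (x - c).

Let dfield i x j : R := (1 + t)^-1 * (dchi (sq x) * (2 * (x - c) ord0 i) * (x - c) ord0 j +
  chi (sq x) * (i == j)%:R).

Let is_derive_affine (a b y : R) : is_derive y 1 (fun y => a + b * y) b.
Proof.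
apply: (@is_derive_taylor _ _ _ 0) => h.
by rewrite (_ : _ - _ - _ = 0); [rewrite normr0 mul0r|ring].
Qed.

Let is_derive_chi (s : R) : is_derive s 1 chi (dchi s).
Proof.
pose f1 (y : R) : R := -1 + 1 * y; pose f2 (y : R) : R := p y.
pose f3 (y : R) : R := 1 + - (t ^+ 2)^-1 * y.
have H2 := @is_derive1_comp R f2 f1 s _ _ (is_derive_pos2 _) (is_derive_affine (-1) 1 s).
have H3 := @is_derive1_comp R f3 (f2 \o f1) s _ _ (is_derive_affine _ _ _) H2.
have H4 := @is_derive1_comp R f2 (f3 \o (f2 \o f1)) s _ _ (is_derive_pos2 _) H3.
have E : f2 \o (f3 \o (f2 \o f1)) = chi.
  by apply/funext => y; rewrite /chi /f2 /f3 /f1 /= mul1r (addrC (-1)) mulNr (mulrC _^-1).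
rewrite E in H4; apply: is_derive_eq H4 _.
rewrite /dchi /= /f2 /f3 /f1 !mul1r (addrC (-1)) mulNr (mulrC _^-1).
by rewrite mulr1 mulNr (mulrC _^-1).
Qed.

Let is_derive_line_field x i j :
  is_derive (0 : R) 1 (fun h : R => radial_field (x + h *: 'e_i) ord0 j) (dfield i x j).
Proof.
have H1 : is_derive (0 : R) 1 (fun h : R => sq (x + h *: 'e_i)) (2 * (x - c) ord0 i).
  apply: (@is_derive_taylor _ _ _ 1) => h; rewrite add0r scale0r addr0 mul1r.
  rewrite /sq (_ : x + h *: 'e_i - c = (x - c) + h *: 'e_i); last by rewrite addrAC.
  move: (x - c) => w; rewrite !dotE (dotC 'e_i w) dot_delta_delta dot_delta.
  rewrite (_ : _ - _ - _ = h ^+ 2); last by ring.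
  by rewrite ger0_norm ?sqr_ge0.
have H2 := @is_derive1_comp R chi (fun h : R => sq (x + h *: 'e_i)) 0 _ _ (is_derive_chi _) H1.
have H3 := is_derive_affine ((x - c) ord0 j) (i == j)%:R 0.
have H4 := is_deriveM H2 H3.
have H5 := is_deriveZ (1 + t)^-1 H4.
have E : (1 + t)^-1 \*: ((chi \o (fun h : R => sq (x + h *: 'e_i))) *
   (fun h => (x - c) ord0 j + (i == j)%:R * h)) = (fun h : R => radial_field (x + h *: 'e_i) ord0 j).
  apply/funext => h.
  transitivity ((1 + t)^-1 * (chi (sq (x + h *: 'e_i)) *
    ((x - c) ord0 j + (i == j)%:R * h))); first by [].
  by rewrite /radial_field !mxE eqxx/= (eq_sym j); ring.
rewrite E in H5; apply: is_derive_eq H5 _.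
rewrite /dfield /= scale0r !addr0 mulr0 addr0 /GRing.scale/=; ring.
Qed.

Let is_derive_field x i : is_derive x 'e_i radial_field (\row_j dfield i x j).
Proof.
have H : (fun h : R => h^-1 *: ((radial_field \o shift x) (h *: 'e_i) - radial_field x)) @ 0^' -->
    \row_j dfield i x j.
  apply: cvg_row => j; rewrite mxE.
  have [+ <-] := is_derive_line_field x i j; rewrite /derivable /derive => D.
  rewrite (_ : (fun h => _) = (fun h : R => h^-1 *: (((fun h : R => radial_field (x + h *: 'e_i) ord0 j)
    \o shift 0) (h *: 1) - radial_field (x + 0 *: 'e_i) ord0 j))); first exact: D.
  apply/funext => h; rewrite /= !mxE addr0 [h *: 1]mulr1 scale0r addr0 (addrC _ x).
  by rewrite mul0r addr0 [x ord0 j + h * _]addrC.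
apply: DeriveDef; last by rewrite /derive; apply: cvg_lim.
by rewrite /derivable; apply/cvg_ex; eexists; exact: H.
Qed.

Let continuous_sq : continuous sq. Proof. exact: continuous_sqB. Qed.

Let continuous_field_derive i : continuous ('D_('e_i) radial_field).
Proof.
rewrite (_ : 'D_('e_i) radial_field = fun x => \row_j dfield i x j); last first.
  by apply/funext => x; have [_] := is_derive_field x i.
move=> x; apply: (cvg_row (nbhs_filter x)) => j.
rewrite mxE (_ : (fun _ => _) = fun x => dfield i x j); last first.
  by apply/funext => y; rewrite mxE.
have cc := @continuous_cst R 'rV[R]_n.
have cx k : continuous (fun x : 'rV[R]_n => (x - c) ord0 k).
  rewrite (_ : (fun _ => _) = fun x : 'rV[R]_n => x ord0 k - c ord0 k).
    by apply: continuous_sub; [exact: coord_continuous|exact: cc].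
  by apply/funext => y; rewrite !mxE.
have cpos (f : 'rV[R]_n -> R) : continuous f -> continuous (fun x => pos (f x)).
  by move=> cf y; apply: (@continuous_comp _ _ _ f pos); [exact: cf|exact: continuous_pos].
have cp (f : 'rV[R]_n -> R) : continuous f -> continuous (fun x => p (f x)).
  by move=> /cpos cf; exact: continuous_mul.
have c1 : continuous (fun x => sq x - 1) by exact: continuous_sub.
have c2 : continuous (fun x => 1 - p (sq x - 1) / t ^+ 2).
  apply: continuous_sub; first exact: cc.
  by apply: continuous_mul; [exact: cp|exact: cc].
have c3 : continuous (fun x => dchi (sq x)).
  apply: continuous_mul; first by apply: continuous_mul; [exact: cc|exact: cpos].
  have cg : continuous (fun x => 2 * pos (sq x - 1) / t ^+ 2).
    by apply: continuous_mul; [apply: continuous_mul; [exact: cc|exact: cpos]|exact: cc].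
  by move=> y; exact: (continuousN (cg y)).
move: x; apply: continuous_mul; first exact: cc.
apply: continuous_add; last by apply: continuous_mul; [exact: cp|exact: cc].
apply: continuous_mul; last exact: cx.
by apply: continuous_mul => //; apply: continuous_mul; [exact: cc|exact: cx].
Qed.

Lemma radial_test_field : test_field radial_field.
Proof.
split.
- move=> i; split; last exact: continuous_field_derive.
  by move=> x; have [] := is_derive_field x i.
- apply: (@compact_closure_rV _ _ _ (enorm c + (1 + t))) => x /= x0.
  rewrite /eball/= subr0 ltNge; apply/negP => xr; move/eqP: x0; apply.
  have : 1 + t <= enorm (x - c).
    by have := enormD (x - c) c; rewrite subrK; move: xr; lra.
  move=> xc; rewrite /radial_field /chi pos_eq0; first by rewrite expr0n/= mulr0 scale0r.
  rewrite subr_le0 ler_pdivlMr ?exprn_gt0// mul1r ler_sqr ?nnegrE ?pos_ge0 ?(ltW t0)//.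
  have H : t <= sq x - 1.
    rewrite lerBrDl /sq -enorm_sqr; apply: (le_trans xc).
    have := t0; move: (enorm _) xc => a xc *; nra.
  by rewrite pos_id// (le_trans _ H)// ltW.
- move=> x; rewrite /radial_field enormZ.
  have k0 : 0 < (1 + t)^-1 by rewrite invr_gt0 addr_gt0.
  have chi01 : 0 <= chi (sq x) <= 1.
    rewrite /chi sqr_ge0/= expr_le1 ?pos_ge0//.
    have [H|H] := leP (1 - p (sq x - 1) / t ^+ 2) 0; first by rewrite pos_eq0.
    by rewrite pos_id ?(ltW H)// gerBl divr_ge0 ?sqr_ge0.
  have /andP[chi0 chi1] := chi01.
  rewrite ger0_norm; last by apply: mulr_ge0 => //; exact: ltW.
  rewrite -mulrA ler_pdivrMl ?addr_gt0// mulr1.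
  have [xc|xc] := leP (enorm (x - c)) (1 + t).
    by apply: le_trans xc; rewrite ler_piMl ?enorm_ge0.
  suff -> : chi (sq x) = 0 by rewrite mul0r addr_ge0 ?(ltW t0).
  rewrite /chi pos_eq0 ?expr0n//.
  rewrite subr_le0 ler_pdivlMr ?exprn_gt0// mul1r ler_sqr ?nnegrE ?pos_ge0 ?(ltW t0)//.
  have H : t <= sq x - 1.
    rewrite lerBrDl /sq -enorm_sqr; apply: le_trans (ltW xc) _.
    have := t0; move: (enorm _) xc => a xc *; nra.
  by rewrite pos_id// (le_trans _ H)// ltW.
Qed.

Lemma radial_divergence x : eball c 1 x -> divergence radial_field x = n%:R / (1 + t).
Proof.
rewrite /eball/= enorm_lt// expr1n => xc.
rewrite /divergence; transitivity (\sum_(i < n) (1 + t)^-1).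
  apply: eq_bigr => i _; have [_ ->] := is_derive_field x i.
  have P0 : pos (sq x - 1) = 0 by rewrite pos_eq0// subr_le0 ltW.
  by rewrite mxE /dfield /dchi /chi P0 eqxx expr0n/= mul0r subr0 pos_id// expr1n; ring.
by rewrite sumr_const card_ord mulr_natl.
Qed.

End radial_field.

Lemma perimeter_eball_ge (c : 'rV[R]_n) :
  ((n%:R * vol (eball c 1))%:E <= perimeter (eball c 1))%E.
Proof.
have H (t : R) : 0 < t -> ((n%:R / (1 + t) * vol (eball c 1))%:E <= perimeter (eball c 1))%E.
  move=> t0; apply: ereal_sup_ubound.
  exists (radial_field c t); first exact: radial_test_field.
  rewrite (eq_integral (cst (n%:R / (1 + t))%:E)) => [|x]; last first.
    by rewrite inE => /(radial_divergence t) ->.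
  rewrite integral_cst; last exact: measurable_eball.
  rewrite [RHS]EFinM; congr (_ * _)%E.
  by rewrite /vol fineK// ge0_fin_numE// lebesgue_rV_eball_lty.
have [poo|] := eqVneq (perimeter (eball c 1)) +oo%E; first by rewrite poo leey.
have := H 1 ltr01; case: (perimeter _) H => // q H _ _.
rewrite lee_fin leNgt; apply/negP => qV.
set V := n%:R * _ in qV.
have V0 : 0 <= V by rewrite mulr_ge0// vol_ge0.
have VH t : 0 < t -> V <= q * (1 + t).
  move=> t0; have := H _ t0; rewrite lee_fin mulrAC ler_pdivrMr// addr_gt0//.
have q0 : 0 <= q by have := VH 1 ltr01; lra.
(* For this [t] the increment [q * t] is at most half of the gap [V - q], so [q * (1 + t)] stays
   below [V]. *)
have t0 : 0 < (V - q) / (q + 1) / 2 by rewrite !divr_gt0 ?subr_gt0 ?ltr_wpDl.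
have := VH _ t0; apply/negP; rewrite -ltNge.
have : q * ((V - q) / (q + 1) / 2) <= (V - q) / 2.
  rewrite !mulrA ler_pM2r ?invr_gt0// ler_pdivrMr ?ltr_wpDl// mulrC ler_pM2l ?subr_gt0//.
  by rewrite lerDl.
lra.
Qed.

End perimeter_lower_bound.

(** * Fraenkel asymmetry *)

Section fraenkel_estimate.
Context {R : realType} {n : nat}.
Implicit Types (x c p q y : 'rV[R]_n) (Omega : set 'rV[R]_n).

Local Notation V := (vol (eball (0 : 'rV[R]_n) 1)).

Lemma lebesgue_rV_eball c (r : R) : 0 < r ->
  lebesgue_rV (eball c r) = (r ^+ n * V)%:E.
Proof.
move=> r0; rewrite EFinM fineK ?ge0_fin_numE ?lebesgue_rV_eball_lty//.
rewrite -{2}(invrK r) -(lebesgue_rV_homothety (- r^-1 *: c)) ?invr_gt0//; last first.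
  exact: measurable_eball.
congr lebesgue_rV; apply/seteqP; split=> x; rewrite /eball/= subr0;
  rewrite (_ : - r^-1 *: c + r^-1 *: x = r^-1 *: (x - c)) ?enormZ;
  rewrite ?(gtr0_norm (_ : 0 < r^-1)) ?invr_gt0// ?ltr_pdivrMl ?mulr1//;
  by rewrite scalerBr scaleNr addrC.
Qed.

Lemma vol_eball1_gt0 : 0 < V.
Proof.
rewrite fine_gt0// lebesgue_rV_eball_lty andbT; apply: lebesgue_rV_open_gt0.
  exact: eball_open.
by exists 0; rewrite /eball/= subrr enorm0.
Qed.

(** Exact convexity of a quadratic function with constant Hessian; the defect [l (1 - l) |p - y|^2]
    drives both the hull and the far-point estimates. *)
Lemma excess_conv c p y (l : R) : excess c (l *: p + (1 - l) *: y) =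
  l * excess c p + (1 - l) * excess c y - l * (1 - l) * dot (p - y) (p - y).
Proof.
rewrite /excess (_ : _ - c = l *: (p - c) + (1 - l) *: (y - c)); last first.
  by apply/rowP => i; rewrite !mxE; ring.
rewrite (_ : p - y = (p - c) - (y - c)); last by apply/rowP => i; rewrite !mxE; ring.
by move: (p - c) (y - c) => u v; rewrite !dotE (dotC v u); ring.
Qed.

Lemma measurable_excess_le0 c : measurable [set x | excess c x <= 0].
Proof.
rewrite (_ : mkset _ = ~` [set x | 0 < excess c x]).
  apply: measurableC; apply: open_measurable_rV; apply: open_ltr.
  exact: continuous_excess.
by apply/seteqP; split=> x /=; rewrite leNgt => /negP.
Qed.

(** The closed ball lies in the open balls of radius [1 + t], whose volume [(1 + t) ^ n V] tends to
    [V]. *)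
Lemma vol_closed_ball_le c : vol [set x | excess c x <= 0] <= V.
Proof.
pose f (t : R) := (1 + t) ^+ n * V.
rewrite (_ : V = f 0); last by rewrite /f addr0 expr1n mul1r.
apply: le_at_0_of_continuous => [|t t0 t1]; rewrite /f.
  apply: continuous_mul; last exact: continuous_cst.
  apply: continuous_exp; apply: continuous_add; first exact: continuous_cst.
  by move=> x; exact: cvg_id.
have t2 : 0 < 1 + t by rewrite addr_gt0.
rewrite (_ : _ * V = vol (eball c (1 + t))); last by rewrite [RHS]/vol lebesgue_rV_eball.
apply: (@vol_le _ _ _ _ (enorm c + (1 + t))).
- exact: measurable_excess_le0.
- exact: measurable_eball.
- move=> x /=; rewrite /excess subr_le0 /eball/= => xc; rewrite enorm_lt ?(ltW t2)//.
  apply: le_lt_trans xc _; rewrite -[ltLHS](expr1n R 2) ltr_sqr ?nnegrE ?(ltW t2)//.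
  by rewrite ltrDl.
- move=> x; rewrite /eball/= subr0 => xc.
  by have := enormD c (x - c); rewrite addrC subrK => /le_lt_trans; apply; rewrite ltrD2l.
Qed.

(** Here [h], [g] and [d] stand for [H(p)], [H(b)] and [|p - b|^2], for a point
    [q = l p + (1 - l) b] with [H(q) > 0]. Dropping the term in [g] and dividing by [l] gives
    [(1 - l) d < h], hence [|q - p|^2 = (1 - l)^2 d < h]. *)
Lemma hull_arith (l h g d : R) : 0 <= l -> l <= 1 -> g < 0 -> 0 <= d ->
  0 < l * h + (1 - l) * g - l * (1 - l) * d ->
  (1 - l) ^+ 2 * d < 2 * h /\ l * h + (1 - l) * g - l * (1 - l) * d < 2 * h.
Proof.
move=> l0 l1 g0 d0 H.
have lg : (1 - l) * g <= 0 by rewrite mulr_ge0_le0 ?subr_ge0// ltW.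
have ld : 0 <= (1 - l) * d by rewrite mulr_ge0 ?subr_ge0.
have lp : 0 < l.
  rewrite lt_def l0 andbT; apply/eqP => l00; rewrite l00 in H; lra.
have H2 : (1 - l) * d < h.
  by rewrite -(ltr_pM2l lp); lra.
have H3 : (1 - l) ^+ 2 * d <= (1 - l) * d.
  by rewrite expr2 -mulrA ler_piMl// gerBl.
have h0 : 0 < h by exact: le_lt_trans ld H2.
have lh : l * h <= h by rewrite ler_piMl// ltW.
by have lld := mulr_ge0 l0 ld; split; lra.
Qed.

(** The worst case is [h = 1/16], [g = 0], [d = 4 + 1/8], where the inequality reads [L h >= d],
    that is [L >= 66]; 128 is the next power of two. *)
Lemma far_point_arith (L h g d : R) : L = 128 -> 1 / 16 < h -> - 1 <= g -> g < 0 ->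
  d <= 2 * (1 + h) + 2 * (1 + g) -> 0 <= d ->
  0 <= (1 - L^-1) * h + (1 - (1 - L^-1)) * g - (1 - L^-1) * (1 - (1 - L^-1)) * d.
Proof. by move=> -> *; lra. Qed.

(* The contraction of ratio 1 / L towards p sends the part of Omega inside the
   ball to a part of Omega outside the ball. *)
Lemma far_point_bound Omega c p (L : R) : L = 128 -> open Omega ->
  @convex_set R 'rV[R]_n Omega -> Omega p -> 1 / 16 < excess c p ->
  lebesgue_rV (Omega `+` eball c 1) \is a fin_num ->
  V <= (1 + L ^+ n) * fine (lebesgue_rV (Omega `+` eball c 1)).
Proof.
move=> LE oO cO Op H1; set D := Omega `+` eball c 1 => Dfin.
have L0 : 0 < L by rewrite LE ltr0n.
have mO : measurable Omega by exact: open_measurable_rV.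
have mB : measurable (eball c 1) by exact: measurable_eball.
pose T y : 'rV[R]_n := (1 - L^-1) *: p + L^-1 *: y.
have L1 : 0 <= L^-1 <= 1 by rewrite invr_ge0 (ltW L0) invf_le1// LE ler1n.
have OB y : (Omega `&` eball c 1) y -> (Omega `\` eball c 1) (T y).
  move=> [Oy]; rewrite eballE => yB; have /andP[l0 l1] := L1.
  have TE : T y = (1 - L^-1) *: p + (1 - (1 - L^-1)) *: y by rewrite subKr.
  split; first by rewrite TE; apply: convex_setP => //; rewrite ?subr_ge0// gerBl.
  rewrite eballE TE excess_conv; apply/negP; rewrite -leNgt.
  apply: far_point_arith => //; last exact: dot_ge0.
    by rewrite /excess lerBrDl addrN dot_ge0.
  rewrite /excess !subrKC (_ : p - y = (p - c) - (y - c)); last first.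
    by apply/rowP => i; rewrite !mxE; ring.
  have := dot_ge0 ((p - c) + (y - c)); move: (p - c) (y - c) => u v.
  by rewrite !dotE (dotC v u); lra.
have mDO : measurable (Omega `\` eball c 1) by exact: measurableD.
have mBO : measurable (eball c 1 `\` Omega) by exact: measurableD.
have mOB : measurable (Omega `&` eball c 1) by exact: measurableI.
have mD : measurable D by exact: measurableU.
have h1 : (lebesgue_rV (Omega `&` eball c 1) <= (L ^+ n)%:E * lebesgue_rV D)%E.
  rewrite -[X in (X ^+ n)%:E](invrK L) -(lebesgue_rV_homothety ((1 - L^-1) *: p)) ?invr_gt0//.
  apply: le_measure; rewrite ?inE//.
    by rewrite -[X in measurable X]setTI; exact: measurable_homothety_rV.
  by move=> z /OB Tz; left.
have h2 : (lebesgue_rV (eball c 1) <= lebesgue_rV D + lebesgue_rV (Omega `&` eball c 1))%E.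
  apply: (@le_trans _ _ (lebesgue_rV (D `|` (Omega `&` eball c 1)))).
    apply: le_measure; rewrite ?inE//; first exact: measurableU.
    move=> y By; have [Oy|Oy] := pselect (Omega y); first by right.
    by left; right.
  exact: measureU2.
rewrite lebesgue_rV_eball// expr1n mul1r in h2.
rewrite -lee_fin; apply: le_trans h2 _.
rewrite EFinM fineK// EFinD ge0_muleDl ?lee_fin ?exprn_ge0 ?(ltW L0)// mul1e.
exact: leeD2l.
Qed.

(** As [Omega] and the ball are convex, the segments joining one to the other already fill the
    convex hull of their union. *)
Definition hull c Omega : set 'rV[R]_n :=
  [set q | exists p b (l : R), [/\ Omega p, eball c 1 b, 0 <= l, l <= 1 &
    q = l *: p + (1 - l) *: b]].

Lemma convex_eball c (r : R) : @convex_set R 'rV[R]_n (eball c r).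
Proof.
apply: convex_setI => x y t t0 t1; rewrite /eball/= => xr yr.
rewrite (_ : _ - c = t *: (x - c) + (1 - t) *: (y - c)); last first.
  by apply/rowP => i; rewrite !mxE; ring.
apply: le_lt_trans (enormD _ _) _; rewrite !enormZ !ger0_norm ?subr_ge0//.
have [->|tn] := eqVneq t 0; first by rewrite mul0r add0r subr0 mul1r.
have tp : 0 < t by rewrite lt_def tn.
have : t * enorm (x - c) < t * r by rewrite ltr_pM2l.
have : (1 - t) * enorm (y - c) <= (1 - t) * r by rewrite ler_wpM2l ?subr_ge0// ltW.
lra.
Qed.

(** In a combination of two points of the hull, the parts from [Omega], of total weight [m], merge
    into one point of [Omega], and those from the ball, of weight [1 - m], into one point of the
    ball; a zero weight leaves the point arbitrary. *)
Lemma convex_hull c Omega : @convex_set R 'rV[R]_n Omega ->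
  @convex_set R 'rV[R]_n (hull c Omega).
Proof.
move=> cO; apply: convex_setI => _ _ t t0 t1 [p [b [l [Op Bb l0 l1 ->]]]]
  [p' [b' [l' [Op' Bb' l0' l1' ->]]]].
pose m := t * l + (1 - t) * l'.
have m0 : 0 <= m by rewrite addr_ge0// mulr_ge0// subr_ge0.
have m1 : 0 <= 1 - m.
  rewrite (_ : 1 - m = t * (1 - l) + (1 - t) * (1 - l')); last by rewrite /m; ring.
  by rewrite addr_ge0// mulr_ge0// subr_ge0.
have mix A (x y : 'rV[R]_n) (a a' s : R) : @convex_set R 'rV[R]_n A -> A x -> A y ->
    0 <= a -> 0 <= a' -> s = a + a' -> exists2 z, A z & a *: x + a' *: y = s *: z.
  move=> cA Ax Ay a0 a0' ->.
  have [s0|s0] := eqVneq (a + a') 0.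
    exists x => //; have -> : a = 0 by lra.
    have -> : a' = 0 by lra.
    by rewrite addr0 !scale0r addr0.
  have sp : 0 < a + a' by rewrite lt_def s0 addr_ge0.
  have := convex_setP cA (t := a / (a + a')) (x := x) (y := y).
  rewrite divr_ge0 ?addr_ge0// ler_pdivrMr// mul1r lerDl a0' => /(_ isT isT Ax Ay) Az.
  exists (a / (a + a') *: x + (1 - a / (a + a')) *: y) => //.
  by apply/rowP => i; rewrite !mxE; field.
have [|||p2 Op2 Ep] := mix Omega p p' (t * l) ((1 - t) * l') m cO Op Op' => //.
- exact: mulr_ge0.
- by rewrite mulr_ge0// subr_ge0.
have [|||b2 Bb2 Eb] := mix (eball c 1) b b' (t * (1 - l)) ((1 - t) * (1 - l')) (1 - m)
  (@convex_eball c 1) Bb Bb'.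
- by rewrite mulr_ge0// subr_ge0.
- by rewrite mulr_ge0// subr_ge0.
- by rewrite /m; ring.
exists p2, b2, m; split=> //; first by rewrite -subr_ge0.
by rewrite -Ep -Eb; apply/rowP => i; rewrite !mxE; ring.
Qed.

(** The hull is covered by the closed unit ball and the open set of [hull_excess_bound], which gives
    [perimeter_le] a measurable set of controlled volume. *)
Lemma near_ball_bound Omega c (M r : R) : M = 8192 -> open Omega ->
  @convex_set R 'rV[R]_n Omega -> Omega !=set0 -> Omega `<=` eball 0 r ->
  (forall p, Omega p -> excess c p <= 1 / 16) ->
  lebesgue_rV (Omega `+` eball c 1) \is a fin_num ->
  (perimeter Omega <= (n%:R * (V + (1 + 2 ^+ n) * M ^+ n *
     fine (lebesgue_rV (Omega `+` eball c 1))))%:E)%E.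
Proof.
move=> ME oO cO O0 Or near Dfin.
have M0 : 0 < M by rewrite ME ltr0n.
have := hull_excess_bound ME oO cO near; set X := mkset _ => -[oX muX].
pose cB : set 'rV[R]_n := [set x | excess c x <= 0].
have mcB : measurable cB by exact: measurable_excess_le0.
have mX : measurable X by exact: open_measurable_rV.
have cBr : cB `<=` eball 0 (enorm c + 2).
  move=> x; rewrite /cB/= /excess subr_le0 => xc; rewrite /eball/= subr0.
  have : enorm (x - c) <= 1 by rewrite enorm_le// expr1n.
  by have := enormD c (x - c); rewrite addrC subrK; lra.
have Xr : X `<=` eball 0 (r + 1).
  move=> q [_ [p [Op qp _]]]; have pO := near p Op.
  have qp1 : enorm (q - p) < 1 by rewrite enorm_lt// expr1n; lra.
  have := Or p Op; rewrite /eball/= !subr0 => pr.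
  by have := enormD p (q - p); rewrite addrC subrK; lra.
pose r2 := Num.max (enorm c + 2) (r + 1).
have big (s : R) : s <= r2 -> eball (0 : 'rV[R]_n) s `<=` eball 0 r2.
  by move=> sr x; rewrite /eball/= => /lt_le_trans; apply.
have cBr2 : cB `<=` eball 0 r2.
  by apply: subset_trans cBr _; apply: big; rewrite le_max lexx.
have Xr2 : X `<=` eball 0 r2.
  by apply: subset_trans Xr _; apply: big; rewrite le_max lexx orbT.
have Ur2 : cB `|` X `<=` eball 0 r2 by move=> x [/cBr2|/Xr2].
have mU : measurable (cB `|` X) by exact: measurableU.
have [p0 Op0] := O0.
have hU : hull c Omega `<=` cB `|` X.
  move=> q [p [b [l [Op Bb l0 l1 qE]]]].
  have [q0|q0] := leP (excess c q) 0; [by left|right; split=> //; exists p].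
  have Hq := excess_conv c p b l; rewrite -qE in Hq.
  rewrite eballE in Bb.
  have qp : dot (q - p) (q - p) = (1 - l) ^+ 2 * dot (p - b) (p - b).
    rewrite (_ : q - p = - ((1 - l) *: (p - b))); last first.
      by rewrite qE; apply/rowP => i; rewrite !mxE; ring.
    by rewrite !dotE; ring.
  rewrite qp; rewrite Hq in q0 *; have := dot_ge0 (p - b).
  move: (dot _ _) (excess c p) (excess c b) q0 Bb => d h g q0 g0 d0.
  have [hd hq] := hull_arith l0 l1 g0 d0 q0.
  by split.
have BK : eball c 1 `<=` hull c Omega.
  by move=> b Bb; exists p0, b, 0; split=> //; rewrite scale0r add0r subr0 scale1r.
have OK : Omega `<=` hull c Omega.
  move=> p Op; exists p, c, 1; split=> //.
    by rewrite /eball/= subrr enorm0.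
  by rewrite subrr scale0r addr0 scale1r.
have := perimeter_le oO O0 cO (convex_hull cO) OK BK mU hU Ur2.
move=> /le_trans; apply; rewrite lee_fin ler_wpM2l//.
have volU : vol (cB `|` X) <= vol cB + vol X.
  rewrite -lee_fin EFinD -(volE mU Ur2) -(volE mcB cBr2) -(volE mX Xr2).
  exact: measureU2.
apply: le_trans volU _; apply: lerD; first exact: vol_closed_ball_le.
move: muX; rewrite (volE mX Xr2) -(fineK Dfin) -EFinM lee_fin.
rewrite -invfM ler_pdivrMl ?mulr_gt0 ?exprn_gt0 ?addr_gt0 ?exprn_gt0//.
Qed.

End fraenkel_estimate.

Theorem proposition3p1 (R : realType) (n : nat) (n_ge2 : (2 <= n)%N) :
  exists delta C : R, [/\ 0 < delta, 0 < C &
    forall (x0 : 'rV[R]_n) (Omega : set 'rV[R]_n),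
      open Omega -> bounded_set Omega -> @convex_set R 'rV[R]_n Omega ->
      lebesgue_rV Omega = lebesgue_rV (eball x0 1) ->
      (perimeter Omega - perimeter (eball x0 1) < delta%:E)%E ->
      (C%:E * (perimeter Omega - perimeter (eball x0 1))
         <= fraenkel_asymmetry Omega)%E].
Proof.
(* Introducing the two ratios through equations keeps the numerals opaque in the powers below. *)
have [M ME] : exists M : R, M = 8192 by exists 8192.
have [L LE] : exists L : R, L = 128 by exists 128.
have M0 : 0 < M by rewrite ME ltr0n.
have L0 : 0 < L by rewrite LE ltr0n.
have V0 := @vol_eball1_gt0 R n; set V := vol _ in V0.
have n0 : 0 < n%:R :> R by rewrite ltr0n (leq_trans _ n_ge2).
pose k : R := (1 + 2 ^+ n) * M ^+ n.
have k0 : 0 < k by rewrite mulr_gt0 ?exprn_gt0// addr_gt0 ?exprn_gt0.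
have l0 : 0 < 1 + L ^+ n by rewrite addr_gt0 ?exprn_gt0.
have k1 : 0 < n%:R * k * V by rewrite mulr_gt0// mulr_gt0.
(* The first entry serves a centre far from fitting [Omega], where a deficit below 1 faces a
   symmetric difference of volume at least [V / (1 + L ^ n)]; the second serves the centres for
   which [excess] is at most [1/16] on [Omega]. *)
pose C := Num.min (1 + L ^+ n)^-1 (n%:R * k * V)^-1.
have C0 : 0 < C by rewrite lt_min !invr_gt0 l0 k1.
exists 1, C; split=> // x0 Omega oO bO cO OV Pd.
have VE : lebesgue_rV Omega = V%:E.
  by rewrite OV lebesgue_rV_eball// expr1n mul1r.
have O0 : Omega !=set0.
  apply/set0P/negP => /eqP OE.
  have /(congr1 fine)/= V00 : (V%:E = 0)%E by rewrite -VE OE measure0.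
  by rewrite V00 ltxx in V0.
apply: le_ereal_inf_tmp => _ [x [r [r0 rV ->]]].
have r1 : r = 1.
  move: rV; rewrite lebesgue_rV_eball// VE => /(congr1 fine)/=.
  rewrite -[RHS]mul1r => /(mulIf (lt0r_neq0 V0))/eqP.
  by rewrite pexpr_eq1 ?(leq_trans _ n_ge2)// ?ltW// => /eqP.
rewrite {r r0 rV}r1 VE.
set D := Omega `+` eball x 1.
have mD : measurable D.
  by apply: measurableU; apply: measurableD; apply: open_measurable_rV => //; exact: eball_open.
have Dfin : lebesgue_rV D = (fine (lebesgue_rV D))%:E.
  rewrite fineK// ge0_fin_numE//.
  apply: (@le_lt_trans _ _ (lebesgue_rV (Omega `|` eball x 1))).
    apply: le_measure; rewrite ?inE//.
      by apply: measurableU; apply: open_measurable_rV => //; exact: eball_open.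
    by move=> y [[Oy _]|[By _]]; [left|right].
  apply: (@le_lt_trans _ _ (lebesgue_rV Omega + lebesgue_rV (eball x 1))%E).
    by apply: measureU2; apply: open_measurable_rV => //; exact: eball_open.
  by rewrite VE lebesgue_rV_eball// lte_add_pinfty// ltry.
rewrite Dfin; set d := fine _.
have d0 : 0 <= d by exact: fine_ge0.
have -> : (d%:E / V%:E = (d / V)%:E)%E by rewrite inver gt_eqF.
have Dfin' : lebesgue_rV D \is a fin_num by rewrite Dfin.
have [near|/existsNP[p /not_implyP[Op /negP]]] :=
    pselect (forall p, Omega p -> excess x p <= 1 / 16); last first.
  rewrite -ltNge => far.
  have Vd := far_point_bound LE oO cO Op far Dfin'.
  apply: (@le_trans _ _ (C%:E * 1%:E)%E).
    by apply: lee_wpmul2l; [rewrite lee_fin ltW|exact: ltW].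
  rewrite mule1 lee_fin ler_pdivlMr//.
  apply: (@le_trans _ _ ((1 + L ^+ n)^-1 * V)); first by rewrite ler_pM2r// ge_min lexx.
  by rewrite ler_pdivrMl.
have [r _ Or] := bounded_set_eball bO.
have PO := near_ball_bound ME oO cO O0 Or near Dfin'.
(* The reference ball is centred at [x0] and the competitor at [x]; the two estimates meet because
   only the common volume [V] enters. *)
have PB := perimeter_eball_ge x0.
have volB : vol (eball x0 1) = V by rewrite [LHS]/vol lebesgue_rV_eball// expr1n mul1r.
rewrite volB in PB.
apply: (@le_trans _ _ (C%:E * (n%:R * k * d)%:E)%E).
  apply: lee_wpmul2l; first by rewrite lee_fin ltW.
  apply: le_trans (leeB PO PB) _; rewrite -EFinB lee_fin -/V -/k -/D -/d.
  by rewrite mulrDr addrAC subrr add0r mulrA.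
rewrite -EFinM lee_fin ler_pdivlMr//.
rewrite (_ : C * _ * V = C * (n%:R * k * V) * d); last by ring.
by rewrite -[leRHS]mul1r ler_wpM2r// -ler_pdivlMr// mul1r ge_min lexx orbT.
Qed.
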